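(* For every integer $n \geq 1$, let $\mathbb{P}^{(n)} = \{p_1 \cdots p_k : 1 \leq k \leq n \text{ and } p_1, \dots, p_k \in \mathbb{P}\}$, where $\mathbb{P}$ is the set of prime numbers (so $\mathbb{P}^{(n)}$ is the set of positive integers having between $1$ and $n$ prime factors, counted with multiplicity). Then for every $n \geq 1$, $$\operatorname{doa}(\mathbb{P}^{(n)}) = 2^n.$$ In particular, when $n=1$, $\operatorname{doa}(\mathbb{P}) = 2$; that is, the set of primes is $2$-accessible.
   Context: $\mathbb{N}$ denotes the set of positive integers. An $r$-coloring of $\mathbb{N}$ is a function from $\mathbb{N}$ to a set with $r$ elements (usually $\{1,\dots,r\}$). A set $A \subseteq \mathbb{N}$ is monochromatic with respect to a coloring $\chi$ if $\chi$ is constant on $A$. For $D \subseteq \mathbb{N}$, a $k$-term $D$-diffsequence is a sequence of positive integers $x_1, x_2, \dots, x_k$ with $x_{i+1} - x_i \in D$ for all $1 \leq i \leq k-1$. A set $D \subseteq \mathbb{N}$ is $r$-accessible if, for every $r$-coloring of $\mathbb{N}$ and every $k \geq 1$, there exists a monochromatic $k$-term $D$-diffsequence. The degree of accessibility $\operatorname{doa}(D)$ is the greatest positive integer $r$ for which $D$ is $r$-accessible; if $D$ is $r$-accessible for every $r \in \mathbb{N}$, then $\operatorname{doa}(D) = \infty$. *)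

(* Defs.v *)
From mathcomp Require Import all_boot.
From mathcomp Require Import boolp classical_sets.

Set Implicit Arguments.
Unset Strict Implicit.
Unset Printing Implicit Defensive.

Local Open Scope classical_set_scope.

(* Sets of positive integers are encoded as [set nat].  An r-colouring of the
   positive integers is a map [nat -> 'I_r]; its value at 0 is never used,
   since the terms of a diffsequence are required to be positive. *)

Definition monochromatic (r : nat) (chi : nat -> 'I_r) (A : set nat) : Prop :=
  forall x y, A x -> A y -> chi x = chi y.

(* The conjunct [nth 0 s i < nth 0 s i.+1] makes the truncated subtraction
   exact; it loses nothing, since D is meant to consist of positive integers. *)
Definition diffsequence (D : set nat) (s : seq nat) : Prop :=
  (forall x, x \in s -> 0 < x) /\
  (forall i, i.+1 < size s ->
     nth 0 s i < nth 0 s i.+1 /\ D (nth 0 s i.+1 - nth 0 s i)).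

Definition accessible (r : nat) (D : set nat) : Prop :=
  forall (chi : nat -> 'I_r) (k : nat), 1 <= k ->
    exists s : k.-tuple nat,
      diffsequence D s /\ monochromatic chi [set x | x \in (s : seq nat)].

(* [Some r] is the finite degree r, [None] the infinite degree. *)
Definition is_doa (D : set nat) (d : option nat) : Prop :=
  match d with
  | Some r => [/\ 0 < r, accessible r D
                & forall s, 0 < s -> accessible s D -> s <= r]
  | None => forall r, 0 < r -> accessible r D
  end.

(* The default [Some 0] is taken only when D is not r-accessible for any
   positive r. *)
Definition doa (D : set nat) : option nat := xget (Some 0) (is_doa D).

Lemma is_doa_inj (D : set nat) (d e : option nat) :
  is_doa D d -> is_doa D e -> d = e.
Proof.
case: d e => [r|] [s|] //=.
- move=> [r0 ar mr] [s0 as_ ms].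
  by congr (Some _); apply/eqP; rewrite eqn_leq ms // mr.
- by move=> [r0 ar mr] h; have := mr r.+1 isT (h r.+1 isT); rewrite ltnn.
- by move=> h [r0 ar mr]; have := mr s.+1 isT (h s.+1 isT); rewrite ltnn.
Qed.

Lemma doaE (D : set nat) (d : option nat) : is_doa D d -> doa D = d.
Proof.
by move=> h; apply: (@is_doa_inj D) => //; rewrite /doa; apply: xgetPex; exists d.
Qed.

Definition primes_set : set nat := [set p | prime p].

Definition almost_primes (n : nat) : set nat :=
  [set m | exists ps : seq nat,
     [/\ 1 <= size ps <= n, forall p, p \in ps -> primes_set p
       & m = \prod_(p <- ps) p]].

(* Main.v *)
(** Upper bound: colour [x] by its residue modulo [2 ^ n], except that the
    multiples of [3 ^ n.+1] get one extra colour.  Consecutive terms of a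
    monochromatic diffsequence then differ by a multiple of [3 ^ n.+1], which has
    too many prime factors, or by a multiple of [2 ^ n], hence by [2 ^ n] itself;
    an arithmetic progression of step [2 ^ n] meets the multiples of [3 ^ n.+1].

    Lower bound: let [chi] be a [2 ^ n]-colouring whose monochromatic
    diffsequences have at most [k] terms, and let [h x] be one less than the
    length of the longest one ending at [x].  In a bounded window there are
    [i < j] with [m = j - i < 2 ^ n] and equally coloured [x + i], [x + j], since
    otherwise [chi] would be [2 ^ n]-periodic there and [2 ^ n] is itself an
    allowed difference.  Restrict to a set [A] of [x] of positive density on which
    [i], [j], the colour and both heights are constant.  If two elements of [A]
    differ by [m (p - 1)], then [y + j] and [x + i] differ by the almost prime
    [m p], so the height at [j] exceeds the height at [i]; if they differ by
    [m (p + 1)], the opposite holds.  Both kinds of differences do occur: this is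
    the recurrence theorem of Sarkozy for shifted primes.

    The recurrence theorem follows, by positivity of a Toeplitz form, from the
    existence of probability weights on the primes such that the cosine sum
    over [p - s], for [s = 1] or [s = -1], is nowhere less than [- eps]
    (Kamae and Mendes France).  The weights average over primes congruent to [s]
    modulo a rapidly growing sequence of moduli: near rationals with small
    denominator the cosines are controlled by divisibility, elsewhere by
    cancellation in exponential sums over primes.  That cancellation is obtained
    from a Selberg sieve majorant written in Ramanujan sums, and the infinitude
    (with positive upper density) of primes in the progression from a proof of
    Dirichlet's theorem with real convolution operators instead of characters. *)

Require Import Defs.
From mathcomp Require Import all_boot all_order all_algebra.
From mathcomp Require Import boolp classical_sets reals sequences exp trigo.
From mathcomp Require Rstruct.
From mathcomp Require Import ring lra zify.
Set Implicit Arguments.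
Unset Strict Implicit.
Unset Printing Implicit Defensive.
Import Order.TTheory GRing.Theory Num.Theory.
Local Open Scope ring_scope.

(** The number [2 ^ n] enters the lower bound twice: an [m < 2 ^ n] has fewer than [n] prime
    factors, so [m p] is still an allowed difference, and [2 ^ n] is the largest power of two that
    is one.

    Only a qualitative saving is needed in the exponential sums, with a range of denominators
    depending on [eps] alone and [N] large. But no logarithm may be lost. Hence all scales are
    powers of one [y] with [log N / log y] bounded, primes and rough numbers are compared with
    majorants of mean of order [1 / log y], and each saving is a large constant such as [s].
    Ramanujan sums suit this because they are orthogonal, which makes the mean square of the sieve
    diagonal, and because [c_r] has period [r], which confines large Fourier coefficients to the
    neighbourhood of rationals whose denominator divides some [r r'].

    In a fixed progression only positive upper density is available, without control of the scale.
    The moduli are therefore fixed before the ranges of primes. *)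

(** * Squarefree numbers *)

Lemma perm_primesM (p t : nat) : prime p -> ~~ (p %| t)%N -> (0 < t)%N ->
  perm_eq (primes (p * t)) (p :: primes t).
Proof.
move=> pp pt t0; apply: uniq_perm; rewrite ?primes_uniq //=.
  by rewrite primes_uniq mem_primes (negbTE pt) !andbF.
move=> q; rewrite primesM ?(prime_gt0 pp) // in_cons; congr (_ || _).
by rewrite primes_prime // inE.
Qed.

Definition sqfree (n : nat) := (0 < n)%N && all (fun p => ~~ (p ^ 2 %| n)%N) (primes n).

Lemma sqfree_gt0 n : sqfree n -> (0 < n)%N.
Proof. by case/andP. Qed.

Lemma sqfreeP n : reflect ((0 < n)%N /\ forall p, prime p -> ~~ (p ^ 2 %| n)%N) (sqfree n).
Proof.
apply: (iffP andP) => [[n0 /allP h]|[n0 h]]; split=> //.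
  move=> p pp; apply/negP => d; have /h : p \in primes n.
    by rewrite mem_primes pp n0 (dvdn_trans _ d) // -{1}(expn1 p) dvdn_exp2l.
  by rewrite d.
by apply/allP => p; rewrite mem_primes => /andP[pp _]; apply: h.
Qed.

Lemma sqfree_dvd d n : (d %| n)%N -> sqfree n -> sqfree d.
Proof.
move=> dn /sqfreeP[n0 h]; apply/sqfreeP; split; first exact: dvdn_gt0 dn.
by move=> p pp; apply: contra (h p pp) => /dvdn_trans; apply.
Qed.

Lemma sqfree_primeM p t : prime p -> ~~ (p %| t)%N -> sqfree (p * t) = sqfree t.
Proof.
move=> pp pt; apply/idP/idP => [|/sqfreeP[t0 h]].
  by apply: sqfree_dvd; rewrite dvdn_mull.
apply/sqfreeP; split; first by rewrite muln_gt0 prime_gt0.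
move=> q qq; have [->|qp] := eqVneq q p.
  by rewrite expnS expn1 dvdn_pmul2l ?prime_gt0.
rewrite Gauss_dvdr ?h // coprimeXl // prime_coprime // dvdn_prime2 //.
Qed.

Lemma sqfree_factor p r : sqfree r -> prime p -> (p %| r)%N ->
  exists t, [/\ r = (p * t)%N, ~~ (p %| t)%N & sqfree t].
Proof.
move=> sr pp /dvdnP[t rE]; exists t.
have rE' : r = (p * t)%N by rewrite mulnC.
have pt : ~~ (p %| t)%N.
  case/sqfreeP: sr => _ /(_ p pp); apply: contra => pt.
  by rewrite rE' expnS expn1 dvdn_pmul2l ?prime_gt0.
by split=> //; rewrite -(sqfree_primeM pp pt) -rE'.
Qed.

Lemma sqfree_ind (P : nat -> Prop) : P 1%N ->
  (forall p t, prime p -> ~~ (p %| t)%N -> sqfree t -> P t -> P (p * t)%N) ->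
  forall r, sqfree r -> P r.
Proof.
move=> P1 PS r; have [n] := ubnP r; elim: n r => // n IHn r; rewrite ltnS => rn sr.
have [r1|r1] := leqP r 1.
  by have -> : r = 1%N by apply/eqP; rewrite eqn_leq r1 sqfree_gt0.
have [t [rE pt st]] := sqfree_factor sr (pdiv_prime r1) (pdiv_dvd r).
rewrite rE; apply: PS => //; first exact: pdiv_prime.
apply: IHn => //; apply: leq_trans rn; rewrite rE.
by rewrite -{1}(mul1n t) ltn_mul2r sqfree_gt0 //= prime_gt1 // pdiv_prime.
Qed.

Lemma sqfree_square_factor n : (0 < n)%N -> exists a b, [/\ sqfree a, n = (a * b ^ 2)%N & (0 < b)%N].
Proof.
have [m] := ubnP n; elim: m n => // m IHm n; rewrite ltnS => nm n0.
have [sn|] := boolP (sqfree n); first by exists n, 1%N; rewrite exp1n muln1.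
rewrite /sqfree n0 /= => /allPn[p]; rewrite mem_primes => /andP[pp _] /negbNE/dvdnP[k kE].
have k0 : (0 < k)%N by move: n0; rewrite kE muln_gt0 => /andP[].
have p2 : (1 < p ^ 2)%N by rewrite -{1}(exp1n 2) ltn_exp2r // prime_gt1.
have km : (k < m)%N.
  by apply: leq_trans nm; rewrite kE -{1}(muln1 k) ltn_pmul2l.
have [a [b [sa kE' b0]]] := IHm k km k0.
exists a, (b * p)%N; split=> //; last by rewrite muln_gt0 b0 prime_gt0.
by rewrite kE kE' expnMn mulnA.
Qed.

(** * Multiplicative functions *)

Section PrimeProducts.
Context {R : realType}.
Implicit Types (F : nat -> R).

Definition primeprod F n : R := \prod_(p <- primes n) F p.

Lemma primeprod1 F : primeprod F 1 = 1.
Proof. by rewrite /primeprod big_nil. Qed.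

Lemma primeprodM F p t : prime p -> ~~ (p %| t)%N -> (0 < t)%N ->
  primeprod F (p * t) = F p * primeprod F t.
Proof. by move=> *; rewrite /primeprod (perm_big _ (perm_primesM _ _ _)) ?big_cons. Qed.

Lemma primeprod_mul F1 F2 n :
  primeprod (fun p => F1 p * F2 p) n = primeprod F1 n * primeprod F2 n.
Proof. by rewrite /primeprod big_split. Qed.

Lemma eq_primeprod F1 F2 n : (forall p, prime p -> (p %| n)%N -> F1 p = F2 p) ->
  primeprod F1 n = primeprod F2 n.
Proof.
move=> h; rewrite /primeprod big_seq [RHS]big_seq; apply: eq_bigr => p.
by rewrite mem_primes => /and3P[pp _ pn]; apply: h.
Qed.

(** Euler's totient on squarefree arguments; elsewhere multiplicities are ignored, for instance
    [phi 4 = 1]. *)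
Definition phi : nat -> R := primeprod (fun p => p%:R - 1).
(* Agrees with the Moebius function on squarefree arguments only; see [mu] below. *)
Definition mob : nat -> R := primeprod (fun=> -1).

Lemma prime_ge2 p : prime p -> 2 <= p%:R :> R.
Proof. by move=> /prime_gt1; rewrite (ler_nat R 2). Qed.

Lemma phi_ge1 n : 1 <= phi n.
Proof.
rewrite /phi /primeprod big_seq; elim/big_ind: _ => // [x y hx hy|p].
  by rewrite -[1]mulr1 ler_pM.
by rewrite mem_primes => /andP[/prime_ge2 h _]; lra.
Qed.

Lemma phi_gt0 n : 0 < phi n.
Proof. exact: lt_le_trans ltr01 (phi_ge1 n). Qed.

Lemma phi_ge0 n : 0 <= phi n.
Proof. exact: ltW (phi_gt0 n). Qed.

Lemma phi_le n : sqfree n -> phi n <= n%:R.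
Proof.
elim/sqfree_ind => [|p t pp pt st IH]; first by rewrite /phi primeprod1.
rewrite /phi primeprodM ?sqfree_gt0 // natrM ler_pM //.
- by have := prime_ge2 pp; lra.
- exact: le_trans (phi_ge1 t).
- by rewrite gerDl lerN10.
Qed.

Lemma mob_sqr n : mob n ^+ 2 = 1.
Proof.
by rewrite /mob expr2 -primeprod_mul /primeprod big1 // => p _; rewrite mulrNN mulr1.
Qed.

Lemma norm_mob n : `|mob n| = 1.
Proof.
by apply/eqP; rewrite -(@eqrXn2 _ 2) // expr1n real_normK ?num_real // mob_sqr.
Qed.

End PrimeProducts.

(** * Estimates of Chebyshev and Mertens *)

Section Chebyshev.

Lemma dvdn_prod_primes (s : seq nat) m : uniq s -> all prime s -> all (fun p => p %| m)%N s ->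
  ((\prod_(p <- s) p) %| m)%N.
Proof.
elim: s => [|p s IH] /=; first by rewrite big_nil dvd1n.
move=> /andP[ps us] /andP[pp aps] /andP[pm dm]; rewrite big_cons Gauss_dvd ?pm ?IH //.
rewrite big_seq; elim/big_ind: _ => [|x y|q qs]; rewrite ?coprimen1 //.
  by rewrite coprimeMr => -> ->.
rewrite prime_coprime // dvdn_prime2 //; last exact: (allP aps).
by apply: contra ps => /eqP ->.
Qed.

(** Row [2m + 1] has two equal middle coefficients, which together are at most the row sum
    [2 ^ (2m + 1)]. *)
Lemma bin_odd_mid_le m : ('C(m.*2.+1, m) <= 4 ^ m)%N.
Proof.
suff h : (2 * 'C(m.*2.+1, m) <= 2 ^ m.*2.+1)%N.
  by rewrite -(leq_pmul2l (isT : (0 < 2)%N)) (leq_trans h) // expnS -mul2n expnM.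
have <- : (\sum_(i < m.*2.+2) 'C(m.*2.+1, i) = 2 ^ m.*2.+1)%N.
  by rewrite -[2%N]/(1 + 1)%N expnDn; apply: eq_bigr => i _; rewrite !exp1n !muln1.
have hm : (m < m.*2.+2)%N by lia.
have hm1 : (m.+1 < m.*2.+2)%N by lia.
rewrite (bigD1 (Ordinal hm)) //= (bigD1 (Ordinal hm1)) /=; last by rewrite -val_eqE /= gtn_eqF.
rewrite mul2n -addnn leq_add2l //.
suff -> : 'C(m.*2.+1, m.+1) = 'C(m.*2.+1, m) by rewrite leq_addr.
by rewrite -bin_sub; [congr 'C(_, _); lia | lia].
Qed.

Lemma prime_dvd_fact p n : prime p -> (p %| n`!)%N -> (p <= n)%N.
Proof.
move=> pp; elim: n => [|n IH]; first by rewrite dvdn1 => /eqP p1; rewrite p1 in pp.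
by rewrite factS Euclid_dvdM // => /orP[/dvdn_leq -> //|/IH/leqW].
Qed.

(** Erdos' induction. An even [n > 2] is not prime, so [n - 1] serves; for [n = 2m + 1] the primes
    above [m + 1] all divide the middle binomial coefficient, which is at most [4 ^ m]. *)
Lemma primorial_le n : (\prod_(0 <= p < n.+1 | prime p) p <= 4 ^ n)%N.
Proof.
have [k] := ubnP n; elim: k n => // k IH n; rewrite ltnS => nk.
case: (posnP n) => [->|n0]; first by rewrite big_mkcond big_nat1.
have [on|] := boolP (odd n); last first.
  have [-> _|n2 en] := eqVneq n 2%N; first by rewrite big_mkcond unlock.
  rewrite big_mkcond big_nat_recr //= -big_mkcond /=.
  have /negbTE -> : ~~ prime n by apply: contra en => /even_prime [n2'|//]; rewrite n2' in n2.
  rewrite muln1 -{1}(prednK n0) (leq_trans (IH n.-1 _)) ?leq_exp2l ?leq_pred //.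
  by rewrite (leq_trans _ nk) // prednK.
set m := n./2; have nE : n = m.*2.+1 by rewrite -[LHS]odd_double_half on.
case: (posnP m) => [m0|m0]; first by rewrite nE m0 big_mkcond unlock.
rewrite (@big_cat_nat _ _ _ m.+2) //=; last by lia.
rewrite nE -mul2n -[(2 * m).+1]addn1 mul2n -addnn -addnA expnD mulnC.
have -> : (4 ^ m * 4 ^ (m + 1) = 4 ^ m.+1 * 4 ^ m)%N by rewrite addn1 mulnC.
rewrite mulnC leq_mul //; first by apply: IH; lia.
apply: leq_trans (bin_odd_mid_le m).
rewrite -big_filter; apply: dvdn_leq; first by rewrite bin_gt0; lia.
apply: dvdn_prod_primes; rewrite ?filter_uniq ?iota_uniq ?filter_all //.
apply/allP => p; rewrite mem_filter mem_index_iota => /and3P[pp mp pm].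
have := bin_fact (_ : m <= m.*2.+1)%N; have -> : (m.*2.+1 - m = m.+1)%N by lia.
move=> /(_ ltac:(lia)) bf.
have : (p %| (m.*2.+1)`!)%N by rewrite dvdn_fact // prime_gt0 //=; lia.
by rewrite -bf Euclid_dvdM // Euclid_dvdM // => /or3P[//|h|h]; have := prime_dvd_fact pp h; lia.
Qed.

Section RealBounds.
Context {R : realType}.

(** Its value at [0] is [0], as [ln] vanishes there by convention; so it is nonnegative on all of
    [nat]. *)
Definition log_nat (n : nat) : R := ln n%:R.
Local Notation L := log_nat.

Lemma log_nat_ge0 n : 0 <= L n.
Proof.
case: n => [|n]; first by rewrite /log_nat ln0.
by rewrite /log_nat ln_ge0 // ler1n.
Qed.

Lemma log_natM m n : (0 < m)%N -> (0 < n)%N -> L (m * n) = L m + L n.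
Proof. by move=> m0 n0; rewrite /log_nat natrM lnM // posrE ltr0n. Qed.

Lemma log_nat_le m n : (0 < m)%N -> (m <= n)%N -> L m <= L n.
Proof.
by move=> m0 mn; rewrite /log_nat ler_ln ?ler_nat // posrE ltr0n // (leq_trans m0).
Qed.

Lemma log_natX m k : (0 < m)%N -> L (m ^ k) = k%:R * L m.
Proof. by move=> m0; rewrite /log_nat natrX lnXn ?ltr0n // mulr_natl. Qed.

Lemma log_nat_prod (s : seq nat) : all (fun p => 0 < p)%N s ->
  L (\prod_(p <- s) p) = \sum_(p <- s) L p.
Proof.
elim: s => [|p s IH] /=; first by rewrite !big_nil /log_nat ln1.
move=> /andP[p0 s0]; rewrite !big_cons log_natM ?IH //.
by rewrite big_seq; apply: prodn_cond_gt0 => q /(allP s0).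
Qed.

Lemma log_nat_lt n : L n <= n%:R.
Proof.
case: n => [|n]; first by rewrite /log_nat ln0.
by rewrite ltW // ln_sublinear // ltr0n.
Qed.

Lemma expR_log_nat n : (0 < n)%N -> expR (L n) = n%:R.
Proof. by move=> n0; rewrite /log_nat lnK // posrE ltr0n. Qed.

Lemma chebyshev n : \sum_(0 <= p < n.+1 | prime p) L p <= 3 * n%:R.
Proof.
rewrite -big_filter -log_nat_prod; last by apply/allP => p; rewrite mem_filter => /andP[/prime_gt0].
rewrite big_filter (le_trans (log_nat_le _ (primorial_le n))) //.
  by apply: prodn_cond_gt0 => p /prime_gt0.
rewrite log_natX // mulrC ler_wpM2r // /log_nat.
(* The constant [3] is the crude bound [ln 4 <= 3] coming from [ln (1 + x) <= x]. *)
by have := @le_ln1Dx R 3 ltac:(lra); rewrite -[1 + 3](natrD R 1 3).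
Qed.

Lemma log_factor m B : (0 < m)%N -> (forall p, prime p -> (p %| m)%N -> (p < B)%N) ->
  L m = \sum_(0 <= p < B | prime p) (logn p m)%:R * L p.
Proof.
move=> m0 hB; rewrite {1}(prod_prime_decomp m0) prime_decompE big_map /=.
rewrite -(big_map (fun p => (p ^ logn p m)%N) xpredT id) log_nat_prod; last first.
  by apply/allP => _ /mapP[p + ->]; rewrite mem_primes expn_gt0 => /andP[/prime_gt0 ->].
rewrite big_map (eq_big_seq (fun p => (logn p m)%:R * L p)); last first.
  by move=> p; rewrite mem_primes => /andP[/prime_gt0 p0 _]; rewrite log_natX.
rewrite -big_filter [RHS](bigID (fun p => p \in primes m)) /= [X in _ + X]big1 ?addr0; last first.
  move=> p /andP[pp]; rewrite mem_primes pp m0 /= => pm.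
  by rewrite lognE pp m0 (negbTE pm) mul0r.
rewrite big_filter -[RHS]big_filter; apply: perm_big; apply: uniq_perm.
- exact: primes_uniq.
- by rewrite filter_uniq // iota_uniq.
- move=> p; rewrite mem_filter mem_index_iota /=.
  apply/idP/idP => [pm|/andP[/andP[]] //]; rewrite pm.
  by move: pm; rewrite mem_primes => /and3P[pp _ pm]; rewrite pp hB.
Qed.

Lemma log_step_le n : (0 < n)%N -> L n.+1 - L n <= n%:R^-1.
Proof.
move=> n0; have n0' : 0 < n%:R :> R by rewrite ltr0n.
have -> : L n.+1 - L n = ln (1 + n%:R^-1).
  by rewrite /log_nat -ln_div ?posrE ?ltr0n // -natr1 mulrDl divff ?gt_eqF // mul1r.
by apply: le_ln1Dx; rewrite (@lt_trans _ _ 0) // ?invr_gt0 //; lra.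
Qed.

Lemma log_step_ge n : (0 < n)%N -> n.+1%:R^-1 <= L n.+1 - L n.
Proof.
move=> n0; have n0' : 0 < n%:R :> R by rewrite ltr0n.
have n1' : 0 < n.+1%:R :> R by rewrite ltr0n.
have -> : L n.+1 - L n = - ln (1 + (- n.+1%:R^-1)).
  rewrite /log_nat -ln_div ?posrE // -natr1; move: (n%:R) n0' => x x0.
  have x1 : 0 < x + 1 by lra.
  have -> : 1 - (x + 1)^-1 = x / (x + 1) by field; lra.
  by rewrite -lnV ?posrE ?divr_gt0 // invf_div.
rewrite lerNr; apply: le_ln1Dx.
by rewrite ltrN2 invf_lt1 // ltr1n.
Qed.

Lemma harmonic_ge n : L n.+1 <= \sum_(1 <= k < n.+1) k%:R^-1.
Proof.
elim: n => [|n IH]; first by rewrite big_geq // /log_nat ln1.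
by rewrite big_nat_recr //= (le_trans _ (lerD IH (log_step_le _))) // addrC subrK.
Qed.

Lemma harmonic_le n : \sum_(1 <= k < n.+1) k%:R^-1 <= 1 + L n.
Proof.
elim: n => [|n IH]; first by rewrite big_geq // addr_ge0 // log_nat_ge0.
rewrite big_nat_recr //=; case: n IH => [|n] IH.
  by rewrite big_geq // add0r invr1 lerDl log_nat_ge0.
by apply: le_trans (lerD IH (log_step_ge _)) _ => //; rewrite -addrA [L n.+1 + _]addrC subrK.
Qed.

Lemma log_fact_le n : L n`! <= n%:R * L n.
Proof.
elim: n => [|n IH]; first by rewrite /log_nat ln1 mul0r.
rewrite factS log_natM ?fact_gt0 // -natr1 mulrDl mul1r addrC lerD2r.
case: n IH => [|n] IH; first by rewrite /log_nat ln1 mul0r.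
by rewrite (le_trans IH) // ler_wpM2l // log_nat_le.
Qed.

Lemma log_fact_ge n : n%:R * L n - n%:R <= L n`!.
Proof.
elim: n => [|n IH]; first by rewrite /log_nat ln1 mul0r subr0.
rewrite factS log_natM ?fact_gt0 // -natr1 mulrDl mul1r.
case: n IH => [|n] IH; first by rewrite /log_nat ln1; lra.
have /(ler_wpM2l (ler0n R n.+1)) := @log_step_le n.+1 isT.
rewrite divff ?pnatr_eq0 // mulrBr; lra.
Qed.

Lemma logn_fact_ge p n : prime p -> (n %/ p <= logn p n`!)%N.
Proof.
move=> pp; rewrite logn_fact //; case: n => [|n]; first by rewrite div0n.
by rewrite big_nat_recl // expn1 leq_addr.
Qed.

Lemma natr_div_ge n p : (0 < p)%N -> n%:R / p%:R - 1 <= (n %/ p)%:R :> R.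
Proof.
move=> p0; have p0' : 0 < p%:R :> R by rewrite ltr0n.
rewrite lerBlDr ler_pdivrMr // natr1 -natrM ler_nat; exact/ltnW/ltn_ceil.
Qed.

Lemma natr_div_le n p : (n %/ p)%:R <= n%:R / p%:R :> R.
Proof.
case: p => [|p]; first by rewrite divn0 invr0 mulr0.
by rewrite ler_pdivlMr ?ltr0n // -natrM ler_nat leq_divM.
Qed.

(** By Legendre's formula [p] divides [n!] at least [n / p - 1] times, so [log n! <= n log n] bounds
    [n] times the sum up to the Chebyshev error [3 n]. *)
Lemma mertens_le n : (0 < n)%N -> \sum_(0 <= p < n.+1 | prime p) L p / p%:R <= L n + 3.
Proof.
move=> n0; have n0' : 0 < n%:R :> R by rewrite ltr0n.
rewrite -(ler_pM2l n0') mulrDr [X in _ <= _ + X]mulrC -lerBlDr.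
apply: le_trans (log_fact_le n).
rewrite (@log_factor _ n.+1) ?fact_gt0 //; last by move=> p pp /(prime_dvd_fact pp).
apply: (@le_trans _ _ (n%:R * (\sum_(0 <= p < n.+1 | prime p) L p / p%:R) -
                    \sum_(0 <= p < n.+1 | prime p) L p)).
  by rewrite lerD2l lerN2 chebyshev.
rewrite mulr_sumr -sumrB; apply: ler_sum => p pp.
have -> : n%:R * (L p / p%:R) - L p = (n%:R / p%:R - 1) * L p by ring.
rewrite ler_wpM2r ?log_nat_ge0 // (le_trans (natr_div_ge _ (prime_gt0 pp))) //.
by rewrite ler_nat logn_fact_ge.
Qed.

Lemma sum_log_sq_le n : \sum_(2 <= m < n.+1) L m / (m%:R * (m%:R - 1)) <= 2.
Proof.
(* The subtracted [(2 + L n) / n] majorises the tail of the series beyond [n], which makes the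
   induction close. *)
suff : forall n, (0 < n)%N -> \sum_(2 <= m < n.+1) L m / (m%:R * (m%:R - 1)) <= 2 - (2 + L n) / n%:R.
  case: n => [|n]; first by rewrite big_geq // => _; lra.
  move=> /(_ n.+1 isT) /le_trans -> //; rewrite gerDl oppr_le0 divr_ge0 //.
  by rewrite addr_ge0 // log_nat_ge0.
elim=> // -[_ _|m IH _]; first by rewrite big_geq // /log_nat ln1 addr0 divr1 subrr.
rewrite big_nat_recr //=; apply: le_trans (lerD (IH isT) (lexx _)) _.
have m1 : 0 < m.+1%:R :> R by rewrite ltr0n.
have := @log_step_le m.+1 isT; rewrite -(ler_pM2l m1) divff ?gt_eqF //.
have : L m.+1 <= L m.+2 by apply: log_nat_le.
have : 1 <= m.+1%:R :> R by rewrite ler1n.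
rewrite -[m.+2%:R]natr1 addrK; move: (L m.+1) (L m.+2); move: (m.+1%:R) m1 => x x0 a b x1 ab h.
rewrite -subr_ge0.
have -> : 2 - (2 + b) / (x + 1) - (2 - (2 + a) / x + b / ((x + 1) * x)) =
   (2 - (x + 1) * (b - a)) / ((x + 1) * x) by field; rewrite !gt_eqF //; lra.
by rewrite divr_ge0 ?mulr_ge0; nra.
Qed.

Lemma sum_inv_sq_le n : \sum_(1 <= m < n.+1) (m%:R ^+ 2)^-1 <= 2 :> R.
Proof.
suff : forall n, (0 < n)%N -> \sum_(1 <= m < n.+1) (m%:R ^+ 2)^-1 <= 2 - n%:R^-1 :> R.
  case: n => [|n]; first by rewrite big_geq.
  by move=> /(_ n.+1 isT) /le_trans -> //; rewrite gerDl oppr_le0 invr_ge0.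
elim=> // -[_ _|m IH _]; first by rewrite big_nat1 expr1n invr1; lra.
rewrite big_nat_recr //=; apply: le_trans (lerD (IH isT) (lexx _)) _.
have m1 : 0 < m.+1%:R :> R by rewrite ltr0n.
rewrite -[m.+2%:R]natr1; move: (m.+1%:R) m1 => x x0.
have x1 : 0 < x + 1 by lra.
rewrite -subr_ge0.
have -> : 2 - (x + 1)^-1 - (2 - x^-1 + ((x + 1) ^+ 2)^-1) = ((x + 1) ^+ 2 * x)^-1.
  by field; rewrite !gt_eqF.
by rewrite invr_ge0 mulr_ge0 ?exprn_ge0 // ltW.
Qed.

Lemma sumr_ge_term (T : eqType) (s : seq T) (P : pred T) (F : T -> R) i :
  i \in s -> P i -> (forall j, P j -> 0 <= F j) -> F i <= \sum_(j <- s | P j) F j.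
Proof.
by move=> si Pi F0; rewrite (big_rem i) //= Pi lerDl sumr_ge0.
Qed.

(** Each [k <= y] is a squarefree number times a square, so the harmonic sum is at most the
    squarefree one times the sum of [1 / b ^ 2], which is at most [2]. *)
Lemma log_le_sqfree y : L y.+1 <= 2 * \sum_(0 <= r < y.+1 | sqfree r) r%:R^-1.
Proof.
apply: le_trans (harmonic_ge y) _.
pose F k a b : R := if k == (a * b ^ 2)%N then a%:R^-1 * (b%:R ^+ 2)^-1 else 0.
have F0 k a b : 0 <= F k a b.
  by rewrite /F; case: ifP => // _; rewrite mulr_ge0 ?invr_ge0 ?exprn_ge0.
apply: (@le_trans _ _ (\sum_(1 <= k < y.+1) \sum_(0 <= a < y.+1 | sqfree a) \sum_(1 <= b < y.+1) F k a b)).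
  rewrite big_nat [leRHS]big_nat; apply: ler_sum => k /andP[k0 ky].
  have [a [b [sa kE b0]]] := sqfree_square_factor k0.
  have ay : (a < y.+1)%N by apply: leq_ltn_trans ky; rewrite kE leq_pmulr // expn_gt0 b0.
  have by_ : (b < y.+1)%N.
    apply: leq_ltn_trans ky; rewrite kE (leq_trans _ (leq_pmull _ (sqfree_gt0 sa))) //.
    by rewrite -{1}(expn1 b) leq_pexp2l.
  apply: (@le_trans _ _ (\sum_(1 <= b < y.+1) F k a b)); last first.
    apply: (@sumr_ge_term _ _ _ (fun a => \sum_(1 <= b < y.+1) F k a b)); rewrite ?mem_index_iota //.
    by move=> j _; apply: sumr_ge0.
  apply: (@le_trans _ _ (F k a b)); last first.
    by apply: sumr_ge_term; rewrite ?mem_index_iota ?b0.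
  by rewrite /F kE eqxx natrM natrX invfM.
rewrite exchange_big /= mulr_sumr; apply: ler_sum => a sa.
rewrite exchange_big /=; apply: (@le_trans _ _ (\sum_(1 <= b < y.+1) a%:R^-1 * (b%:R ^+ 2)^-1)).
  apply: ler_sum => b _; rewrite /F -big_mkcond /=.
  rewrite big_const_seq iter_addr_0 -[leRHS]mulr1n ler_wpMn2l ?mulr_ge0 ?invr_ge0 ?exprn_ge0 //.
  rewrite -size_filter; apply: (@leq_trans (size [:: (a * b ^ 2)%N])) => //.
  apply: uniq_leq_size; first by rewrite filter_uniq // iota_uniq.
  by move=> k; rewrite mem_filter inE => /andP[].
by rewrite -mulr_sumr mulrC ler_wpM2r ?invr_ge0 // sum_inv_sq_le.
Qed.

End RealBounds.

End Chebyshev.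

(** * Smooth numbers and the product of Mertens *)

Lemma big_nat_multiples (V : nmodType) (P : pred nat) (F : nat -> V) p B : (0 < p)%N ->
  \sum_(0 <= r < B | (p %| r)%N && P r) F r =
  \sum_(0 <= t < B | (p * t < B)%N && P (p * t)%N) F (p * t)%N.
Proof.
move=> p0; rewrite -[RHS]big_filter -(big_map (muln p) xpredT F) -[LHS]big_filter.
apply: perm_big; apply: uniq_perm; first by rewrite filter_uniq // iota_uniq.
  rewrite map_inj_uniq ?filter_uniq ?iota_uniq // => x y /eqP.
  by rewrite eqn_pmul2l // => /eqP.
move=> r; rewrite mem_filter mem_index_iota /=; apply/idP/mapP.
  move=> /andP[/andP[/dvdnP[t rE] Pr] rB]; exists t; last by rewrite rE mulnC.
  rewrite mem_filter mem_index_iota /= mulnC -rE rB Pr /=.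
  by rewrite (leq_ltn_trans _ rB) // rE leq_pmulr.
move=> [t]; rewrite mem_filter mem_index_iota /= => /andP[/andP[tB Pt] _] ->.
by rewrite dvdn_mulr // Pt tB.
Qed.

Section MertensProduct.
Context {R : realType}.
Local Notation L := (@log_nat R).

Definition smooth z r := all (fun p => p < z)%N (primes r).

Lemma smooth_primeM z p t : prime p -> ~~ (p %| t)%N -> (0 < t)%N ->
  smooth z (p * t) = (p < z)%N && smooth z t.
Proof. by move=> pp pt t0; rewrite /smooth (perm_all _ (perm_primesM pp pt t0)). Qed.

Lemma smooth_leq z1 z2 r : (z1 <= z2)%N -> smooth z1 r -> smooth z2 r.
Proof. by move=> z12; apply: sub_all => p /leq_trans; apply. Qed.

Lemma smoothS z r : smooth z.+1 r = smooth z r || [&& prime z, (z %| r)%N & smooth z.+1 r].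
Proof.
apply/idP/orP => [h|[/smooth_leq|/and3P[]//]]; last by apply.
have [/and3P[-> -> _]|nz] := boolP [&& prime z, (z %| r)%N & (0 < r)%N]; first by right.
left; apply/allP => p pr; have := allP h p pr; rewrite /= ltnS leq_eqVlt => /orP[/eqP pz|//].
by move: pr nz; rewrite mem_primes pz => /and3P[-> -> ->].
Qed.

Lemma smooth_split z r : prime z -> sqfree r ->
  smooth z.+1 r && ~~ (z %| r)%N = smooth z r.
Proof.
move=> pz sr; apply/andP/idP => [[]|h].
  by rewrite smoothS => /orP[//|/and3P[_ ->]].
split; first exact: smooth_leq h.
apply/negP => zr; have /(allP h) : z \in primes r by rewrite mem_primes pz sqfree_gt0.
by rewrite ltnn.
Qed.

Lemma smooth_nprime z r : ~~ prime z -> smooth z.+1 r = smooth z r.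
Proof. by move=> /negbTE pz; rewrite smoothS pz orbF. Qed.

(** The Euler product, expanded. With finite sums the two inequalities need different cutoffs: this
    one holds for every [B], the converse [prod_le_sum_smooth] for some [B]. *)
Lemma sum_smooth_le (F : nat -> R) z B : (forall p, 0 <= F p) ->
  \sum_(0 <= r < B | sqfree r && smooth z r) primeprod F r <=
  \prod_(0 <= p < z | prime p) (1 + F p).
Proof.
move=> F0; have pF0 r : 0 <= primeprod F r by apply: prodr_ge0.
elim: z => [|z IH].
  rewrite big_geq //; apply: (@le_trans _ _ (\sum_(0 <= r < B | r == 1%N) 1)).
    rewrite big_mkcond [leRHS]big_mkcond; apply: ler_sum => r _.
    have [/andP[sr zr]|_] := ifP; last by case: ifP.
    case: eqP => [->|r1]; first by rewrite primeprod1.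
    have : pdiv r \in primes r.
      by rewrite mem_primes pdiv_prime ?pdiv_dvd ?sqfree_gt0 //; have := sqfree_gt0 sr; lia.
    by move=> /(allP zr).
  rewrite -big_filter big_const_seq iter_addr_0 count_predT -[leRHS]mulr1n ler_wpMn2l //.
  apply: (@uniq_leq_size _ _ [:: 1%N]); first by rewrite filter_uniq // iota_uniq.
  by move=> k; rewrite mem_filter inE => /andP[].
rewrite [leRHS]big_mkcond big_nat_recr //= -big_mkcond /=.
have [pz|pz] := ifPn; last first.
  by rewrite mulr1 (le_trans _ IH) //; under eq_bigl do rewrite smooth_nprime //.
rewrite (bigID (fun r => z %| r)%N) /=.
have -> : \sum_(0 <= r < B | sqfree r && smooth z.+1 r && ~~ (z %| r)%N) primeprod F r =
          \sum_(0 <= r < B | sqfree r && smooth z r) primeprod F r.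
  by apply: eq_bigl => r; rewrite -andbA; case: (boolP (sqfree r)) => //= sr; rewrite smooth_split.
rewrite mulrDr mulr1 addrC lerD //.
apply: (@le_trans _ _ ((\sum_(0 <= r < B | sqfree r && smooth z r) primeprod F r) * F z)); last first.
  by rewrite ler_wpM2r.
under eq_bigl do rewrite andbC.
rewrite big_nat_multiples ?prime_gt0 // mulr_suml.
rewrite big_mkcond [leRHS]big_mkcond; apply: ler_sum => t _.
have [/and3P[_ st zt]|_] := ifP; last by case: ifP => // _; rewrite mulr_ge0.
have nzt : ~~ (z %| t)%N.
  have /sqfreeP[_ /(_ _ pz)] := st; apply: contra => d.
  by rewrite expnS expn1 dvdn_pmul2l ?prime_gt0.
move: st zt; rewrite sqfree_primeM // => st.
have t0 := sqfree_gt0 st.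
rewrite smooth_primeM // ltnSn /= => zt.
by rewrite st /= -(smooth_split pz) ?zt ?nzt //= primeprodM // mulrC.
Qed.

Lemma prod_le_sum_smooth (F : nat -> R) z : (forall p, 0 <= F p) -> exists B,
  \prod_(0 <= p < z | prime p) (1 + F p) <=
  \sum_(0 <= r < B | sqfree r && smooth z r) primeprod F r.
Proof.
move=> F0; have pF0 r : 0 <= primeprod F r by apply: prodr_ge0.
elim: z => [|z [B IH]].
  exists 2%N; rewrite big_geq //.
  rewrite (le_trans _ (@sumr_ge_term _ _ _ _ _ 1%N _ _ _)) ?mem_index_iota //.
  by rewrite primeprod1.
have [pz|pz] := boolP (prime z); last first.
  exists B; rewrite big_mkcond big_nat_recr //= -big_mkcond (negbTE pz) mulr1.
  by under [leRHS]eq_bigl do rewrite smooth_nprime //.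
exists (z * B)%N; rewrite big_mkcond big_nat_recr //= -big_mkcond /= pz.
rewrite [leRHS](bigID (fun r => z %| r)%N) /= mulrDr mulr1.
have z0 := prime_gt0 pz.
apply: (@le_trans _ _ ((\sum_(0 <= r < B | sqfree r && smooth z r) primeprod F r) * F z +
   \sum_(0 <= r < B | sqfree r && smooth z r) primeprod F r)).
  by rewrite [leLHS]addrC lerD // ler_wpM2r.
apply: lerD.
  under [leRHS]eq_bigl do rewrite andbC.
  rewrite big_nat_multiples // mulr_suml.
  rewrite [leRHS](@big_cat_nat _ _ _ B) //=; last by rewrite leq_pmull.
  rewrite -[leLHS]addr0 lerD ?sumr_ge0 //.
  rewrite big_nat_cond [leRHS]big_nat_cond big_mkcond [leRHS]big_mkcond; apply: ler_sum => t _.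
  have [/andP[tB /andP[st zt]]|_] := ifP; last by case: ifP.
  have /andP[zt' nzt] : smooth z.+1 t && ~~ (z %| t)%N by rewrite smooth_split.
  have t0 := sqfree_gt0 st.
  have tB' : (t < B)%N by case/andP: tB.
  rewrite tB ltn_pmul2l // tB' sqfree_primeM // st smooth_primeM // ltnSn zt' /=.
  by rewrite primeprodM // mulrC.
rewrite [leRHS](@big_cat_nat _ _ _ B) //=; last by rewrite leq_pmull.
rewrite -[leLHS]addr0 lerD ?sumr_ge0 //.
rewrite le_eqVlt; apply/orP; left; apply/eqP.
by apply: eq_bigl => r; rewrite -andbA; case: (boolP (sqfree r)) => //= sr; rewrite smooth_split.
Qed.

(** Partial sums of [zeta (1 + s)]. The strengthened bound subtracts [B ^ (- s) / s], the integral
    over the tail. *)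
Lemma zeta_tail (s : R) B : 0 < s ->
  \sum_(1 <= n < B.+1) expR (- ((1 + s) * L n)) <= 1 + s^-1.
Proof.
move=> s0.
suff : forall B, (0 < B)%N -> \sum_(1 <= n < B.+1) expR (- ((1 + s) * L n)) <= 1 + s^-1 - s^-1 * expR (- (s * L B)).
  case: B => [|B]; first by rewrite big_geq // addr_ge0 ?invr_ge0 // ltW.
  move=> /(_ B.+1 isT) /le_trans -> //.
  by rewrite gerDl oppr_le0 mulr_ge0 ?invr_ge0 ?expR_ge0 ?ltW.
elim=> // -[_ _|n IH _].
  by rewrite big_nat1 /log_nat ln1 !mulr0 oppr0 expR0; lra.
rewrite big_nat_recr //=; apply: le_trans (lerD (IH isT) (lexx _)) _.
set a := L n.+1; set b := L n.+2.
have h : n.+2%:R^-1 <= b - a by apply: log_step_ge.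
have -> : expR (- ((1 + s) * b)) = n.+2%:R^-1 * expR (- (s * b)).
  by rewrite mulrDl mul1r opprD expRD (expRN b) expR_log_nat.
have -> : expR (- (s * a)) = expR (- (s * b)) * expR (s * (b - a)).
  by rewrite -expRD; congr expR; ring.
move: (n.+2%:R^-1) h => c h; rewrite -subr_ge0.
have -> : 1 + s^-1 - s^-1 * expR (- (s * b)) -
  (1 + s^-1 - s^-1 * (expR (- (s * b)) * expR (s * (b - a))) + c * expR (- (s * b))) =
  s^-1 * expR (- (s * b)) * (expR (s * (b - a)) - 1 - s * c).
  by field; rewrite gt_eqF.
rewrite mulr_ge0 ?mulr_ge0 ?invr_ge0 ?expR_ge0 ?(ltW s0) //.
have := expR_ge1Dx (s * (b - a)); have : s * c <= s * (b - a) by rewrite ler_pM2l.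
lra.
Qed.

Lemma primeprod_expR (c : R) r : sqfree r ->
  primeprod (fun p => expR (- (c * L p))) r = expR (- (c * L r)).
Proof.
elim/sqfree_ind => [|p t pp pt st IH]; first by rewrite primeprod1 /log_nat ln1 mulr0 oppr0 expR0.
have t0 := sqfree_gt0 st; have p0 := prime_gt0 pp.
rewrite primeprodM // IH -expRD log_natM //.
by congr expR; ring.
Qed.

Lemma telescope_inv_le n : \sum_(0 <= p < n | prime p) (p%:R * (p%:R - 1))^-1 <= 1 :> R.
Proof.
suff : forall n, (0 < n)%N -> \sum_(0 <= p < n.+1 | prime p) (p%:R * (p%:R - 1))^-1 <= 1 - n%:R^-1 :> R.
  case: n => [|[|n]] h; first by rewrite big_geq.
    by rewrite big_mkcond big_nat1.
  by rewrite (le_trans (h n.+1 isT)) // gerDl oppr_le0 invr_ge0.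
elim=> // -[_ _|m IH _]; first by rewrite big_mkcond unlock /= !addr0 invr1 subrr.
rewrite big_mkcond big_nat_recr //= -big_mkcond /=.
apply: le_trans (lerD (IH isT) (lexx _)) _.
have m1 : 0 < m.+1%:R :> R by rewrite ltr0n.
rewrite -[m.+2%:R]natr1 addrK; move: (m.+1%:R) m1 => x x0.
have x1 : 0 < x + 1 by lra.
have e : x^-1 - (x + 1)^-1 = ((x + 1) * x)^-1 by field; rewrite !gt_eqF.
case: ifP => _; first by rewrite -e; lra.
have : 0 <= ((x + 1) * x)^-1 by rewrite invr_ge0 mulr_ge0 // ltW.
by rewrite -e; lra.
Qed.

(** Rankin's trick, factor by factor: passing from [1 / (p - 1)] to [p ^ (- 1 - s)] costs at most
    the exponential of [1 / (p (p - 1)) + s log p / p], whose sum over [p < z] stays bounded for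
    [s = 1 / log z]. *)
Lemma euler_factor_le p (s : R) : prime p -> 0 <= s ->
  1 + (p%:R - 1)^-1 <= (1 + expR (- ((1 + s) * L p))) *
    expR ((p%:R * (p%:R - 1))^-1 + s * (L p / p%:R)).
Proof.
move=> pp s0; have p2 := @prime_ge2 R _ pp; have p0 : 0 < p%:R :> R by lra.
have lp : 0 <= L p by apply: log_nat_ge0.
set x := expR (- ((1 + s) * L p)).
have xE : x = p%:R^-1 * expR (- (s * L p)).
  by rewrite /x mulrDl mul1r opprD expRD (expRN (L p)) expR_log_nat ?prime_gt0.
have x0 : 0 <= x by apply: expR_ge0.
have h1 : 1 - s * L p <= expR (- (s * L p)) by apply: le_trans (expR_ge1Dx _).
have h2 : p%:R^-1 - x <= s * (L p / p%:R).
  rewrite xE; have : p%:R^-1 * (1 - s * L p) <= p%:R^-1 * expR (- (s * L p)).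
    by rewrite ler_wpM2l ?invr_ge0 // ltW.
  lra.
set y := (p%:R * (p%:R - 1))^-1 + s * (L p / p%:R).
have y0 : 0 <= y.
  rewrite addr_ge0 //; last by rewrite !mulr_ge0 ?invr_ge0 // ltW.
  by rewrite invr_ge0 mulr_ge0; lra.
have h3 : (p%:R - 1)^-1 - x <= y.
  have -> : (p%:R - 1)^-1 = p%:R^-1 + (p%:R * (p%:R - 1))^-1 :> R by field; lra.
  by rewrite /y; lra.
apply: (@le_trans _ _ ((1 + x) * (1 + y))).
  by rewrite mulrDr mulr1 mulrDl mul1r; have := mulr_ge0 x0 y0; lra.
by rewrite ler_wpM2l ?addr_ge0 // expR_ge1Dx.
Qed.

(** With [s = 1 / log z] the factors [1 + p ^ (- 1 - s)] multiply to at most [1 + log z]. The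
    exponent [5] is [1] from the sum of [1 / (p (p - 1))] and [4] from [s (log z + 3)]. *)
Lemma mertens_product_le z : (3 < z)%N ->
  \prod_(0 <= p < z | prime p) (1 + (p%:R - 1)^-1) <= expR 5 * (1 + L z).
Proof.
move=> z3; have z2 : (2 < z)%N by lia.
have z0 : (0 < z)%N by lia.
have Lz : 1 <= L z.
  have : L 4 <= L z by apply: log_nat_le.
  have := @log_step_ge R 3 isT; have := @log_step_ge R 2 isT.
  have := @log_step_ge R 1 isT; rewrite {2}/log_nat ln1.
  move: (L 2) (L 3) (L 4) (L z) => a b c d; lra.
have Lz0 : 0 < L z by lra.
pose s := (L z)^-1; have s0 : 0 < s by rewrite invr_gt0.
pose F (p : nat) := expR (- ((1 + s) * L p)).
have F0 p : 0 <= F p by apply: expR_ge0.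
have [B hB] := prod_le_sum_smooth z F0.
have e1 : \prod_(0 <= p < z | prime p) (1 + F p) <= 1 + L z.
  apply: le_trans hB _.
  apply: le_trans (_ : \sum_(0 <= r < B | sqfree r && smooth z r) expR (- ((1 + s) * L r)) <= _).
    by rewrite big_mkcond [leRHS]big_mkcond; apply: ler_sum => r _; case: ifP => // /andP[sr _]; rewrite primeprod_expR.
  apply: le_trans (_ : \sum_(1 <= r < B.+1) expR (- ((1 + s) * L r)) <= _); last first.
    by rewrite (le_trans (zeta_tail B s0)) // /s invrK.
  rewrite big_mkcond /=; case: B => [|B]; first by rewrite !big_geq.
  rewrite big_nat_recl //= add0r big_add1 /= [leRHS]big_nat_recr //=.
  rewrite -[leLHS]addr0 lerD ?expR_ge0 //.
  by apply: ler_sum => r _; case: ifP => // _; apply: expR_ge0.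
apply: (@le_trans _ _ (\prod_(0 <= p < z | prime p) ((1 + F p) *
    expR ((p%:R * (p%:R - 1))^-1 + s * (L p / p%:R))))).
  apply: ler_prod => p pp; rewrite (euler_factor_le pp (ltW s0)) andbT.
  by have p2 := @prime_ge2 R _ pp; rewrite addr_ge0 ?invr_ge0 //; lra.
rewrite big_split /= mulrC ler_pM ?prodr_ge0 //.
- by move=> *; exact: expR_ge0.
- by move=> *; rewrite addr_ge0.
rewrite -expR_sum ler_expR big_split /=.
have h1 := telescope_inv_le z.
have h2 : \sum_(0 <= p < z | prime p) L p / p%:R <= L z + 3.
  case: z z0 {z2 z3 Lz Lz0 s s0 F F0 B hB e1 h1} => // z _.
  case: z => [|z]; first by rewrite big_mkcond big_nat1 addr_ge0 // log_nat_ge0.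
  apply: le_trans (mertens_le _) _ => //; rewrite lerD2r; exact: log_nat_le.
rewrite -mulr_sumr; have : s * (\sum_(0 <= p < z | prime p) L p / p%:R) <= 1 + 3.
  apply: le_trans (ler_wpM2l (ltW s0) h2) _.
  rewrite mulrDr mulVf ?gt_eqF // lerD2l -[leRHS]mul1r ler_wpM2r // /s invf_le1 //.
lra.
Qed.

End MertensProduct.

(** * Trigonometric sums *)

Section Trigonometry.
Context {R : realType}.
Implicit Types (x y e f : R).

(** Real part of [exp (2 pi i x)]; [sn] is the imaginary part. Complex numbers are avoided by
    bounding, in place of an exponential sum, its cosine sums with an arbitrary phase. *)
Definition cs x : R := cos (2 * pi * x).
Definition sn x : R := sin (2 * pi * x).
Definition nearint e x := exists A : int, `|x - A%:~R| <= e.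

Lemma csD x y : cs (x + y) = cs x * cs y - sn x * sn y.
Proof. by rewrite /cs mulrDr cosD. Qed.

Lemma csN x : cs (- x) = cs x.
Proof. by rewrite /cs mulrN cosN. Qed.

Lemma snN x : sn (- x) = - sn x.
Proof. by rewrite /sn mulrN sinN. Qed.

Lemma csB x y : cs (x - y) = cs x * cs y + sn x * sn y.
Proof. by rewrite csD csN snN mulrN opprK. Qed.

Lemma cs0 : cs 0 = 1.
Proof. by rewrite /cs mulr0 cos0. Qed.

Lemma cs_le1 x : `|cs x| <= 1.
Proof. exact: cos_max. Qed.

Lemma csDnat x n : cs (x + n%:R) = cs x.
Proof.
have e : 2 * pi = pi *+ 2 :> R by rewrite mulr_natl.
rewrite /cs mulrDr e mulr_natr; exact: (periodicn (@cosD2pi R)).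
Qed.

Lemma csDint x (A : int) : cs (x + A%:~R) = cs x.
Proof.
case: A => n; first exact: csDnat.
by rewrite NegzE mulrNz -[LHS](csDnat _ n.+1) subrK.
Qed.

Lemma nearint_le e f x : e <= f -> nearint e x -> nearint f x.
Proof. by move=> ef [A h]; exists A; apply: le_trans ef. Qed.

Lemma nearintD e f x y : nearint e x -> nearint f y -> nearint (e + f) (x + y).
Proof.
move=> [A hA] [B hB]; exists (A + B).
by rewrite intrD opprD addrACA (le_trans (ler_normD _ _)) // lerD.
Qed.

Lemma nearintN e x : nearint e x -> nearint e (- x).
Proof. by move=> [A hA]; exists (- A); rewrite mulrNz -opprD normrN. Qed.

Lemma nearint_mulz e x (k : int) : nearint e x -> nearint (`|k|%:~R * e) (k%:~R * x).
Proof.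
move=> [A hA]; exists (k * A); rewrite intrM -mulrBr normrM -intr_norm.
by rewrite ler_wpM2l // ler0z normr_ge0.
Qed.

Lemma nearint_muln e x k : nearint e x -> nearint (k%:R * e) (k%:R * x).
Proof. exact: (@nearint_mulz e x k). Qed.

Lemma nearintDint e x (A : int) : nearint e (x + A%:~R) <-> nearint e x.
Proof.
split=> -[B hB]; [exists (B - A) | exists (B + A)].
  by rewrite intrB opprB addrA.
by rewrite intrD opprD addrACA subrr addr0.
Qed.

Lemma nearest_int x : nearint 2^-1 x.
Proof.
exists (Num.floor (x + 2^-1)).
have h1 := floor_le (x + 2^-1); have h2 := floorD1_gt (x + 2^-1).
rewrite intrD in h2.
by rewrite ler_norml; apply/andP; split; lra.
Qed.

Lemma cos_pi4 : 2^-1 <= cos (pi / 4) :> R.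
Proof.
have h : 0 < cos (pi / 4) :> R.
  by apply: cos_gt0_pihalf; have := @pi_gt0 R; lra.
have : cos ((pi / 4) *+ 2) = 0 :> R.
  by rewrite -[RHS]cos_pihalf; congr cos; rewrite mulr2n; field.
rewrite cos_mulr2n -mulr_natr; move: (cos (pi / 4)) h => c h e; nra.
Qed.

Lemma sin_pi4 : 2^-1 <= sin (pi / 4) :> R.
Proof.
rewrite -cosBpihalf -cosN; apply: le_trans cos_pi4 _.
by rewrite le_eqVlt; apply/orP; left; apply/eqP; congr cos; field.
Qed.

Lemma sinpi_ge_half x : 4^-1 <= x <= 2^-1 -> 2^-1 <= sin (pi * x).
Proof.
move=> /andP[x1 x2]; have p0 := @pi_gt0 R.
apply: le_trans sin_pi4 _; have [->//|ne] := eqVneq (pi / 4) (pi * x).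
apply/ltW; rewrite ltr_sin ?in_itv /=; first last.
- by apply/andP; split; nra.
- by apply/andP; split; nra.
by rewrite lt_neqAle ne /= ler_wpM2l // ltW.
Qed.

Lemma cspi_ge_half x : nearint 8^-1 x -> 2^-1 <= cs x.
Proof.
move=> [A hA]; rewrite -(subrK A%:~R x) csDint /cs -cos_norm normrM.
have p0 := @pi_gt0 R.
rewrite gtr0_norm ?mulr_gt0 //; set t := `|_| in hA *.
have t0 : 0 <= t by apply: normr_ge0.
apply: le_trans cos_pi4 _; have [->//|ne] := eqVneq (pi / 4) (2 * pi * t).
apply/ltW; rewrite ltr_cos ?in_itv /=; first last.
- by apply/andP; split; nra.
- by apply/andP; split; nra.
by rewrite lt_neqAle eq_sym ne /=; nra.
Qed.

Lemma cspi_ge0 x : nearint 4^-1 x -> 0 <= cs x.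
Proof.
move=> [A hA]; rewrite -(subrK A%:~R x) csDint /cs; have p0 := @pi_gt0 R.
move: hA; rewrite ler_norml => /andP[h1 h2].
by apply: cos_ge0_pihalf; apply/andP; split; nra.
Qed.

Lemma abs_sin_muln n x : `|sin (n%:R * x)| <= n%:R * `|sin x|.
Proof.
elim: n => [|n IH]; first by rewrite !mul0r sin0 normr0.
rewrite -natr1 !mulrDl !mul1r sinD (le_trans (ler_normD _ _)) // lerD //.
  by rewrite normrM (le_trans _ IH) // ler_piMr // cos_max.
by rewrite normrM ler_piMl // cos_max.
Qed.

(** For [x] below [1 / 4] some multiple [n x] lies between [1 / 4] and [1 / 2], where the sine is at
    least [1 / 2]; then [|sin (n y)| <= n |sin y|] leads back to [x]. *)
Lemma sinpi_ge x : 0 <= x <= 2^-1 -> x <= `|sin (pi * x)|.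
Proof.
move=> /andP[x0 x1]; have [x4|x4] := leP 4^-1 x.
  apply: (le_trans x1); apply: le_trans (ler_norm _).
  by apply: sinpi_ge_half; rewrite x4.
move: x0; rewrite le_eqVlt => /predU1P[<-|x0]; first by [].
pose n := Num.truncn ((2 * x)^-1).
have y0 : 0 <= (2 * x)^-1 by rewrite invr_ge0 mulr_ge0 // ltW.
have /andP[n1 n2] := truncn_itv y0.
have h1 : n%:R * (2 * x) <= 1.
  by rewrite -ler_pdivlMr ?mulr_gt0 // div1r.
have h2 : 1 < n.+1%:R * (2 * x).
  by rewrite -ltr_pdivrMr ?mulr_gt0 // div1r.
rewrite -natr1 in h2.
have n0 : 0 < n%:R :> R by nra.
have : 2^-1 <= n%:R * `|sin (pi * x)|.
  apply: le_trans (abs_sin_muln _ _); rewrite mulrCA.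
  by apply: le_trans (ler_norm _); apply: sinpi_ge_half; apply/andP; split; nra.
by move: `|_| => s hs; nra.
Qed.

Lemma far_sin e x : ~ nearint e x -> e <= `|sin (pi * x)|.
Proof.
move=> h; have [A hA] := nearest_int x.
have -> : `|sin (pi * x)| = `|sin (pi * `|x - A%:~R|)|.
  have hn (y : R) n : `|sin (pi * (y + n%:R))| = `|sin (pi * y)|.
    elim: n => [|n IH]; first by rewrite addr0.
    by rewrite -natr1 addrA mulrDr mulr1 sinDpi normrN.
  have hz (y : R) (B : int) : `|sin (pi * (y + B%:~R))| = `|sin (pi * y)|.
    case: B => n; first exact: hn.
    by rewrite NegzE mulrNz -[LHS](hn _ n.+1) subrK.
  have ha (y : R) : `|sin (pi * `|y|)| = `|sin (pi * y)|.
    have [//|_] := ger0P y.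
    by rewrite mulrN sinN normrN.
  by rewrite ha -[in LHS](subrK A%:~R x) hz.
apply: le_trans (sinpi_ge _); last by rewrite normr_ge0 hA.
by rewrite leNgt; apply/negP => /ltW h2; apply: h; exists A.
Qed.

Lemma telescope_shift (G : nat -> R) P X :
  \sum_(0 <= n < X) (G (n + P)%N - G n) = \sum_(0 <= i < P) (G (X + i)%N - G i).
Proof.
elim: X => [|X IH].
  by rewrite big_geq // big1 // => i _; rewrite add0n subrr.
rewrite big_nat_recr //= IH !sumrB addrAC; congr (_ - _).
apply/eqP; rewrite addrC addrAC subr_eq eq_sym.
have -> : \sum_(0 <= i < P) G (X.+1 + i)%N + G X = \sum_(0 <= i < P.+1) G (X + i)%N.
  rewrite big_nat_recl //= addn0 addrC; congr (_ + _).
  by apply: eq_bigr => i _; rewrite addnS.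
by rewrite big_nat_recr //= addrC.
Qed.

(** Multiplication by [2 sin (pi P x)] turns the summand into [G (n + P) - G n], so that only [2 P]
    boundary terms survive, whatever [X] is. *)
Lemma periodic_cs_sum (F : nat -> R) (M x y : R) P X :
  (forall n, F (n + P)%N = F n) -> (forall n, `|F n| <= M) ->
  `|sin (pi * (P%:R * x))| * `|\sum_(0 <= n < X) F n * cs (n%:R * x + y)| <= P%:R * M.
Proof.
move=> FP FM; rewrite -normrM -(ler_pM2l (ltr0n R 2)) -{1}(ger0_norm (ler0n R 2)) -normrM.
pose G n := F n * sin (2 * pi * (n%:R * x + y) - pi * (P%:R * x)).
have -> : 2 * (sin (pi * (P%:R * x)) * \sum_(0 <= n < X) F n * cs (n%:R * x + y)) =
          \sum_(0 <= n < X) (G (n + P)%N - G n).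
  rewrite mulrA mulr_sumr; apply: eq_bigr => n _; rewrite /G FP -mulrBr /cs.
  set a := pi * (P%:R * x); set b := 2 * pi * (n%:R * x + y).
  have -> : 2 * pi * ((n + P)%:R * x + y) - a = b + a by rewrite natrD /a /b; ring.
  by rewrite sinD sinB; ring.
rewrite telescope_shift (le_trans (ler_norm_sum _ _ _)) //.
have GM n : `|G n| <= M.
  by rewrite /G normrM (le_trans _ (FM n)) // ler_piMr // sin_max.
apply: le_trans (_ : \sum_(0 <= i < P) (2 * M) <= _).
  by apply: ler_sum => i _; rewrite (le_trans (ler_normB _ _)) // mulrDl mul1r lerD.
by rewrite sumr_const_nat subn0 -[_ *+ P]mulr_natl mulrCA.
Qed.

End Trigonometry.

Lemma prod_primes_sqfree d : sqfree d -> (\prod_(p <- primes d) p)%N = d.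
Proof.
elim/sqfree_ind => [|p t pp pt st IH]; first by rewrite big_nil.
by rewrite (perm_big _ (perm_primesM pp pt (sqfree_gt0 st))) big_cons IH.
Qed.

Lemma sqfree_dvd_fact d m : sqfree d -> (forall p, prime p -> (p %| d)%N -> (p <= m)%N) ->
  (d %| m`!)%N.
Proof.
move=> sd h; rewrite -(prod_primes_sqfree sd); apply: dvdn_prod_primes.
- exact: primes_uniq.
- by apply/allP => p; rewrite mem_primes => /andP[].
- apply/allP => p; rewrite mem_primes => /and3P[pp _ pd].
  by rewrite dvdn_fact // prime_gt0 //= h.
Qed.

Lemma dvdn_gcd_mul q a b : (q %| a * b)%N -> (q %| gcdn q a * gcdn q b)%N.
Proof.
move=> h; rewrite muln_gcdr !muln_gcdl !dvdn_gcd.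
by rewrite h dvdn_mulr // dvdn_mull // dvdn_mulr.
Qed.

(** * Ramanujan sums and Selberg weights *)

Section Ramanujan.
Context {R : realType}.
Implicit Types (F a : nat -> R).

(* The Ramanujan sum [c_r(n)], for squarefree [r]. *)
Definition ramanujan (r n : nat) : R :=
  primeprod (fun p => if (p %| n)%N then p%:R - 1 else -1) r.

Lemma ramanujan1 n : ramanujan 1 n = 1.
Proof. exact: primeprod1. Qed.

Lemma ramanujan_primeM p t n : prime p -> ~~ (p %| t)%N -> (0 < t)%N ->
  ramanujan (p * t) n = (if (p %| n)%N then p%:R - 1 else -1) * ramanujan t n.
Proof. by move=> *; rewrite /ramanujan primeprodM. Qed.

Lemma ramanujan_add r n P : (r %| P)%N -> ramanujan r (n + P) = ramanujan r n.
Proof.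
move=> rP; apply: eq_primeprod => p _ pr.
by rewrite dvdn_addl // (dvdn_trans pr).
Qed.

Lemma norm_ramanujan_le r n : `|ramanujan r n| <= phi r.
Proof.
rewrite /ramanujan /phi /primeprod normr_prod !big_seq; apply: ler_prod => p.
rewrite mem_primes => /andP[/(@prime_ge2 R) p2 _]; rewrite normr_ge0 /=.
case: ifP => _; first by rewrite ger0_norm; lra.
by rewrite normrN1; lra.
Qed.

Lemma ramanujan_coprime r n : (forall p, prime p -> (p %| r)%N -> ~~ (p %| n)%N) -> ramanujan r n = mob r.
Proof. by move=> h; apply: eq_primeprod => p pp /(h p pp) /negbTE ->. Qed.

Lemma ramanujan_mul p r k : prime p -> ~~ (p %| r)%N -> ramanujan r (p * k) = ramanujan r k.
Proof.
move=> pp pr; apply: eq_primeprod => q qq qr.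
rewrite Euclid_dvdM // dvdn_prime2 //; case: eqP => [qp|//].
by rewrite qp (negbTE pr) in qr.
Qed.

Lemma sum_periodic_blocks F P k i : (forall n, F (n + P)%N = F n) ->
  \sum_(0 <= n < k * P + i) F n = k%:R * (\sum_(0 <= n < P) F n) + \sum_(0 <= n < i) F n.
Proof.
move=> FP; have FkP j n : F (n + j * P)%N = F n.
  by elim: j => [|j IH]; rewrite ?addn0 // mulSn addnCA addnC FP.
elim: k => [|k IH]; first by rewrite mul0n add0n mul0r add0r.
rewrite mulSn -addnA (@big_cat_nat _ _ _ P) ?leq_addr //=.
rewrite -{2}[P]add0n big_addn addKn -natr1 mulrDl mul1r addrAC addrC; congr (_ + _).
by rewrite -IH; apply: eq_bigr => n _.
Qed.

Lemma sum_coprime_perm F P p : (forall n, F (n + P)%N = F n) -> coprime p P ->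
  \sum_(0 <= k < P) F (p * k)%N = \sum_(0 <= n < P) F n.
Proof.
move=> FP cpP; case: P FP cpP => [|P] FP cpP; first by rewrite !big_geq.
have Fm n : F n = F (n %% P.+1)%N.
  rewrite {1}(divn_eq n P.+1); elim: (n %/ _)%N => [|j IH]; first by rewrite mul0n add0n.
  by rewrite mulSn -addnA addnC FP.
rewrite !big_mkord.
pose f (k : 'I_P.+1) : 'I_P.+1 := inord ((p * k) %% P.+1).
have fE k : val (f k) = ((p * k) %% P.+1)%N by rewrite /= inordK // ltn_pmod.
have f_inj : injective f.
  move=> k l /(congr1 val); rewrite !fE => /eqP.
  have cP : coprime P.+1 p by rewrite coprime_sym.
  wlog kl : k l / (k <= l)%N.
    by move=> W; case: (leqP k l) => [|/ltnW] h e; [|symmetry]; apply: W; rewrite // eq_sym.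
  rewrite eq_sym eqn_mod_dvd ?leq_mul2l ?kl ?orbT // -mulnBr Gauss_dvdr //.
  move=> /dvdnP[c hc]; apply/val_inj/eqP; rewrite /= eqn_leq kl /= -subn_eq0 hc.
  case: c hc => // c hc; have := ltn_ord l; have : (P.+1 <= l - k)%N by rewrite hc leq_pmull.
  lia.
rewrite [RHS](reindex_inj f_inj) /=; apply: eq_bigr => k _.
by rewrite Fm -fE.
Qed.

(** Chinese remainder theorem: over a period [p P], divisibility by [p] is independent of the class
    modulo [P]. For [u = p - 1], [v = -1] the factor vanishes, which is the orthogonality of
    Ramanujan sums. *)
Lemma sum_prime_factor F P p (u v : R) : (forall n, F (n + P)%N = F n) -> prime p -> coprime p P ->
  \sum_(0 <= n < p * P) (if (p %| n)%N then u else v) * F n =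
  (u + (p%:R - 1) * v) * \sum_(0 <= n < P) F n.
Proof.
move=> FP pp cpP.
have -> : \sum_(0 <= n < p * P) (if (p %| n)%N then u else v) * F n =
  v * (\sum_(0 <= n < p * P) F n) + (u - v) * (\sum_(0 <= n < p * P | (p %| n)%N && true) F n).
  rewrite [X in _ + _ * X]big_mkcond !mulr_sumr -big_split; apply: eq_bigr => n _ /=.
  by rewrite andbT; case: ifP => _; ring.
rewrite big_nat_multiples ?prime_gt0 //.
have -> : \sum_(0 <= t < p * P | (p * t < p * P)%N && true) F (p * t)%N = \sum_(0 <= t < P) F (p * t)%N.
  rewrite (@big_cat_nat _ _ _ P) ?leq_pmull ?prime_gt0 //= [X in _ + X]big1_seq ?addr0; last first.
    by move=> t; rewrite andbT ltn_pmul2l ?prime_gt0 // mem_index_iota; lia.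
  rewrite big_nat_cond [RHS]big_nat; apply: eq_bigl => t.
  by rewrite andbT ltn_pmul2l ?prime_gt0 //; case: (t < P)%N; rewrite ?andbF.
rewrite sum_coprime_perm // -[(p * P)%N]addn0 sum_periodic_blocks // [\sum_(0 <= n < 0) _]big_geq //.
by rewrite addr0; ring.
Qed.

Lemma ramanujan_orthogonal_aux p t r' : prime p -> ~~ (p %| t)%N -> ~~ (p %| r')%N -> (0 < t)%N ->
  \sum_(0 <= n < (p * t) * r') ramanujan (p * t) n * ramanujan r' n = 0.
Proof.
move=> pp pt pr t0; rewrite -mulnA.
under eq_bigr do rewrite ramanujan_primeM // -mulrA.
rewrite (@sum_prime_factor (fun n => ramanujan t n * ramanujan r' n)) //.
- by rewrite mulrN1 subrr mul0r.
- by move=> n; rewrite (ramanujan_add _ (dvdn_mulr _ (dvdnn t))) (ramanujan_add _ (dvdn_mull _ (dvdnn r'))).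
- by rewrite prime_coprime // Euclid_dvdM // negb_or pt pr.
Qed.

Lemma ramanujan_orthogonal r r' : sqfree r -> sqfree r' -> r != r' ->
  \sum_(0 <= n < r * r') ramanujan r n * ramanujan r' n = 0.
Proof.
move=> sr sr' rr'.
have key (a b : nat) : sqfree a -> sqfree b -> (exists2 p, prime p & (p %| a)%N && ~~ (p %| b)%N) ->
    \sum_(0 <= n < a * b) ramanujan a n * ramanujan b n = 0.
  move=> sa sb [p pp /andP[pa pb]]; have [t [-> pt st]] := sqfree_factor sa pp pa.
  by rewrite ramanujan_orthogonal_aux // sqfree_gt0.
have [/hasP[p]|h1] := boolP (has (fun p => ~~ (p %| r')%N) (primes r)).
  by rewrite mem_primes => /and3P[pp _ pr] pr'; apply: key => //; exists p; rewrite ?pr.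
have [/hasP[p]|h2] := boolP (has (fun p => ~~ (p %| r)%N) (primes r')).
  rewrite mem_primes => /and3P[pp _ pr'] pr; under eq_bigr do rewrite mulrC.
  by rewrite mulnC; apply: key => //; exists p; rewrite ?pr'.
case/negP: rr'; rewrite eqn_dvd -{1}(prod_primes_sqfree sr) -{2}(prod_primes_sqfree sr').
rewrite !dvdn_prod_primes ?primes_uniq //.
- by apply/allP => p; rewrite mem_primes => /andP[].
- by move: h2; rewrite -all_predC; apply: sub_all => p /= /negbNE.
- by apply/allP => p; rewrite mem_primes => /andP[].
- by move: h1; rewrite -all_predC; apply: sub_all => p /= /negbNE.
Qed.

Lemma ramanujan_square r : sqfree r -> \sum_(0 <= n < r) ramanujan r n ^+ 2 = r%:R * phi r.
Proof.
elim/sqfree_ind => [|p t pp pt st IH].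
  by rewrite big_nat1 ramanujan1 expr1n /phi primeprod1 mulr1.
have t0 := sqfree_gt0 st.
under eq_bigr => n _ do rewrite ramanujan_primeM // exprMn (fun_if (fun x : R => x ^+ 2)).
rewrite (@sum_prime_factor (fun n => ramanujan t n ^+ 2)) //.
- by rewrite IH /phi primeprodM // natrM; ring.
- by move=> n; rewrite ramanujan_add.
- by rewrite prime_coprime.
Qed.

End Ramanujan.

(** * Mean squares and Fourier coefficients of sieve sums *)

Section SieveWeights.
Context {R : realType}.
Implicit Types (a : nat -> R) (I : pred nat).

(** A Selberg sieve in the basis of Ramanujan sums in place of divisor sums; its square is the
    majorant. The index set [I] is a parameter because the sum is later split by divisibility of [r]
    by one prime. *)
Definition sieve I a D n : R := \sum_(0 <= r < D.+1 | sqfree r && I r) a r * ramanujan r n.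

Lemma sum_index_le I (c : R) D (F : nat -> R) : 0 <= c ->
  (forall r, (r <= D)%N -> sqfree r -> I r -> F r <= c) ->
  \sum_(0 <= r < D.+1 | sqfree r && I r) F r <= D%:R * c.
Proof.
move=> c0 h; rewrite big_mkcond big_nat_recl //= add0r.
apply: le_trans (_ : \sum_(0 <= i < D) c <= _); last by rewrite sumr_const_nat subn0 mulr_natl.
rewrite big_nat [leRHS]big_nat; apply: ler_sum => r rD; case: ifP => // /andP[sr Ir].
exact: h.
Qed.

Lemma ramanujan_pair_le r r' D n : sqfree r -> sqfree r' -> (r <= D)%N -> (r' <= D)%N ->
  `|ramanujan r n * ramanujan r' n| <= D%:R ^+ 2 :> R.
Proof.
move=> sr sr' rD rD'; rewrite normrM expr2 ler_pM //.
  by rewrite (le_trans (norm_ramanujan_le _ _)) // (le_trans (phi_le sr)) // ler_nat.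
by rewrite (le_trans (norm_ramanujan_le _ _)) // (le_trans (phi_le sr')) // ler_nat.
Qed.

(** Complete periods are evaluated by orthogonality; the incomplete one has at most [D ^ 2] terms of
    size at most [D ^ 2]. *)
Lemma ramanujan_pair_sum r r' X D : sqfree r -> sqfree r' -> (r <= D)%N -> (r' <= D)%N ->
  `|\sum_(0 <= n < X) ramanujan r n * ramanujan r' n| <=
    (if r == r' then X%:R * phi r else 0) + D%:R ^+ 4 :> R.
Proof.
move=> sr sr' rD rD'.
have tail P i : (P <= D ^ 2)%N -> (i <= P)%N ->
    `|\sum_(0 <= n < i) ramanujan r n * ramanujan r' n| <= D%:R ^+ 4 :> R.
  move=> PD iP; apply: le_trans (ler_norm_sum _ _ _) _.
  apply: le_trans (_ : \sum_(0 <= n < i) D%:R ^+ 2 <= _).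
    by apply: ler_sum => n _; apply: ramanujan_pair_le.
  rewrite sumr_const_nat subn0 -[leLHS]mulr_natl (_ : 4%N = (2 + 2)%N) // exprD ler_wpM2r ?exprn_ge0 //.
  by rewrite -natrX ler_nat (leq_trans iP).
have r0 := sqfree_gt0 sr; have r0' := sqfree_gt0 sr'.
case: eqP => [e|/eqP ne].
  rewrite -e in sr' rD' tail *.
  have rD2 : (r <= D ^ 2)%N by rewrite (leq_trans rD) // -{1}(expn1 D) leq_pexp2l // (leq_trans r0).
  rewrite {1}(divn_eq X r) sum_periodic_blocks; last by move=> n; rewrite !ramanujan_add.
  under eq_bigr do rewrite -expr2.
  rewrite ramanujan_square // (le_trans (ler_normD _ _)) // lerD //; last first.
    by apply: (tail r) => //; rewrite ltnW // ltn_pmod.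
  rewrite ger0_norm ?mulr_ge0 ?(ltW (phi_gt0 _)) // mulrA ler_wpM2r ?(ltW (phi_gt0 _)) //.
  by rewrite -natrM ler_nat leq_divM.
have PD : (r * r' <= D ^ 2)%N by rewrite -mulnn leq_mul.
rewrite {1}(divn_eq X (r * r')) sum_periodic_blocks; last first.
  by move=> n; rewrite (ramanujan_add _ (dvdn_mulr _ (dvdnn r))) (ramanujan_add _ (dvdn_mull _ (dvdnn r'))).
rewrite ramanujan_orthogonal // mulr0 !add0r; apply: (tail (r * r')%N) => //.
by rewrite ltnW // ltn_pmod // muln_gt0 r0.
Qed.

Lemma sieve_bilinear I1 I2 a D X (w : nat -> R) :
  \sum_(0 <= n < X) sieve I1 a D n * sieve I2 a D n * w n =
  \sum_(0 <= r < D.+1 | sqfree r && I1 r) \sum_(0 <= r' < D.+1 | sqfree r' && I2 r')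
    a r * a r' * \sum_(0 <= n < X) ramanujan r n * ramanujan r' n * w n.
Proof.
rewrite /sieve; under eq_bigr => n _.
  rewrite mulr_suml mulr_suml; under eq_bigr => r _ do rewrite mulr_sumr mulr_suml.
  over.
rewrite exchange_big /=; apply: eq_bigr => r _; rewrite exchange_big /=.
by apply: eq_bigr => r' _; rewrite mulr_sumr; apply: eq_bigr => n _; ring.
Qed.

Lemma sieve_pairs_le I1 I2 a D (S : nat -> nat -> R) (E : R) : 0 <= E ->
  (forall r, sqfree r -> I1 r || I2 r -> `|a r| <= 1) ->
  (forall r r', (r <= D)%N -> (r' <= D)%N -> sqfree r -> sqfree r' -> I1 r -> I2 r' -> `|S r r'| <= E) ->
  `|\sum_(0 <= r < D.+1 | sqfree r && I1 r) \sum_(0 <= r' < D.+1 | sqfree r' && I2 r')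
    a r * a r' * S r r'| <= D%:R ^+ 2 * E.
Proof.
move=> E0 a1 hS; apply: le_trans (ler_norm_sum _ _ _) _.
rewrite expr2 -mulrA; apply: sum_index_le; first by rewrite mulr_ge0.
move=> r rD sr Ir; apply: le_trans (ler_norm_sum _ _ _) _; apply: sum_index_le => // r' rD' sr' Ir'.
rewrite !normrM -[leRHS]mul1r ler_pM ?mulr_ge0 // ?hS //.
by rewrite -[leRHS]mulr1 ler_pM // a1 // ?Ir // Ir' orbT.
Qed.

(** Orthogonality leaves the diagonal; each of the at most [D ^ 2] pairs leaves an error of at most
    [D ^ 4]. *)
Lemma sieve_sq_sum I a D X : (forall r, sqfree r -> I r -> `|a r| <= 1) ->
  \sum_(0 <= n < X) sieve I a D n ^+ 2 <=
  X%:R * (\sum_(0 <= r < D.+1 | sqfree r && I r) a r ^+ 2 * phi r) + D%:R ^+ 6.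
Proof.
move=> a1; under eq_bigr do rewrite expr2 -[_ * _]mulr1.
rewrite (@sieve_bilinear _ _ _ _ _ (fun=> 1)).
have -> : D%:R ^+ 6 = D%:R * (D%:R * D%:R ^+ 4) :> R by ring.
apply: le_trans (_ : \sum_(0 <= r < D.+1 | sqfree r && I r)
   (X%:R * (a r ^+ 2 * phi r) + D%:R * D%:R ^+ 4) <= _); last first.
  by rewrite big_split /= -mulr_sumr lerD2l; apply: sum_index_le => //; rewrite mulr_ge0 ?exprn_ge0.
rewrite big_nat_cond [leRHS]big_nat_cond; apply: ler_sum => r /andP[/andP[_ rD] /andP[sr Ir]].
apply: le_trans (_ : \sum_(0 <= r' < D.+1 | sqfree r' && I r')
   ((if r' == r then X%:R * (a r ^+ 2 * phi r) else 0) + D%:R ^+ 4) <= _).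
  rewrite big_nat_cond [leRHS]big_nat_cond; apply: ler_sum => r' /andP[/andP[_ rD'] /andP[sr' Ir']].
  under eq_bigr do rewrite mulr1.
  apply: le_trans (ler_norm _) _; rewrite !normrM.
  have := @ramanujan_pair_sum r r' X D sr sr' rD rD'.
  rewrite [r' == r]eq_sym; set S := `|\sum_(_ <= _ < _) _|; have S0 : 0 <= S by exact: normr_ge0.
  case: eqP => [<-|_] hS.
    have ha := a1 r sr Ir; have X0 : 0 <= X%:R * phi r :> R by rewrite mulr_ge0 // ltW // phi_gt0.
    have -> : a r ^+ 2 = `|a r| ^+ 2 by rewrite real_normK // num_real.
    move: `|a r| (normr_ge0 (a r)) ha => b b0 b1.
    have b2 : b * b <= 1 by nra.
    have b20 : 0 <= b * b by nra.
    apply: le_trans (ler_wpM2l b20 hS) _.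
    rewrite mulrDr; apply: lerD; first by rewrite le_eqVlt; apply/orP; left; apply/eqP; ring.
    by rewrite ler_piMl // exprn_ge0.
  rewrite add0r in hS *; apply: le_trans hS; rewrite ler_piMl //.
  by rewrite -[leRHS]mulr1 ler_pM // a1.
rewrite big_split /= lerD //; last by apply: sum_index_le; rewrite ?exprn_ge0.
rewrite -big_mkcondr /=.
apply: le_trans (_ : \sum_(0 <= r' < D.+1 | r' == r) X%:R * (a r ^+ 2 * phi r) <= _).
  have Z0 : 0 <= X%:R * (a r ^+ 2 * phi r) by rewrite mulr_ge0 // mulr_ge0 ?sqr_ge0 ?phi_ge0.
  rewrite big_mkcond [leRHS]big_mkcond; apply: ler_sum => r' _.
  by case: (r' == r); rewrite ?andbF //; case: ifP.
rewrite big_const_seq iter_addr_0 count_uniq_mem ?iota_uniq // -[leRHS]mulr1n.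
by rewrite ler_wpMn2l ?leq_b1 // mulr_ge0 // mulr_ge0 ?sqr_ge0 ?phi_ge0.
Qed.

Lemma ramanujan_pair_cs r r' X D (e x y : R) : sqfree r -> sqfree r' -> (r <= D)%N -> (r' <= D)%N ->
  0 < e -> ~ nearint e ((r * r')%:R * x) ->
  `|\sum_(0 <= n < X) ramanujan r n * ramanujan r' n * cs (n%:R * x + y)| <= D%:R ^+ 4 / e :> R.
Proof.
move=> sr sr' rD rD' e0 far.
have FP n : ramanujan r (n + r * r') * ramanujan r' (n + r * r') = ramanujan r n * ramanujan r' n :> R.
  by rewrite (ramanujan_add _ (dvdn_mulr _ (dvdnn r))) (ramanujan_add _ (dvdn_mull _ (dvdnn r'))).
have FM n : `|ramanujan r n * ramanujan r' n| <= D%:R ^+ 2 :> R by apply: ramanujan_pair_le.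
have := periodic_cs_sum x y X FP FM; have := far_sin far.
set S := `|\sum_(_ <= _ < _) _|; have S0 : 0 <= S by exact: normr_ge0.
move=> h1 h2; rewrite ler_pdivlMr // mulrC.
apply: le_trans (_ : (r * r')%:R * D%:R ^+ 2 <= _).
  by apply: le_trans h2; rewrite ler_wpM2r.
rewrite (_ : 4%N = (2 + 2)%N) // exprD ler_wpM2r ?exprn_ge0 //.
by rewrite -natrX ler_nat -mulnn leq_mul.
Qed.

Lemma sum_inv_phi_dvd z l D : prime l ->
  \sum_(0 <= r < D.+1 | sqfree r && (smooth z r && (l %| r)%N)) (phi r)^-1 <=
  (l%:R - 1)^-1 * \sum_(0 <= r < D.+1 | sqfree r && smooth z r) (phi r)^-1 :> R.
Proof.
move=> pl; have l2 := @prime_ge2 R _ pl.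
under eq_bigl do rewrite andbA andbC.
rewrite big_nat_multiples ?prime_gt0 // mulr_sumr.
rewrite big_mkcond [leRHS]big_mkcond; apply: ler_sum => t _.
have F0 : 0 <= (l%:R - 1)^-1 * (phi t)^-1 :> R.
  by rewrite mulr_ge0 ?invr_ge0 ?phi_ge0 //; lra.
case: ifP => [/andP[_ /andP[slt zlt]]|_]; last by case: ifP.
have lt : ~~ (l %| t)%N.
  have /sqfreeP[_ /(_ _ pl)] := slt; apply: contra => d.
  by rewrite expnS expn1 dvdn_pmul2l ?prime_gt0.
have st : sqfree t by rewrite sqfree_primeM in slt.
have t0 := sqfree_gt0 st.
move: zlt; rewrite smooth_primeM // => /andP[_ zt]; rewrite st zt /=.
by rewrite /phi primeprodM // invfM.
Qed.

(** For two products [P], [P1] with near integers [A], [A1], the integer [P A1 - P1 A] has absolute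
    value below [1]. So all the fractions [A / P] agree, and [q] is their reduced denominator. *)
Lemma common_denominator (D : nat) (e x : R) P1 (A1 : int) : (0 < P1 <= D ^ 2)%N ->
  2 * D%:R ^+ 2 * e < 1 -> `|P1%:R * x - A1%:~R| <= e ->
  exists q, [/\ (0 < q)%N, (q %| P1)%N, nearint e (q%:R * x) &
    forall P, (P <= D ^ 2)%N -> nearint e (P%:R * x) -> (q %| P)%N].
Proof.
move=> /andP[P10 P1D] De hA1.
have e0 : 0 <= e by apply: le_trans hA1; apply: normr_ge0.
set d := gcdn `|A1|%N P1; have d0 : (0 < d)%N by rewrite gcdn_gt0 P10 orbT.
have dP : (d %| P1)%N by apply: dvdn_gcdr.
have dA : (d %| `|A1|)%N by apply: dvdn_gcdl.
set q := (P1 %/ d)%N; have qE : P1 = (q * d)%N by rewrite divnK.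
have q0 : (0 < q)%N by move: P10; rewrite qE muln_gt0 => /andP[].
exists q; split=> //; first by rewrite qE dvdn_mulr.
  exists (A1 %/ d%:Z)%Z.
  have A1E : A1 = (A1 %/ d%:Z)%Z * d%:Z by rewrite divzK // /dvdz /=.
  apply: le_trans hA1; rewrite {2}A1E qE natrM intrM.
  have -> : q%:R * d%:R * x - (A1 %/ d)%Z%:~R * d%:~R = d%:R * (q%:R * x - (A1 %/ d)%Z%:~R) :> R.
    by rewrite -[d%:~R]/(d%:R); ring.
  by rewrite normrM ger0_norm // ler_peMl // ler1n.
move=> P PD [A hA].
have eqz : P%:Z * A1 = P1%:Z * A.
  have D0 : 0 <= D%:R ^+ 2 :> R by rewrite exprn_ge0.
  have lt1 : `|(P%:Z * A1 - P1%:Z * A)%:~R| < 1 :> R.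
    have -> : (P%:Z * A1 - P1%:Z * A)%:~R =
        P1%:R * (P%:R * x - A%:~R) - P%:R * (P1%:R * x - A1%:~R) :> R.
      by rewrite intrB !intrM -[P%:~R]/(P%:R) -[P1%:~R]/(P1%:R); ring.
    apply: le_lt_trans (ler_normB _ _) _; rewrite !normrM !normr_nat.
    have hP : P%:R <= D%:R ^+ 2 :> R by rewrite -natrX ler_nat.
    have hP1 : P1%:R <= D%:R ^+ 2 :> R by rewrite -natrX ler_nat.
    apply: le_lt_trans (_ : D%:R ^+ 2 * e + D%:R ^+ 2 * e < 1); last by lra.
    by apply: lerD; apply: ler_pM.
  move: lt1; rewrite ltr_norml => /andP[h1 h2].
  have {}h1 : -1 < P%:Z * A1 - P1%:Z * A by rewrite -(ltr_int R) mulrN1z.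
  have {}h2 : P%:Z * A1 - P1%:Z * A < 1 by rewrite -(ltr_int R).
  by lia.
have e1 : (P * `|A1| = P1 * `|A|)%N by have := congr1 absz eqz; rewrite !abszM.
have e2 : (P * (`|A1| %/ d) = q * `|A|)%N.
  apply/eqP; rewrite -(eqn_pmul2r d0) -mulnA divnK // e1 qE; apply/eqP; lia.
have cop : coprime q (`|A1| %/ d) by rewrite coprime_sym /coprime -(eqn_pmul2r d0) muln_gcdl !divnK // mul1n.
by rewrite -(Gauss_dvdl _ cop) e2 dvdn_mulr.
Qed.

(** As [r] and [r'] are squarefree, a [q] with prime factors up to [m] only would have a gcd with
    each that divides [m!], so it would divide [(m!) ^ 2]. This is the origin of the threshold
    [((s ^ 2)!) ^ 2] for denominators. *)
Lemma big_prime_factor q r r' m : sqfree r -> sqfree r' -> (q %| r * r')%N ->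
  (m`! ^ 2 < q)%N -> exists l, [/\ prime l, (m < l)%N & (l %| q)%N].
Proof.
move=> sr sr' qrr mq; have q0 : (0 < q)%N by apply: leq_ltn_trans mq.
have [/hasP[l]|h] := boolP (has (fun l => m < l)%N (primes q)).
  by rewrite mem_primes => /and3P[pl _ lq] ml; exists l.
move: mq; rewrite ltnNge => /negP[]; apply: dvdn_leq; first by rewrite expn_gt0 fact_gt0.
apply: dvdn_trans (dvdn_gcd_mul qrr) _; rewrite -mulnn.
have small (t : nat) : sqfree t -> (gcdn q t %| m`!)%N.
  move=> st; apply: sqfree_dvd_fact; first exact: sqfree_dvd (dvdn_gcdr q t) st.
  move=> p pp pg; rewrite leqNgt; apply: contra h => mp; apply/hasP; exists p => //.
  by rewrite mem_primes pp q0 (dvdn_trans pg) // dvdn_gcdl.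
by rewrite dvdn_mul // small.
Qed.

(* All [P = r r'] with [P x] near an integer share a denominator [q].  Either [q] is
   bounded, or it has a prime factor [l > s ^ 2], and then [l] divides [r] or [r'],
   which by Cauchy-Schwarz saves a factor [s]. *)
Lemma sieve_fourier z a D s (g e x y : R) X : (0 < s)%N -> 0 <= g <= 1 -> 0 < e <= 1 ->
  2 * D%:R ^+ 2 * e < 1 ->
  (forall r, sqfree r -> smooth z r -> `|a r| <= g / phi r) ->
  (exists q, (0 < q <= ((s ^ 2)`!) ^ 2)%N /\ nearint e (q%:R * x)) \/
  `|\sum_(0 <= n < X) sieve (smooth z) a D n ^+ 2 * cs (n%:R * x + y)| <=
    3 * g ^+ 2 * (\sum_(0 <= r < D.+1 | sqfree r && smooth z r) (phi r)^-1) * X%:R / s%:R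
    + (s%:R + 3) * D%:R ^+ 6 / e.
Proof.
move=> s0 /andP[g0 g1] /andP[e0 e1] De ha.
set M := \sum_(0 <= r < D.+1 | _) _.
have M0 : 0 <= M by apply: sumr_ge0 => r _; rewrite invr_ge0 phi_ge0.
have s0' : 1 <= s%:R :> R by rewrite ler1n.
have sp : 0 < s%:R :> R by lra.
have g20 : 0 <= g ^+ 2 by rewrite sqr_ge0.
have D6 : 0 <= D%:R ^+ 6 :> R by rewrite exprn_ge0.
have D6e : D%:R ^+ 6 <= D%:R ^+ 6 / e by rewrite ler_pdivlMr // ler_piMr.
have main0 : 0 <= 3 * g ^+ 2 * M * X%:R / s%:R by rewrite !mulr_ge0 ?invr_ge0 // ?(ltW sp).
have a1 r : sqfree r -> smooth z r -> `|a r| <= 1.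
  move=> sr zr; apply: le_trans (ha r sr zr) _.
  by rewrite ler_pdivrMr ?phi_gt0 // mul1r (le_trans g1) // phi_ge1.
have asq r : sqfree r -> smooth z r -> a r ^+ 2 * phi r <= g ^+ 2 * (phi r)^-1.
  move=> sr zr; have p0 := @phi_gt0 R r; have := ha r sr zr.
  have -> : a r ^+ 2 = `|a r| ^+ 2 by rewrite real_normK // num_real.
  move=> h; apply: le_trans (_ : (g / phi r) ^+ 2 * phi r <= _).
    by rewrite ler_wpM2r ?phi_ge0 // ler_sqr // nnegrE // divr_ge0 // ltW.
  by rewrite le_eqVlt; apply/orP; left; apply/eqP; field; rewrite gt_eqF.
pose bad r r' := [/\ (r <= D)%N, (r' <= D)%N, sqfree r && smooth z r, sqfree r' && smooth z r'
   & nearint e ((r * r')%:R * x)].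
have [[r1 [r1' [r1D r1D' /andP[sr1 zr1] /andP[sr1' zr1'] [A1 hA1]]]]|nobad] :=
    pselect (exists r r', bad r r'); last first.
  right; under eq_bigr do rewrite expr2.
  rewrite sieve_bilinear; apply: le_trans (@sieve_pairs_le _ _ _ _ _ (D%:R ^+ 4 / e) _ _ _) _.
  - by rewrite divr_ge0 ?exprn_ge0 // ltW.
  - by move=> r sr; rewrite orbb; apply: a1.
  - move=> r r' rD rD' sr sr' zr zr'; apply: ramanujan_pair_cs => // near.
    by apply: nobad; exists r, r'; rewrite /bad sr zr sr' zr'.
  - rewrite mulrA -exprD -[leLHS]add0r lerD // ler_wpM2r ?invr_ge0 ?(ltW e0) //.
    by rewrite ler_peMl //; lra.
have P1b : (0 < r1 * r1' <= D ^ 2)%N.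
  by rewrite muln_gt0 !sqfree_gt0 //= -mulnn leq_mul.
have [q [q0 qP1 qnear qdvd]] := common_denominator P1b De hA1.
have [qs|qs] := leqP q ((s ^ 2)`! ^ 2); first by left; exists q; rewrite q0.
right.
have [l [pl ls lq]] := big_prime_factor sr1 sr1' qP1 qs.
pose I1 r := smooth z r && (l %| r)%N; pose I2 r := smooth z r && ~~ (l %| r)%N.
have split n : sieve (smooth z) a D n = sieve I1 a D n + sieve I2 a D n.
  rewrite /sieve (bigID (fun r => l %| r)%N) /=.
  by congr (_ + _); apply: eq_bigl => r; rewrite /I1 /I2 andbA.
have a11 r : sqfree r -> I1 r -> `|a r| <= 1 by move=> sr /andP[zr _]; apply: a1.
have a12 r : sqfree r -> I2 r -> `|a r| <= 1 by move=> sr /andP[zr _]; apply: a1.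
set S1 := \sum_(0 <= n < X) sieve I1 a D n ^+ 2.
set S2 := \sum_(0 <= n < X) sieve I2 a D n ^+ 2.
have hS1 : S1 <= X%:R * (g ^+ 2 * (M / s%:R ^+ 2)) + D%:R ^+ 6.
  apply: le_trans (sieve_sq_sum D X a11) _; rewrite lerD2r ler_wpM2l //.
  apply: le_trans (_ : \sum_(0 <= r < D.+1 | sqfree r && I1 r) g ^+ 2 * (phi r)^-1 <= _).
    by apply: ler_sum => r /andP[sr /andP[zr _]]; apply: asq.
  rewrite -mulr_sumr ler_wpM2l // (le_trans (sum_inv_phi_dvd _ _ pl)) // mulrC ler_wpM2l //.
  rewrite lef_pV2 ?posrE ?exprn_gt0 //; last by have := @prime_ge2 R _ pl; lra.
  by rewrite lerBrDr -natrX natr1 ler_nat.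
have hS2 : S2 <= X%:R * (g ^+ 2 * M) + D%:R ^+ 6.
  apply: le_trans (sieve_sq_sum D X a12) _; rewrite lerD2r ler_wpM2l //.
  apply: le_trans (_ : \sum_(0 <= r < D.+1 | sqfree r && I2 r) g ^+ 2 * (phi r)^-1 <= _).
    by apply: ler_sum => r /andP[sr /andP[zr _]]; apply: asq.
  rewrite -mulr_sumr ler_wpM2l // big_mkcond [leRHS]big_mkcond; apply: ler_sum => r _.
  rewrite /I2; case: (sqfree r); case: (smooth z r); case: (l %| r)%N => //=.
  by rewrite invr_ge0 phi_ge0.
(* No near pair has both indices in [I2]: [l] divides [q], which divides [r r'] for every near
   pair. *)
have E3 : `|\sum_(0 <= n < X) sieve I2 a D n ^+ 2 * cs (n%:R * x + y)| <= D%:R ^+ 6 / e.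
  under eq_bigr do rewrite expr2.
  rewrite sieve_bilinear; apply: le_trans (@sieve_pairs_le _ _ _ _ _ (D%:R ^+ 4 / e) _ _ _) _.
  - by rewrite divr_ge0 ?exprn_ge0 // ltW.
  - by move=> r sr; rewrite orbb; apply: a12.
  - move=> r r' rD rD' sr sr' /andP[zr lr] /andP[zr' lr']; apply: ramanujan_pair_cs => // near.
    have /(dvdn_trans lq) : (q %| r * r')%N by apply: qdvd => //; rewrite -mulnn leq_mul.
    by rewrite Euclid_dvdM // (negbTE lr) (negbTE lr').
  - by rewrite mulrA -exprD.
(* The cross term [2 b1 b2] is split by AM-GM with weight [s]. Since [S1] carries a factor
   [1 / s ^ 2], both [s S1] and [S2 / s] save [s]. *)
have E12 : `|\sum_(0 <= n < X) (sieve I1 a D n ^+ 2 + 2 * (sieve I1 a D n * sieve I2 a D n)) *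
     cs (n%:R * x + y)| <= (1 + s%:R) * S1 + s%:R^-1 * S2.
  apply: le_trans (ler_norm_sum _ _ _) _; rewrite /S1 /S2 !mulr_sumr -big_split /=.
  apply: ler_sum => n _; rewrite normrM; set b1 := sieve I1 _ _ _; set b2 := sieve I2 _ _ _.
  apply: le_trans (_ : `|b1 ^+ 2 + 2 * (b1 * b2)| <= _); first by rewrite ler_piMr // cs_le1.
  have h : 0 <= (s%:R * b1 - b2) ^+ 2 / s%:R by rewrite divr_ge0 ?sqr_ge0 // ltW.
  have h' : 0 <= (s%:R * b1 + b2) ^+ 2 / s%:R by rewrite divr_ge0 ?sqr_ge0 // ltW.
  have eh : (s%:R * b1 - b2) ^+ 2 / s%:R = s%:R * b1 ^+ 2 - 2 * (b1 * b2) + s%:R^-1 * b2 ^+ 2.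
    by field; rewrite gt_eqF.
  have eh' : (s%:R * b1 + b2) ^+ 2 / s%:R = s%:R * b1 ^+ 2 + 2 * (b1 * b2) + s%:R^-1 * b2 ^+ 2.
    by field; rewrite gt_eqF.
  rewrite eh in h; rewrite eh' in h'; have b10 : 0 <= b1 ^+ 2 by apply: sqr_ge0.
  by rewrite ler_norml; apply/andP; split; lra.
have -> : \sum_(0 <= n < X) sieve (smooth z) a D n ^+ 2 * cs (n%:R * x + y) =
   \sum_(0 <= n < X) (sieve I1 a D n ^+ 2 + 2 * (sieve I1 a D n * sieve I2 a D n)) *
     cs (n%:R * x + y) + \sum_(0 <= n < X) sieve I2 a D n ^+ 2 * cs (n%:R * x + y).
  by rewrite -big_split /=; apply: eq_bigr => n _; rewrite split; ring.
apply: le_trans (ler_normD _ _) _; apply: le_trans (lerD E12 E3) _.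
have si0 : 0 < s%:R^-1 :> R by rewrite invr_gt0.
have si1 : s%:R^-1 <= 1 :> R by rewrite invf_le1.
have k1 : (1 + s%:R) * S1 <= (1 + s%:R) * (X%:R * (g ^+ 2 * (M / s%:R ^+ 2)) + D%:R ^+ 6).
  by rewrite ler_wpM2l //; lra.
have k2 : s%:R^-1 * S2 <= s%:R^-1 * (X%:R * (g ^+ 2 * M) + D%:R ^+ 6) by rewrite ler_wpM2l // ltW.
have k3 : (1 + s%:R) * (X%:R * (g ^+ 2 * (M / s%:R ^+ 2))) <= 2 * g ^+ 2 * M * X%:R / s%:R.
  have -> : (1 + s%:R) * (X%:R * (g ^+ 2 * (M / s%:R ^+ 2))) =
    (s%:R^-1 + 1) * (g ^+ 2 * M * X%:R / s%:R) by field; rewrite gt_eqF.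
  have -> : 2 * g ^+ 2 * M * X%:R / s%:R = 2 * (g ^+ 2 * M * X%:R / s%:R) by ring.
  by rewrite ler_wpM2r //; [rewrite !mulr_ge0 // ltW | lra].
have k4 : s%:R^-1 * D%:R ^+ 6 <= D%:R ^+ 6 :> R by rewrite ler_piMl.
have k5 : (1 + s%:R) * D%:R ^+ 6 <= (1 + s%:R) * (D%:R ^+ 6 / e) :> R by rewrite ler_wpM2l //; lra.
have -> : (s%:R + 3) * D%:R ^+ 6 / e = (1 + s%:R) * (D%:R ^+ 6 / e) + D%:R ^+ 6 / e + D%:R ^+ 6 / e by ring.
have -> : 3 * g ^+ 2 * M * X%:R / s%:R = 2 * g ^+ 2 * M * X%:R / s%:R + s%:R^-1 * (X%:R * (g ^+ 2 * M)) by ring.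
rewrite mulrDr in k1; rewrite mulrDr in k2.
move: k1 k2 k3 k4 k5 D6e; move: (_ * S1) (_ * S2) (_ / e) => A B C; lra.
Qed.

Lemma sieve_mean z a D (g : R) X : 0 <= g <= 1 ->
  (forall r, sqfree r -> smooth z r -> `|a r| <= g / phi r) ->
  \sum_(0 <= n < X) sieve (smooth z) a D n ^+ 2 <=
    g ^+ 2 * (\sum_(0 <= r < D.+1 | sqfree r && smooth z r) (phi r)^-1) * X%:R + D%:R ^+ 6.
Proof.
move=> /andP[g0 g1] ha.
have a1 r : sqfree r -> smooth z r -> `|a r| <= 1.
  move=> sr zr; apply: le_trans (ha r sr zr) _.
  by rewrite ler_pdivrMr ?phi_gt0 // mul1r (le_trans g1) // phi_ge1.
apply: le_trans (sieve_sq_sum D X a1) _; rewrite lerD2r mulrC ler_wpM2r // mulr_sumr.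
apply: ler_sum => r /andP[sr zr]; have p0 := @phi_gt0 R r; have := ha r sr zr.
have -> : a r ^+ 2 = `|a r| ^+ 2 by rewrite real_normK // num_real.
move=> h; apply: le_trans (_ : (g / phi r) ^+ 2 * phi r <= _).
  by rewrite ler_wpM2r ?phi_ge0 // ler_sqr // nnegrE // divr_ge0 // ltW.
by rewrite le_eqVlt; apply/orP; left; apply/eqP; field; rewrite gt_eqF.
Qed.

End SieveWeights.

(** * Selberg weights, flat and damped *)

Section SelbergWeights.
Context {R : realType}.
Implicit Types (h : nat -> R).
Local Notation L := (@log_nat R).

(* Selberg's optimal weights correspond to [h = 1]; [h = damp D] cuts off
   logarithmically at [D], which makes the mass of non-rough numbers small. *)
Definition selberg_sum z h D : R :=
  \sum_(0 <= r < D.+1 | sqfree r && smooth z r) h r / phi r.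
Definition selberg z h D r : R := h r * mob r / (selberg_sum z h D * phi r).

Lemma selberg_sum_ge1 z h D : (0 < D)%N -> (forall r, 0 <= h r) -> h 1%N = 1 ->
  1 <= selberg_sum z h D.
Proof.
move=> D0 h0 h1; rewrite /selberg_sum.
rewrite (bigID (fun r => r == 1%N)) /= -[leLHS]addr0 lerD //.
  rewrite (big_rem 1%N) ?mem_index_iota //= h1 /phi primeprod1 divr1 lerDl big_seq_cond.
  by apply: sumr_ge0 => r /andP[_ /andP[_ /eqP ->]]; rewrite h1 primeprod1 divr1.
rewrite big_nat_cond; apply: sumr_ge0 => r /andP[/andP[_ rD] /andP[/andP[sr _] _]].
by rewrite divr_ge0 ?phi_ge0.
Qed.

Lemma selberg_le z h D r : (0 < D)%N -> (forall r, 0 <= h r) -> h 1%N = 1 ->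
  `|h r| <= 1 -> `|selberg z h D r| <= (selberg_sum z h D)^-1 / phi r.
Proof.
move=> D0 h0 h1 hr; have G1 := selberg_sum_ge1 z D0 h0 h1.
have G0 : 0 < selberg_sum z h D by lra.
have p0 := @phi_gt0 R r.
rewrite /selberg !normrM norm_mob mulr1 normfV normrM (gtr0_norm G0) (gtr0_norm p0) invfM.
by rewrite -[leRHS]mul1r ler_wpM2r // mulr_ge0 ?invr_ge0 // ltW.
Qed.

(** On rough [n] every [c_r (n)] equals the Moebius value of [r], so the terms add up to the
    normalisation of the weights. *)
Lemma sieve_rough z h D n : selberg_sum z h D != 0 ->
  (forall p, prime p -> (p < z)%N -> ~~ (p %| n)%N) ->
  sieve (smooth z) (selberg z h D) D n = 1.
Proof.
move=> G0 hn; rewrite /sieve.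
transitivity (\sum_(0 <= r < D.+1 | sqfree r && smooth z r) (selberg_sum z h D)^-1 * (h r / phi r)).
  apply: eq_bigr => r /andP[sr zr]; rewrite ramanujan_coprime; last first.
    move=> p pp pr; apply: hn => //; apply: (allP zr).
    by rewrite mem_primes pp sqfree_gt0.
  have p0 : phi r != 0 :> R by rewrite gt_eqF // phi_gt0.
  rewrite /selberg.
  have -> : h r * mob r / (selberg_sum z h D * phi r) * mob r =
    h r * (mob r) ^+ 2 / (selberg_sum z h D * phi r) by ring.
  by rewrite mob_sqr mulr1 invfM; ring.
by rewrite -mulr_sumr mulVf.
Qed.

Lemma selberg_sum_flat y : 2^-1 * L y.+1 <= selberg_sum y.+1 (fun=> 1) y.
Proof.
rewrite mulrC ler_pdivrMr // mulrC; apply: le_trans (log_le_sqfree y) _.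
rewrite ler_wpM2l // big_nat_cond [leRHS]big_nat_cond.
rewrite big_mkcond [leRHS]big_mkcond; apply: ler_sum => r _.
case: ifP => [/andP[/andP[r0 ry] sr]|_]; last first.
  by case: ifP => // _; rewrite divr_ge0 ?phi_ge0.
have -> : smooth y.+1 r.
  apply/allP => p; rewrite mem_primes => /and3P[_ rp /dvdn_leq]; rewrite sqfree_gt0 // => /(_ isT).
  by move/leq_ltn_trans; apply.
rewrite r0 ry sr /= div1r lef_pV2 ?posrE ?phi_gt0 ?phi_le //.
by rewrite ltr0n sqfree_gt0.
Qed.

Definition damp D r : R := Num.max 0 (1 - L r / L D).

Lemma damp_itv D r : (1 < D)%N -> 0 <= damp D r <= 1.
Proof.
move=> D1; have LD : 0 < L D by rewrite /log_nat ln_gt0 // ltr1n.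
rewrite /damp le_max lexx /= ge_max ler01 /=.
by rewrite gerDl oppr_le0 divr_ge0 ?log_nat_ge0 // ltW.
Qed.

Lemma norm_damp D r : (1 < D)%N -> `|damp D r| <= 1.
Proof. by move=> /(damp_itv r) /andP[h0 h1]; rewrite ger0_norm. Qed.

Lemma damp1 D : damp D 1 = 1.
Proof. by rewrite /damp /log_nat ln1 mul0r subr0; apply: max_r. Qed.

Lemma damp_step D p t : (1 < D)%N -> (0 < p)%N -> (0 < t)%N ->
  0 <= damp D t - damp D (p * t) <= L p / L D.
Proof.
move=> D1 p0 t0; have LD : 0 < L D by rewrite /log_nat ln_gt0 // ltr1n.
rewrite /damp log_natM // mulrDl; have : 0 <= L p / L D by rewrite divr_ge0 ?log_nat_ge0 // ltW.
move: (L p / L D) (L t / L D) => a b a0; rewrite /Num.max.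
by case: ltP => h1; case: ltP => h2; apply/andP; split; lra.
Qed.

(** Only [r < z] are kept: they are all smooth, and as [u >= 2] their damping factor is at least
    [1 / 2]. *)
Lemma selberg_sum_damp z u : (3 < z)%N -> (1 < u)%N ->
  4^-1 * L z <= selberg_sum z (damp (z ^ u)) (z ^ u).
Proof.
move=> z3 u2; have z0 : (0 < z)%N by lia.
have z1 : (1 < z)%N by lia.
have zu1 : (1 < z ^ u)%N by rewrite -(expn0 z) ltn_exp2l //; lia.
have Lz : 0 < L z by rewrite /log_nat ln_gt0 // ltr1n.
apply: (@le_trans _ _ (2^-1 * \sum_(0 <= r < z | sqfree r) r%:R^-1)).
  case: z z3 z0 z1 zu1 Lz => // z z3 z0 z1 zu1 Lz; have := @log_le_sqfree R z; lra.
have zzu : (z <= (z ^ u).+1)%N by apply/leqW; rewrite -{1}(expn1 z) leq_pexp2l //; lia.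
rewrite /selberg_sum [leRHS](@big_cat_nat _ _ _ z) //= -[leLHS]addr0 lerD //; last first.
  rewrite big_nat_cond; apply: sumr_ge0 => r /andP[/andP[_ rz] /andP[sr _]].
  by have /andP[h _] := damp_itv r zu1; rewrite divr_ge0 ?phi_ge0.
rewrite mulr_sumr [leLHS]big_nat_cond [leRHS]big_nat_cond [leLHS]big_mkcond [leRHS]big_mkcond.
apply: ler_sum => r _; case: ifP => [/andP[/andP[_ rz] sr]|_]; last first.
  case: ifP => // /andP[/andP[_ rz] /andP[sr _]].
  have /andP[h _] := damp_itv r zu1.
  by rewrite divr_ge0 ?phi_ge0.
have r0 := sqfree_gt0 sr.
have -> : smooth z r.
  apply/allP => p; rewrite mem_primes => /and3P[_ _ /dvdn_leq -/(_ r0)].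
  by move/leq_ltn_trans; apply.
rewrite rz sr /=; apply: ler_pM; rewrite ?invr_ge0 //; last first.
  by rewrite lef_pV2 ?posrE ?phi_gt0 ?phi_le // ltr0n.
rewrite /damp le_max; apply/orP; right; rewrite log_natX //.
have u2' : 2 <= u%:R :> R by rewrite (ler_nat R 2).
have uL : 0 < u%:R * L z by rewrite mulr_gt0 //; lra.
have rzL : L r <= L z by rewrite log_nat_le // ltnW.
have : L r / (u%:R * L z) <= 2^-1 by rewrite ler_pdivrMr //; nra.
lra.
Qed.

Lemma smooth_inv_phi_le z D : (3 < z)%N ->
  \sum_(0 <= r < D.+1 | sqfree r && smooth z r) (phi r)^-1 <= expR 5 * (1 + L z) :> R.
Proof.
move=> z3; pose F (p : nat) : R := if prime p then (p%:R - 1)^-1 else 0.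
have F0 p : 0 <= F p.
  by rewrite /F; case: ifP => // /(@prime_ge2 R) p2; rewrite invr_ge0; lra.
apply: le_trans (_ : \prod_(0 <= p < z | prime p) (1 + F p) <= _); last first.
  apply: le_trans (mertens_product_le z3); rewrite le_eqVlt; apply/orP; left; apply/eqP.
  by apply: eq_bigr => p pp; rewrite /F pp.
apply: le_trans (sum_smooth_le z D.+1 F0); rewrite le_eqVlt; apply/orP; left; apply/eqP.
apply: eq_bigr => r _; rewrite /phi /primeprod -prodfV big_seq [RHS]big_seq.
by apply: eq_bigr => p; rewrite mem_primes /F => /andP[-> _].
Qed.

(** This is the main term in the mean of the squared sieve. The constant is [32 = 2 * 4 ^ 2], from
    [1 + log z <= 2 log z] and the lower bound [log z / 4] for the normalisation. *)
Lemma damp_mass z u : (3 < z)%N -> (1 < u)%N ->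
  (selberg_sum z (damp (z ^ u)) (z ^ u))^-1 ^+ 2 *
    (\sum_(0 <= r < (z ^ u).+1 | sqfree r && smooth z r) (phi r)^-1) <= 32 * expR 5 / L z.
Proof.
move=> z3 u1; have Lz : 1 <= L z.
  have : L 4 <= L z by apply: log_nat_le.
  have := @log_step_ge R 3 isT; have := @log_step_ge R 2 isT.
  have := @log_step_ge R 1 isT; rewrite {2}/log_nat ln1.
  move: (L 2) (L 3) (L 4) (L z) => a b c d; lra.
have Lz0 : 0 < L z by lra.
have G := selberg_sum_damp z3 u1; set g := selberg_sum _ _ _ in G *.
have g0 : 0 < g by lra.
have M := smooth_inv_phi_le (z ^ u) z3; set m := \sum_(_ <= _ < _ | _) _ in M *.
have e0 : 0 < expR 5 :> R by apply: expR_gt0.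
rewrite exprVn mulrC ler_pdivrMr ?exprn_gt0 //.
apply: le_trans M _; rewrite mulrAC ler_pdivlMr //.
have h : (4^-1 * L z) ^+ 2 <= g ^+ 2 by rewrite ler_sqr ?nnegrE //; lra.
have : 32 * expR 5 * ((4^-1 * L z) ^+ 2) <= 32 * expR 5 * g ^+ 2 by rewrite ler_wpM2l //; lra.
apply: le_trans; have -> : 32 * expR 5 * (4^-1 * L z) ^+ 2 = expR 5 * (2 * L z ^+ 2) by field.
rewrite -mulrA ler_wpM2l //; first lra.
by nra.
Qed.

End SelbergWeights.

(** * Rough numbers *)

Definition rough z n := (0 < n)%N && all (fun p => z <= p)%N (primes n).

Lemma roughP z n : reflect ((0 < n)%N /\ forall p, prime p -> (p < z)%N -> ~~ (p %| n)%N) (rough z n).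
Proof.
apply: (iffP andP) => [[n0 /allP h]|[n0 h]]; split=> //.
  move=> p pp pz; apply/negP => pn; have : p \in primes n by rewrite mem_primes pp n0.
  by move/h; rewrite leqNgt pz.
apply/allP => p; rewrite mem_primes => /and3P[pp _ pn]; rewrite leqNgt.
by apply: contraL pn => /(h p pp).
Qed.

Section RoughNumbers.
Context {R : realType}.
Local Notation L := (@log_nat R).

Lemma log_ge1 z : (3 < z)%N -> 1 <= L z.
Proof.
move=> z3; have : L 4 <= L z by apply: log_nat_le.
have := @log_step_ge R 3 isT; have := @log_step_ge R 2 isT.
have := @log_step_ge R 1 isT; rewrite {2}/log_nat ln1.
move: (L 2) (L 3) (L 4) (L z) => a b c d; lra.
Qed.

Lemma log_gt0 z : (1 < z)%N -> 0 < L z.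
Proof. by move=> z1; rewrite /log_nat ln_gt0 // ltr1n. Qed.

(** Weights of the sieve on multiples of [p]. The terms [r] and [p r] have opposite signs there, so
    only the variation of [damp] between them remains, of size at most [log p / log D]. *)
Definition shifted_weights z (D p r : nat) : R :=
  (damp D r - damp D (p * r)) * mob r /
  (selberg_sum z (damp D) D * phi r).

Lemma sieve_multiple z D p k : (1 < D)%N -> prime p -> (p < z)%N -> selberg_sum z (@damp R D) D != 0 ->
  sieve (smooth z) (selberg z (damp D) D) D (p * k) =
  sieve (fun r => smooth z r && ~~ (p %| r)%N) (shifted_weights z D p) D k.
Proof.
move=> D1 pp pz G0; rewrite /sieve [LHS](bigID (fun r => p %| r)%N) /=.
have -> : \sum_(0 <= r < D.+1 | sqfree r && smooth z r && (p %| r)%N)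
     selberg z (damp D) D r * ramanujan r (p * k) =
   \sum_(0 <= r < D.+1 | sqfree r && (smooth z r && ~~ (p %| r)%N))
     - (damp D (p * r) * mob r / (selberg_sum z (damp D) D * phi r) * ramanujan r k) :> R.
  under eq_bigl do rewrite andbC.
  rewrite big_nat_multiples ?prime_gt0 // big_mkcond [RHS]big_mkcond; apply: eq_bigr => t _.
  rewrite ltnS; case: ifP => [/andP[ptD /andP[spt zpt]]|h].
    have pt : ~~ (p %| t)%N.
      have /sqfreeP[_ /(_ _ pp)] := spt; apply: contra => d.
      by rewrite expnS expn1 dvdn_pmul2l ?prime_gt0.
    have st : sqfree t by rewrite sqfree_primeM in spt.
    have t0 := sqfree_gt0 st.
    move: zpt; rewrite smooth_primeM // => /andP[_ zt]; rewrite st zt pt /=.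
    rewrite /selberg ramanujan_primeM // dvdn_mulr // ramanujan_mul // /mob /phi !primeprodM // -/(mob t) -/(phi t).
    have p1 : p%:R - 1 != 0 :> R by have := @prime_ge2 R _ pp; lra.
    have p0 : phi t != 0 :> R by rewrite gt_eqF // phi_gt0.
    by field; rewrite G0 p1 p0.
  case: ifP => // /andP[st /andP[zt pt]]; move: h.
  rewrite sqfree_primeM // st smooth_primeM ?sqfree_gt0 // pz zt /= andbT => /negbT; rewrite -ltnNge => ptD.
  (* For [p t > D] the partner of [t] is missing from the sum, but [damp] would vanish there anyway:
     the cutoff at [D] costs nothing. *)
  rewrite (_ : damp D (p * t) = 0) ?mul0r ?oppr0 //; apply: max_l; rewrite subr_le0.
  by rewrite ler_pdivlMr ?mul1r ?log_gt0 // log_nat_le // ltnW.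
rewrite (eq_bigl (fun r => sqfree r && (smooth z r && ~~ (p %| r)%N)) (fun r => selberg z (damp D) D r * ramanujan r (p * k)));
  last by move=> r; rewrite andbA.
rewrite -big_split /=; apply: eq_bigr => r /andP[sr /andP[zr pr]].
by rewrite ramanujan_mul // /selberg /shifted_weights; ring.
Qed.

Lemma damp_sum_ge1 z D : (1 < D)%N -> 1 <= selberg_sum z (@damp R D) D.
Proof.
move=> D1; apply: selberg_sum_ge1; first exact: ltnW.
  by move=> t; have /andP[] := @damp_itv R D t D1.
exact: damp1.
Qed.

Lemma damp_weights_le z D r : (1 < D)%N ->
  `|selberg z (@damp R D) D r| <= (selberg_sum z (damp D) D)^-1 / phi r.
Proof.
move=> D1; apply: selberg_le; [exact: ltnW | | exact: damp1 | exact: norm_damp].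
by move=> t; have /andP[] := @damp_itv R D t D1.
Qed.

Lemma shifted_weights_le z D p r : prime p -> (1 < D)%N -> (0 < r)%N ->
  `|shifted_weights z D p r| <= L p / L D * ((selberg_sum z (damp D) D)^-1 / phi r).
Proof.
move=> pp D1 r0.
have G0 : 0 < selberg_sum z (@damp R D) D by apply: lt_le_trans (damp_sum_ge1 z D1).
have p0 := @phi_gt0 R r.
rewrite /shifted_weights !normrM norm_mob mulr1 normfV normrM (gtr0_norm G0) (gtr0_norm p0) invfM.
rewrite ler_wpM2r ?mulr_ge0 ?invr_ge0 ?(ltW G0) ?(ltW p0) //.
by have /andP[h0 h1] := @damp_step R D p r D1 (prime_gt0 pp) r0; rewrite ger0_norm.
Qed.

Lemma nonrough_mass_prime z u p X : (3 < z)%N -> (1 < u)%N -> prime p -> (p < z)%N ->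
  \sum_(0 <= n < X | (p %| n)%N) sieve (smooth z) (selberg z (damp (z ^ u)) (z ^ u)) (z ^ u) n ^+ 2 <=
  (X%:R / p%:R + 1) * ((L p / L (z ^ u)) ^+ 2 * (32 * expR 5 / L z)) + (z ^ u)%:R ^+ 6 :> R.
Proof.
move=> z3 u1 pp pz; set D := (z ^ u)%N.
have D1 : (1 < D)%N by rewrite -(expn0 z) ltn_exp2l //; lia.
have LD := log_gt0 D1; have p0 := prime_gt0 pp.
have mass := @damp_mass R z u z3 u1; rewrite -/D in mass.
have G1 := damp_sum_ge1 z D1.
set G := selberg_sum z (damp D) D in mass G1 *.
have G0 : 0 < G by lra.
under eq_bigl do rewrite -[(_ %| _)%N]andbT.
rewrite big_nat_multiples //.
apply: le_trans (_ : \sum_(0 <= k < (X %/ p).+1) sieve (fun r => smooth z r && ~~ (p %| r)%N)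
   (shifted_weights z D p) D k ^+ 2 <= _).
  rewrite (eq_bigr (fun k => sieve (fun r => smooth z r && ~~ (p %| r)%N)
   (shifted_weights z D p) D k ^+ 2)); last first.
    by move=> k _; rewrite sieve_multiple // gt_eqF.
  have [XX|XX] := leqP X (X %/ p).+1.
    rewrite [leRHS](@big_cat_nat _ _ _ X) //= -[leLHS]addr0 lerD //; last first.
      by apply: sumr_ge0 => k _; apply: sqr_ge0.
    by rewrite big_mkcond; apply: ler_sum => k _; case: ifP => // _; apply: sqr_ge0.
  rewrite (@big_cat_nat _ _ _ (X %/ p).+1) //=; last exact: ltnW.
  rewrite [X in _ + X]big1_seq ?addr0; last first.
    move=> k; rewrite mem_index_iota andbT => /andP[h /andP[kX _]].
    by move: kX; rewrite ltnNge leq_divRL // mulnC ltnW.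
  by rewrite big_mkcond; apply: ler_sum => k _; case: ifP => // _; apply: sqr_ge0.
set l := L p / L D; have l0 : 0 <= l by rewrite divr_ge0 ?log_nat_ge0 // ltW.
have l1 : l <= 1.
  rewrite ler_pdivrMr // mul1r log_nat_le // (leq_trans (ltnW pz)) //.
  by rewrite /D -{1}(expn1 z) leq_pexp2l //; lia.
have wle r : sqfree r -> `|shifted_weights z D p r| <= l * (G^-1 / phi r).
  by move=> sr; apply: shifted_weights_le => //; rewrite sqfree_gt0.
have G11 : G^-1 <= 1 by rewrite invf_le1.
apply: le_trans (sieve_sq_sum _ _ _) _.
  move=> r sr _; apply: le_trans (wle r sr) _; rewrite -[leRHS]mulr1 ler_pM //.
    by rewrite divr_ge0 ?phi_ge0 ?invr_ge0 // ltW.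
  by rewrite ler_pdivrMr ?phi_gt0 // mul1r (le_trans G11) // phi_ge1.
rewrite lerD2r; apply: ler_pM => //.
- by apply: sumr_ge0 => r _; rewrite mulr_ge0 ?sqr_ge0 ?phi_ge0.
- by rewrite -natr1 lerD2r natr_div_le.
apply: le_trans (_ : l ^+ 2 * (G^-1 ^+ 2 * \sum_(0 <= r < D.+1 | sqfree r && smooth z r) (phi r)^-1) <= _);
  last by rewrite ler_wpM2l // sqr_ge0.
rewrite mulrA mulr_sumr big_mkcond [leRHS]big_mkcond; apply: ler_sum => r _.
case: ifP => [/andP[sr /andP[zr _]]|_]; last first.
  by case: ifP => // _; rewrite -exprMn mulr_ge0 ?sqr_ge0 ?invr_ge0 ?phi_ge0.
rewrite sr zr /=; have r0 := @phi_gt0 R r; have := wle r sr.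
have -> : shifted_weights z D p r ^+ 2 = `|shifted_weights z D p r| ^+ 2 by rewrite real_normK // num_real.
move=> h; apply: le_trans (_ : (l * (G^-1 / phi r)) ^+ 2 * phi r <= _).
  rewrite ler_wpM2r ?phi_ge0 // ler_sqr // nnegrE // mulr_ge0 // divr_ge0 ?invr_ge0 //.
    exact: ltW.
  exact: ltW.
by rewrite le_eqVlt; apply/orP; left; apply/eqP; field; rewrite !gt_eqF.
Qed.

(** A non-rough [n] is a multiple of some prime [p < z], where the sieve saves
    [(log p / log D) ^ 2]. Summed against [1 / p] this is at most
    [4 (log z / log D) ^ 2 = 4 / u ^ 2]. *)
Lemma nonrough_mass z u X : (3 < z)%N -> (1 < u)%N ->
  \sum_(0 <= n < X | ~~ rough z n) sieve (smooth z) (selberg z (damp (z ^ u)) (z ^ u)) (z ^ u) n ^+ 2 <=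
  X%:R * (32 * expR 5 / L z) * (4 / u%:R ^+ 2) + z%:R * (32 * expR 5 + (z ^ u)%:R ^+ 6) :> R.
Proof.
move=> z3 u1; set D := (z ^ u)%N; set b := sieve _ _ _.
have D1 : (1 < D)%N by rewrite -(expn0 z) ltn_exp2l //; lia.
have LD := log_gt0 D1; have Lz := log_ge1 z3; have Lz0 : 0 < L z by lra.
have e0 : 0 < expR 5 :> R by apply: expR_gt0.
apply: le_trans (_ : \sum_(0 <= p < z | prime p) \sum_(0 <= n < X | (p %| n)%N) b n ^+ 2 <= _).
  under [leRHS]eq_bigr do rewrite big_mkcond.
  rewrite exchange_big /= big_mkcond; apply: ler_sum => n _; case: ifP => [nr|_]; last first.
    by apply: sumr_ge0 => p _; case: ifP => // _; apply: sqr_ge0.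
  have [p [pp pz pn]] : exists p, [/\ prime p, (p < z)%N & (p %| n)%N].
    case: n nr => [|n]; first by exists 2%N; split=> //; lia.
    rewrite /rough /= => /allPn[p]; rewrite mem_primes -ltnNge => /and3P[pp _ pn] pz.
    by exists p.
  apply: le_trans (@sumr_ge_term _ _ _ _ (fun p => if (p %| n)%N then b n ^+ 2 else 0) p _ _ _) => //.
  - by rewrite pn.
  - by rewrite mem_index_iota.
  - by move=> j _; case: ifP => // _; apply: sqr_ge0.
set m := 32 * expR 5 / L z; have m0 : 0 <= m by rewrite divr_ge0 ?mulr_ge0 // ltW.
have mm : m <= 32 * expR 5 by rewrite ler_pdivrMr // ler_peMr // mulr_ge0 // ltW.
apply: le_trans (_ : \sum_(0 <= p < z | prime p)
   (X%:R * m / L D ^+ 2 * L z * (L p / p%:R) + (32 * expR 5 + D%:R ^+ 6)) <= _).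
  rewrite big_nat_cond [leRHS]big_nat_cond; apply: ler_sum => p /andP[/andP[_ pz] pp].
  apply: le_trans (nonrough_mass_prime _ z3 u1 pp pz) _.
  rewrite -/D -/m addrA lerD2r mulrDl mul1r lerD //.
    have Lpz : L p <= L z by rewrite log_nat_le ?prime_gt0 // ltnW.
    have -> : X%:R / p%:R * ((L p / L D) ^+ 2 * m) = X%:R * m / L D ^+ 2 * (L p * (L p / p%:R)).
      by rewrite expr_div_n; ring.
    rewrite -[leRHS]mulrA; apply: ler_wpM2l; first by rewrite divr_ge0 ?sqr_ge0 // mulr_ge0.
    by apply: ler_wpM2r => //; rewrite divr_ge0 ?log_nat_ge0.
  apply: le_trans mm; rewrite ler_piMl // expr_le1 // ?divr_ge0 ?log_nat_ge0 //.
  rewrite ler_pdivrMr // mul1r log_nat_le ?prime_gt0 // (leq_trans (ltnW pz)) //.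
  by rewrite /D -{1}(expn1 z) leq_pexp2l //; lia.
rewrite big_split /= lerD //; last first.
  rewrite big_mkcond; apply: le_trans (_ : \sum_(0 <= p < z) (32 * expR 5 + D%:R ^+ 6) <= _).
    by apply: ler_sum => p _; case: ifP => // _; rewrite addr_ge0 ?exprn_ge0 // mulr_ge0 // ltW.
  by rewrite sumr_const_nat subn0 -[leLHS]mulr_natl.
rewrite -mulr_sumr.
have h2 : \sum_(0 <= p < z | prime p) L p / p%:R <= 4 * L z.
  apply: le_trans (_ : L z + 3 <= _); last by lra.
  case: z z3 {Lz Lz0 m m0 mm b D D1 LD} => // z z3.
  apply: le_trans (mertens_le _) _; first by lia.
  by rewrite lerD2r log_nat_le //; lia.
have u0 : 0 < u%:R :> R by rewrite ltr0n; lia.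
apply: le_trans (ler_wpM2l _ h2) _.
  by rewrite mulr_ge0 ?(ltW Lz0) // divr_ge0 ?sqr_ge0 // mulr_ge0.
rewrite /D log_natX; last by lia.
by rewrite le_eqVlt; apply/orP; left; apply/eqP; field; rewrite !gt_eqF.
Qed.

(** The squared sieve is [1] on rough numbers, so their indicator is the squared sieve minus its
    part on the other numbers, which has small mass. *)
Lemma rough_fourier z u s (e x y : R) X : (3 < z)%N -> (1 < u)%N -> (0 < s)%N -> 0 < e <= 1 ->
  2 * (z ^ u)%:R ^+ 2 * e < 1 ->
  (exists q, (0 < q <= ((s ^ 2)`!) ^ 2)%N /\ nearint e (q%:R * x)) \/
  `|\sum_(0 <= n < X | rough z n) cs (n%:R * x + y)| <=
    X%:R * (32 * expR 5 / L z) * (3 / s%:R + 4 / u%:R ^+ 2) +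
    ((s%:R + 3) * (z ^ u)%:R ^+ 6 / e + z%:R * (32 * expR 5 + (z ^ u)%:R ^+ 6)).
Proof.
move=> z3 u1 s0 e01; set D := (z ^ u)%N => De.
have D1 : (1 < D)%N by rewrite -(expn0 z) ltn_exp2l //; lia.
have G1 := damp_sum_ge1 z D1; have mass := @damp_mass R z u z3 u1.
have ha r : sqfree r -> smooth z r -> `|selberg z (@damp R D) D r| <= (selberg_sum z (damp D) D)^-1 / phi r.
  by move=> _ _; apply: damp_weights_le.
have g01 : 0 <= (selberg_sum z (@damp R D) D)^-1 <= 1.
  by rewrite invr_ge0 invf_le1 ?(lt_le_trans ltr01 G1) // G1 (le_trans ler01 G1).
have [h|h] := @sieve_fourier R z _ D s _ e x y X s0 g01 e01 De ha; [by left|right].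
set b := sieve _ _ _ in h.
have -> : \sum_(0 <= n < X | rough z n) cs (n%:R * x + y) =
  \sum_(0 <= n < X) b n ^+ 2 * cs (n%:R * x + y) -
  \sum_(0 <= n < X | ~~ rough z n) b n ^+ 2 * cs (n%:R * x + y).
  rewrite [X in _ = X - _](bigID (rough z)) /= addrK; apply: eq_bigr => n /roughP[_ rn].
  by rewrite /b sieve_rough ?expr1n ?mul1r // gt_eqF // (lt_le_trans ltr01 G1).
apply: le_trans (ler_normB _ _) _; apply: le_trans (lerD h _) _.
  apply: le_trans (ler_norm_sum _ _ _) _; apply: le_trans (_ : \sum_(0 <= n < X | ~~ rough z n) b n ^+ 2 <= _).
    by apply: ler_sum => n _; rewrite normrM ger0_norm ?sqr_ge0 // ler_piMr ?sqr_ge0 // cs_le1.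
  exact: nonrough_mass.
rewrite -/D in mass *.
have k : 3 * (selberg_sum z (@damp R D) D)^-1 ^+ 2 *
  (\sum_(0 <= r < D.+1 | sqfree r && smooth z r) (phi r)^-1) * X%:R / s%:R <=
  X%:R * (32 * expR 5 / L z) * (3 / s%:R).
  have -> : X%:R * (32 * expR 5 / L z) * (3 / s%:R) = 3 * (32 * expR 5 / L z) * X%:R / s%:R by ring.
  by rewrite ler_wpM2r ?invr_ge0 // ler_wpM2r // -mulrA ler_wpM2l.
rewrite [X in _ <= X + _]mulrDr [leRHS]addrACA lerD // lerD2r.
exact: k.
Qed.

End RoughNumbers.

(** * Exponential sums over primes *)

Section Majorant.
Context {R : realType}.
Local Notation L := (@log_nat R).
Implicit Types (e x w : R).

(** It equals [1] on numbers without prime factors up to [y] and has mean at most about [2 / log y];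
    so it majorises the primes above [y] with the loss of a constant only, as long as
    [log N / log y] is bounded. *)
Definition nu y n : R := sieve (smooth y.+1) (selberg y.+1 (fun=> 1) y) y n ^+ 2.

Lemma nu_ge0 y n : 0 <= nu y n.
Proof. exact: sqr_ge0. Qed.

Lemma flat_sum_ge1 y : (0 < y)%N -> 1 <= selberg_sum y.+1 (fun=> 1 : R) y.
Proof. by move=> y0; apply: selberg_sum_ge1. Qed.

Lemma nu_one y n : (0 < y)%N -> (forall p, prime p -> (p <= y)%N -> ~~ (p %| n)%N) -> nu y n = 1.
Proof.
move=> y0 h; rewrite /nu sieve_rough ?expr1n //.
by rewrite gt_eqF // (lt_le_trans ltr01) // flat_sum_ge1.
Qed.

Lemma flat_mass y : (1 < y)%N ->
  (selberg_sum y.+1 (fun=> 1) y)^-1 ^+ 2 *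
    (\sum_(0 <= r < y.+1 | sqfree r && smooth y.+1 r) (phi r)^-1) <= 2 / L y.
Proof.
move=> y1; have G1 := flat_sum_ge1 (ltnW y1); have Ly := @log_gt0 R _ y1.
have -> : \sum_(0 <= r < y.+1 | sqfree r && smooth y.+1 r) (phi r)^-1 = selberg_sum y.+1 (fun=> 1 : R) y.
  by apply: eq_bigr => r _; rewrite div1r.
have h := @selberg_sum_flat R y; set G := selberg_sum _ _ _ in G1 h *.
have G0 : 0 < G by lra.
rewrite exprVn expr2 invfM -mulrA mulVf ?gt_eqF // mulr1.
have : L y <= L y.+1 by rewrite log_nat_le // ltnW.
rewrite ler_pdivlMr // mulrC ler_pdivrMr //; lra.
Qed.

Lemma nu_mean y X : (1 < y)%N -> \sum_(0 <= n < X) nu y n <= X%:R * (2 / L y) + y%:R ^+ 6.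
Proof.
move=> y1; have G1 := flat_sum_ge1 (ltnW y1).
apply: le_trans (@sieve_mean R _ _ _ (selberg_sum y.+1 (fun=> 1) y)^-1 _ _ _) _.
- by rewrite invr_ge0 invf_le1 ?(lt_le_trans ltr01 G1) // G1 (le_trans ler01 G1).
- by move=> r _ _; apply: selberg_le; rewrite ?normr1 // ltnW.
- by rewrite lerD2r mulrC ler_wpM2l // flat_mass.
Qed.

Lemma nu_fourier y s e x w X : (1 < y)%N -> (0 < s)%N -> 0 < e <= 1 -> 2 * y%:R ^+ 2 * e < 1 ->
  (exists q, (0 < q <= ((s ^ 2)`!) ^ 2)%N /\ nearint e (q%:R * x)) \/
  `|\sum_(0 <= n < X) nu y n * cs (n%:R * x + w)| <=
    3 * (2 / L y) * X%:R / s%:R + (s%:R + 3) * y%:R ^+ 6 / e.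
Proof.
move=> y1 s0 e01 De; have G1 := flat_sum_ge1 (ltnW y1).
have g01 : 0 <= (selberg_sum y.+1 (fun=> 1 : R) y)^-1 <= 1.
  by rewrite invr_ge0 invf_le1 ?(lt_le_trans ltr01 G1) // G1 (le_trans ler01 G1).
have ha r : sqfree r -> smooth y.+1 r ->
    `|selberg y.+1 (fun=> 1 : R) y r| <= (selberg_sum y.+1 (fun=> 1 : R) y)^-1 / phi r.
  by move=> _ _; apply: selberg_le; rewrite ?normr1 // ltnW.
have [h|h] := @sieve_fourier R y.+1 _ y s _ e x w X s0 g01 e01 De ha; first by left.
right; apply: le_trans h _; rewrite lerD2r ler_wpM2r ?invr_ge0 // ler_wpM2r //.
by rewrite -mulrA ler_wpM2l // flat_mass.
Qed.

Lemma sq_expand (T : Type) (r : seq T) (P : pred T) (a t : T -> R) :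
  (\sum_(i <- r | P i) a i * cs (t i)) ^+ 2 + (\sum_(i <- r | P i) a i * sn (t i)) ^+ 2 =
  \sum_(i <- r | P i) \sum_(j <- r | P j) a i * a j * cs (t i - t j).
Proof.
rewrite !expr2 !mulr_suml -big_split /=; apply: eq_bigr => i _.
rewrite !mulr_sumr -big_split /=; apply: eq_bigr => j _.
by rewrite csB; ring.
Qed.

(* The right-hand side is a multiple of the Fejer kernel. *)
Lemma near_indicator_le J e w : (0 < J)%N -> 0 <= e -> J%:R * e <= 8^-1 ->
  ((`[< nearint e w >] : nat)%:R : R) <=
  4 / J%:R ^+ 2 * \sum_(0 <= j < J) \sum_(0 <= j' < J) cs ((j%:R - j'%:R) * w).
Proof.
move=> J0 e0 Je; have J0' : 0 < J%:R :> R by rewrite ltr0n.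
have -> : \sum_(0 <= j < J) \sum_(0 <= j' < J) cs ((j%:R - j'%:R) * w) =
  (\sum_(0 <= j < J) 1 * cs (j%:R * w)) ^+ 2 + (\sum_(0 <= j < J) 1 * sn (j%:R * w)) ^+ 2.
  rewrite sq_expand; apply: eq_bigr => j _; apply: eq_bigr => j' _.
  by rewrite !mul1r mulrBl.
case: asboolP => [h|_] /=; last first.
  by rewrite mulr_ge0 ?addr_ge0 ?sqr_ge0 // divr_ge0 ?sqr_ge0.
rewrite mulrAC ler_pdivlMr ?exprn_gt0 // mul1r.
have : J%:R / 2 <= \sum_(0 <= j < J) 1 * cs (j%:R * w).
  apply: le_trans (_ : \sum_(0 <= j < J) 2^-1 <= _).
    by rewrite sumr_const_nat subn0 -[leRHS]mulr_natl.
  rewrite big_nat [leRHS]big_nat; apply: ler_sum => j /andP[_ jJ]; rewrite mul1r.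
  apply: cspi_ge_half; apply: nearint_le (nearint_muln j h).
  by apply: le_trans Je; rewrite ler_wpM2r // ler_nat ltnW.
set A := \sum_(_ <= _ < _) _; set B := \sum_(_ <= _ < _) _ => hA.
have B0 : 0 <= B ^+ 2 by apply: sqr_ge0.
by nra.
Qed.

Lemma separated_count (P : pred nat) T J : (0 < T)%N ->
  (forall i j, (i < j)%N -> P i -> P j -> (T <= j - i)%N) ->
  (count P (iota 0 J) <= (J %/ T).+1)%N.
Proof.
move=> T0 h; rewrite -size_filter -(size_map (fun j => j %/ T)%N) -(size_iota 0 (J %/ T).+1).
apply: uniq_leq_size.
  rewrite map_inj_in_uniq ?filter_uniq ?iota_uniq // => i j.
  rewrite !mem_filter => /andP[Pi _] /andP[Pj _] e.
  have lt_sep a b : (a < b)%N -> P a -> P b -> (a %/ T != b %/ T)%N.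
    move=> ab Pa Pb; have ts := h a b ab Pa Pb.
    rewrite neq_ltn; apply/orP; left; rewrite leq_divRL // mulSn.
    have := leq_divM a T; lia.
  have [ij|ji|//] := ltngtP i j; first by have := lt_sep _ _ ij Pi Pj; rewrite e eqxx.
  by have := lt_sep _ _ ji Pj Pi; rewrite e eqxx.
move=> k /mapP[j]; rewrite mem_filter !mem_iota !add0n => /andP[_ jJ] ->.
by rewrite /= ltnS leq_div2r // ltnW.
Qed.

Lemma near_shifts_count e x k T J (j' : nat) : (0 < T)%N -> (0 < k)%N ->
  (forall i, (0 < i < T)%N -> ~ nearint (2 * e) ((k * i)%:R * x)) ->
  \sum_(0 <= j < J) ((`[< nearint e (k%:R * ((j%:R - j'%:R) * x)) >] : nat)%:R : R) <= J%:R / T%:R + 1.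
Proof.
move=> T0 k0 far.
pose P (j : nat) := `[< nearint e (k%:R * ((j%:R - j'%:R) * x)) >].
have -> : \sum_(0 <= j < J) ((P j : nat)%:R : R) = (count P (iota 0 J))%:R.
  by rewrite -sum1_count natr_sum /index_iota subn0 [RHS]big_mkcond; apply: eq_bigr => j _; case: (P j).
apply: le_trans (_ : (J %/ T).+1%:R <= _); last by rewrite -natr1 lerD2r natr_div_le.
rewrite ler_nat; apply: separated_count => // i j ij /asboolP Pi /asboolP Pj.
rewrite leqNgt; apply/negP => h; apply: (far (j - i)%N); first by rewrite subn_gt0 ij h.
have -> : (k * (j - i))%:R * x = k%:R * ((j%:R - j'%:R) * x) - k%:R * ((i%:R - j'%:R) * x).
  by rewrite natrM natrB ?(ltnW ij) //; ring.
have -> : 2 * e = e + e by ring.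
by apply: nearintD => //; apply: nearintN.
Qed.

End Majorant.

(** * Bilinear sums and pairs of primes *)

Section Bilinear.
Context {R : realType}.
Local Notation L := (@log_nat R).
Implicit Types (e x w t : R).

(** Nearness of [q0 (n - p') x] to an integer is detected by Fejer's kernel, with frequencies
    [j - j']. The sum of [nu] at such a frequency is small unless [(j - j') q0 x] is near a rational
    of small denominator, which the last hypothesis allows for few [j] only. *)
Lemma near_mass y s T J e x q0 (p' H : nat) : (1 < y)%N -> (0 < s)%N -> (0 < T)%N -> (0 < J)%N ->
  (0 < q0)%N -> 0 < e <= 1 -> 2 * y%:R ^+ 2 * e < 1 -> J%:R * e <= 8^-1 ->
  (forall i q, (0 < i < T)%N -> (0 < q <= ((s ^ 2)`!) ^ 2)%N -> ~ nearint (2 * e) ((q * q0 * i)%:R * x)) ->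
  \sum_(0 <= n < H) nu y n * (`[< nearint e (q0%:R * ((n%:R - p'%:R) * x)) >] : nat)%:R <=
  4 * (3 * (2 / L y) * H%:R / s%:R + (s%:R + 3) * y%:R ^+ 6 / e +
       (H%:R * (2 / L y) + y%:R ^+ 6) * (((s ^ 2)`!) ^ 2)%:R * (T%:R^-1 + J%:R^-1)).
Proof.
move=> y1 s0 T0 J0 q00 e01 De Je far.
have J0' : 0 < J%:R :> R by rewrite ltr0n.
have e0 : 0 <= e by case/andP: e01 => /ltW.
set Q := (((s ^ 2)`!) ^ 2)%N in far *.
set c := 3 * _ * _ / _ + _ / e; set B := H%:R * _ + _.
have B0 : 0 <= B by rewrite addr_ge0 ?exprn_ge0 // mulr_ge0 // divr_ge0 ?log_nat_ge0.
have d0 : 0 <= 2 / L y by rewrite divr_ge0 ?log_nat_ge0.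
have s3 : 0 <= s%:R + 3 :> R by rewrite addr_ge0.
have c0 : 0 <= c.
  apply: addr_ge0; apply: divr_ge0 => //; first exact: (mulr_ge0 (mulr_ge0 _ d0)).
  by apply: mulr_ge0 => //; apply: exprn_ge0.
pose X (j j' : nat) := (j%:R - j'%:R) * (q0%:R * x) : R.
pose bad (j j' : nat) : R := \sum_(1 <= q < Q.+1) (`[< nearint e ((q * q0)%:R * ((j%:R - j'%:R) * x)) >] : nat)%:R.
have bad0 j j' : 0 <= bad j j' by apply: sumr_ge0.
have inner j j' : \sum_(0 <= n < H) nu y n * cs ((j%:R - j'%:R) * (q0%:R * ((n%:R - p'%:R) * x))) <=
    c + B * bad j j'.
  have -> : \sum_(0 <= n < H) nu y n * cs ((j%:R - j'%:R) * (q0%:R * ((n%:R - p'%:R) * x))) =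
     \sum_(0 <= n < H) nu y n * cs (n%:R * X j j' + - (p'%:R * X j j')).
    by apply: eq_bigr => n _; congr (_ * cs _); rewrite /X; ring.
  have [[q [/andP[q1 qQ] hq]]|h] := @nu_fourier R y s e (X j j') (- (p'%:R * X j j')) H y1 s0 e01 De.
    have b1 : 1 <= bad j j'.
      rewrite /bad; apply: le_trans (@sumr_ge_term _ _ _ _ _ q _ _ _) => //.
        rewrite (_ : `[< _ >] = true) //; apply/asboolP.
        by rewrite natrM; move: hq; rewrite /X; congr nearint; ring.
      by rewrite mem_index_iota q1 ltnS.
    apply: le_trans (_ : \sum_(0 <= n < H) nu y n <= _).
      apply: ler_sum => n _; rewrite ler_piMr ?nu_ge0 //.
      by apply: le_trans (cs_le1 _); apply: ler_norm.
    apply: le_trans (nu_mean _ y1) _; rewrite -[leLHS]add0r lerD // -/B.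
    by rewrite ler_peMr.
  by apply: le_trans (ler_norm _) _; apply: le_trans h _; rewrite lerDl mulr_ge0.
apply: le_trans (_ : \sum_(0 <= n < H) nu y n * (4 / J%:R ^+ 2 * \sum_(0 <= j < J) \sum_(0 <= j' < J)
    cs ((j%:R - j'%:R) * (q0%:R * ((n%:R - p'%:R) * x)))) <= _).
  by apply: ler_sum => n _; rewrite ler_wpM2l ?nu_ge0 // near_indicator_le.
have -> : \sum_(0 <= n < H) nu y n * (4 / J%:R ^+ 2 * \sum_(0 <= j < J) \sum_(0 <= j' < J)
    cs ((j%:R - j'%:R) * (q0%:R * ((n%:R - p'%:R) * x)))) =
  4 / J%:R ^+ 2 * \sum_(0 <= j' < J) \sum_(0 <= j < J)
    \sum_(0 <= n < H) nu y n * cs ((j%:R - j'%:R) * (q0%:R * ((n%:R - p'%:R) * x))).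
  under eq_bigr do rewrite mulrCA.
  rewrite -mulr_sumr; congr (_ * _); under eq_bigr do rewrite exchange_big /= mulr_sumr.
  rewrite exchange_big /=; apply: eq_bigr => j' _; under eq_bigr do rewrite mulr_sumr.
  by rewrite exchange_big.
have key j' : \sum_(0 <= j < J) bad j j' <= Q%:R * (J%:R / T%:R + 1).
  rewrite /bad exchange_big /=; apply: le_trans (_ : \sum_(1 <= q < Q.+1) (J%:R / T%:R + 1) <= _).
    rewrite big_nat [leRHS]big_nat; apply: ler_sum => q /andP[q1 qQ].
    apply: near_shifts_count => //; first by rewrite muln_gt0 q1.
    by move=> i hi; apply: far => //; rewrite q1 -ltnS.
  by rewrite sumr_const_nat subSS subn0 -[leLHS]mulr_natl.
have Q0 : 0 <= Q%:R :> R by [].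
apply: le_trans (_ : 4 / J%:R ^+ 2 * \sum_(0 <= j' < J) (J%:R * c + B * (Q%:R * (J%:R / T%:R + 1))) <= _).
  rewrite ler_wpM2l ?divr_ge0 ?sqr_ge0 //; apply: ler_sum => j' _.
  apply: le_trans (_ : \sum_(0 <= j < J) (c + B * bad j j') <= _).
    by apply: ler_sum => j _; apply: inner.
  by rewrite big_split /= sumr_const_nat subn0 -[c *+ J]mulr_natl lerD2l -mulr_sumr ler_wpM2l.
have T0' : 0 < T%:R :> R by rewrite ltr0n.
rewrite sumr_const_nat subn0 -[_ *+ J]mulr_natl le_eqVlt; apply/orP; left; apply/eqP.
by field; rewrite !gt_eqF.
Qed.

Lemma chebyshev_from z n : \sum_(0 <= p < n.+1 | prime p && (z <= p)%N) L p <= 3 * n%:R.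
Proof.
apply: le_trans (chebyshev _); rewrite big_mkcond [leRHS]big_mkcond.
apply: ler_sum => p _; case: (prime p) => //=; case: ifP => // _; exact: log_nat_ge0.
Qed.

Lemma prefix_interval (F : nat -> R) (b : R) M Y : 0 <= b ->
  (forall X, (X <= 2 * M)%N -> `|\sum_(0 <= m < X) F m| <= b) ->
  `|\sum_(M <= m < 2 * M | (m < Y)%N) F m| <= 2 * b.
Proof.
move=> b0 h.
have -> : \sum_(M <= m < 2 * M | (m < Y)%N) F m = \sum_(M <= m < minn (2 * M) Y) F m.
  rewrite [RHS](big_nat_widen _ _ (2 * M)) ?geq_minl //.
  rewrite [LHS]big_nat_cond [RHS]big_nat_cond; apply: eq_bigl => m.
  by rewrite leq_min /=; case: (m < 2 * M)%N; rewrite ?andbF.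
have [MY|YM] := leqP M (minn (2 * M) Y); last by rewrite big_geq ?normr0 ?mulr_ge0 // ltnW.
have -> : \sum_(M <= m < minn (2 * M) Y) F m = \sum_(0 <= m < minn (2 * M) Y) F m - \sum_(0 <= m < M) F m.
  by rewrite [X in _ = X - _](@big_cat_nat _ _ _ M) //= [X in X - _]addrC addrK.
apply: le_trans (ler_normB _ _) _; rewrite mulr2n mulrDl mul1r lerD // h //.
  exact: geq_minl.
by rewrite leq_pmull.
Qed.

Definition prime_block z N M x t m : R :=
  \sum_(0 <= p < (N %/ M).+1 | prime p && (z <= p)%N) (if (p * m <= N)%N then L p else 0) *
     cs ((p * m)%:R * x + t).

Definition near_pairs z N M e x Q : R :=
  \sum_(0 <= p < (N %/ M).+1 | prime p && (z <= p)%N)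
  \sum_(0 <= p' < (N %/ M).+1 | prime p' && (z <= p')%N) L p * L p' *
     \sum_(1 <= q < Q.+1) (`[< nearint e (q%:R * ((p%:R - p'%:R) * x)) >] : nat)%:R.

(** Adding the sine sum completes the square of an absolute value, which is expanded over pairs of
    primes. The sum over [m] is then a Fourier coefficient of [nu], small unless [(p - p') x] is
    near a rational of small denominator; those pairs are bounded trivially and collected in
    [near_pairs]. *)
Lemma block_square y z s N M e x t : (1 < y)%N -> (0 < s)%N -> (0 < z)%N -> 0 < e <= 1 ->
  2 * y%:R ^+ 2 * e < 1 ->
  \sum_(M <= m < 2 * M) nu y m * (prime_block z N M x t m ^+ 2) <=
  2 * (3 * (2 / L y) * (2 * M)%:R / s%:R + (s%:R + 3) * y%:R ^+ 6 / e) * (3 * (N %/ M)%:R) ^+ 2 +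
  ((2 * M)%:R * (2 / L y) + y%:R ^+ 6) * near_pairs z N M e x (((s ^ 2)`!) ^ 2).
Proof.
move=> y1 s0 z0 e01 De; have e0 : 0 < e by case/andP: e01.
set Q := (((s ^ 2)`!) ^ 2)%N; set b := _ / s%:R + _ / e; set B := (2 * M)%:R * _ + _.
have B0 : 0 <= B by rewrite addr_ge0 ?exprn_ge0 // mulr_ge0 // divr_ge0 ?log_nat_ge0.
have d0 : 0 <= 2 / L y by rewrite divr_ge0 ?log_nat_ge0.
have s3 : 0 <= s%:R + 3 :> R by rewrite addr_ge0.
have b0 : 0 <= b.
  apply: addr_ge0; apply: divr_ge0 => //; first exact: (mulr_ge0 (mulr_ge0 _ d0)).
    by apply: mulr_ge0 => //; apply: exprn_ge0.
  exact: ltW.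
pose a m p : R := if (p * m <= N)%N then L p else 0.
pose y_ m : R := \sum_(0 <= p < (N %/ M).+1 | prime p && (z <= p)%N) a m p * sn ((p * m)%:R * x + t).
apply: le_trans (_ : \sum_(M <= m < 2 * M) nu y m * (prime_block z N M x t m ^+ 2 + y_ m ^+ 2) <= _).
  by apply: ler_sum => m _; rewrite ler_wpM2l ?nu_ge0 // lerDl sqr_ge0.
have -> : \sum_(M <= m < 2 * M) nu y m * (prime_block z N M x t m ^+ 2 + y_ m ^+ 2) =
  \sum_(0 <= p < (N %/ M).+1 | prime p && (z <= p)%N)
  \sum_(0 <= p' < (N %/ M).+1 | prime p' && (z <= p')%N) L p * L p' *
    \sum_(M <= m < 2 * M | (m < (minn (N %/ p) (N %/ p')).+1)%N) nu y m * cs (m%:R * ((p%:R - p'%:R) * x) + 0).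
  under eq_bigr do rewrite /prime_block /y_ sq_expand mulr_sumr.
  rewrite exchange_big /=; apply: eq_bigr => p /andP[pp _].
  under eq_bigr do rewrite mulr_sumr.
  rewrite exchange_big /=; apply: eq_bigr => p' /andP[pp' _].
  rewrite mulr_sumr [RHS]big_mkcond; apply: eq_bigr => m _.
  rewrite ltnS leq_min !leq_divRL ?prime_gt0 // ![(m * _)%N]mulnC /a.
  have -> : (p * m)%:R * x + t - ((p' * m)%:R * x + t) = m%:R * ((p%:R - p'%:R) * x) + 0 by rewrite !natrM; ring.
  by case: ifP => h1 /=; case: ifP => h2 /=; ring.
have inner p p' Y : `|\sum_(M <= m < 2 * M | (m < Y)%N) nu y m * cs (m%:R * ((p%:R - p'%:R) * x) + 0)| <=
   2 * b + B * \sum_(1 <= q < Q.+1) (`[< nearint e (q%:R * ((p%:R - p'%:R) * x)) >] : nat)%:R.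
  set S := \sum_(1 <= q < _) _; have S0 : 0 <= S by apply: sumr_ge0.
  have [[q [/andP[q1 qQ] hq]]|far] := pselect (exists q, (0 < q <= Q)%N /\ nearint e (q%:R * ((p%:R - p'%:R) * x))).
    have b1 : 1 <= S.
      rewrite /S; apply: le_trans (@sumr_ge_term _ _ _ _ _ q _ _ _) => //.
        by rewrite (_ : `[< _ >] = true) //; apply/asboolP.
      by rewrite mem_index_iota q1 ltnS.
    apply: le_trans (ler_norm_sum _ _ _) _.
    apply: le_trans (_ : \sum_(0 <= m < 2 * M) nu y m <= _).
      rewrite [leRHS](@big_cat_nat _ _ _ M) ?leq_pmull //= -[leLHS]add0r lerD ?sumr_ge0 //.
        by move=> *; apply: nu_ge0.
      rewrite big_mkcond; apply: ler_sum => m _; case: ifP => _; last exact: nu_ge0.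
      by rewrite normrM ger0_norm ?nu_ge0 // ler_piMr ?nu_ge0 // cs_le1.
    apply: le_trans (nu_mean _ y1) _; rewrite -/B -[leLHS]add0r lerD ?mulr_ge0 //.
    by rewrite ler_peMr.
  rewrite -[leLHS]addr0 lerD ?mulr_ge0 //; apply: prefix_interval => // X XM.
  have [//|h] := @nu_fourier R y s e ((p%:R - p'%:R) * x) 0 X y1 s0 e01 De.
  apply: le_trans h _; rewrite /b lerD2r ler_wpM2r ?invr_ge0 // ler_wpM2l ?ler_nat //.
  by rewrite mulr_ge0 // divr_ge0 ?log_nat_ge0.
apply: le_trans (_ : \sum_(0 <= p < (N %/ M).+1 | prime p && (z <= p)%N)
  \sum_(0 <= p' < (N %/ M).+1 | prime p' && (z <= p')%N) (2 * b * (L p * L p') +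
    B * (L p * L p' * \sum_(1 <= q < Q.+1) (`[< nearint e (q%:R * ((p%:R - p'%:R) * x)) >] : nat)%:R)) <= _).
  apply: ler_sum => p _; apply: ler_sum => p' _.
  apply: le_trans (ler_wpM2l _ (le_trans (ler_norm _) (inner p p' _))) _; first by rewrite mulr_ge0 ?log_nat_ge0.
  by rewrite le_eqVlt; apply/orP; left; apply/eqP; ring.
under eq_bigr do rewrite big_split /= -!mulr_sumr.
rewrite big_split /= -!mulr_sumr lerD2r ler_wpM2l ?mulr_ge0 //.
set S := \sum_(0 <= p < _ | _) L p.
have S0 : 0 <= S by apply: sumr_ge0 => p _; apply: log_nat_ge0.
have h : S <= 3 * (N %/ M)%:R by apply: chebyshev_from.
have -> : \sum_(0 <= p < (N %/ M).+1 | prime p && (z <= p)%N) L p * S = S ^+ 2.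
  by rewrite -mulr_suml expr2.
by rewrite !expr2; apply: ler_pM.
Qed.

End Bilinear.

(** * Dyadic blocks *)

Section Blocks.
Context {R : realType}.
Local Notation L := (@log_nat R).
Implicit Types (e x w t eta K : R).

Definition square_bound s : nat := (((s ^ 2)`!) ^ 2)%N.

Lemma square_bound_gt0 s : (0 < square_bound s)%N.
Proof. by rewrite expn_gt0 fact_gt0. Qed.

(** These are the denominators that the argument produces: [q0] from the sum over [m], [q] from the
    count of near pairs, [i] from the frequencies of Fejer's kernel. *)
Definition far_multiples s s1 T e x :=
  forall i q q0, (0 < i < T)%N -> (0 < q <= square_bound s1)%N -> (0 < q0 <= square_bound s)%N ->
    ~ nearint (2 * e) ((q * q0 * i)%:R * x).

(** One prime of the pair is relaxed to an integer of weight [log N] times [nu], which is [1] at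
    primes [>= z > y]; [near_mass] then counts the integers near the other prime. *)
Lemma near_pairs_le y z s s1 T J N M e x : (1 < y < z)%N -> (0 < s1)%N -> (0 < T)%N -> (0 < J)%N ->
  (0 < M)%N -> 0 < e <= 1 -> 2 * y%:R ^+ 2 * e < 1 -> J%:R * e <= 8^-1 -> far_multiples s s1 T e x ->
  near_pairs z N M e x (square_bound s) <=
  (square_bound s)%:R * (3 * (N %/ M)%:R * (L N *
   (4 * (3 * (2 / L y) * (N %/ M).+1%:R / s1%:R + (s1%:R + 3) * y%:R ^+ 6 / e +
       ((N %/ M).+1%:R * (2 / L y) + y%:R ^+ 6) * (square_bound s1)%:R * (T%:R^-1 + J%:R^-1))))).
Proof.
move=> /andP[y1 yz] s0 T0 J0 M0 e01 De Je far; set H := (N %/ M).+1; set mass := 4 * _.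
set Q := square_bound s in far *.
have m0 q0 (p' : nat) : (0 < q0 <= Q)%N ->
    \sum_(0 <= n < H) nu y n * (`[< nearint e (q0%:R * ((n%:R - p'%:R) * x)) >] : nat)%:R <= mass.
  move=> /andP[q00 q0Q]; apply: near_mass => // i q hi hq; apply: far => //; by rewrite q00.
have LN0 : 0 <= L N by apply: log_nat_ge0.
have mass0 : 0 <= mass.
  apply: le_trans (m0 1%N 0%N _); last by rewrite square_bound_gt0.
  by apply: sumr_ge0 => n _; rewrite mulr_ge0 ?nu_ge0.
have inner q0 p' : (0 < q0 <= Q)%N ->
    \sum_(0 <= p < H | prime p && (z <= p)%N) L p * (`[< nearint e (q0%:R * ((p%:R - p'%:R) * x)) >] : nat)%:R <= L N * mass.
  move=> hq0; apply: le_trans (ler_wpM2l LN0 (m0 q0 p' hq0)).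
  rewrite mulr_sumr big_nat_cond [leRHS]big_nat big_mkcond [leRHS]big_mkcond.
  apply: ler_sum => p _; rewrite /=; case: ltnP => //= pH.
  case: andP => [[pp zp]|_]; last by rewrite mulr_ge0 // mulr_ge0 ?nu_ge0.
  rewrite nu_one ?(ltnW y1) // ?mul1r.
    rewrite ler_wpM2r // log_nat_le ?prime_gt0 //.
    by apply: leq_trans (_ : N %/ M <= N)%N; rewrite ?leq_div // -ltnS.
  move=> q pq qy; rewrite dvdn_prime2 // neq_ltn; apply/orP; left.
  by apply: leq_ltn_trans qy _; apply: leq_trans yz zp.
rewrite /near_pairs exchange_big /=.
have -> : \sum_(0 <= p' < H | prime p' && (z <= p')%N) \sum_(0 <= p < H | prime p && (z <= p)%N)
    L p * L p' * \sum_(1 <= q < Q.+1) (`[< nearint e (q%:R * ((p%:R - p'%:R) * x)) >] : nat)%:R =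
  \sum_(1 <= q < Q.+1) \sum_(0 <= p' < H | prime p' && (z <= p')%N) L p' *
    \sum_(0 <= p < H | prime p && (z <= p)%N) L p * (`[< nearint e (q%:R * ((p%:R - p'%:R) * x)) >] : nat)%:R :> R.
  rewrite [RHS]exchange_big /=; apply: eq_bigr => p' _.
  rewrite -mulr_sumr exchange_big /= mulr_sumr; apply: eq_bigr => p _.
  by rewrite mulr_sumr mulr_sumr; apply: eq_bigr => q _; ring.
apply: le_trans (_ : \sum_(1 <= q < Q.+1) (3 * (N %/ M)%:R * (L N * mass)) <= _); last first.
  by rewrite sumr_const_nat subSS subn0 -[leLHS]mulr_natl.
rewrite big_nat [leRHS]big_nat; apply: ler_sum => q /andP[q1 qQ].
apply: le_trans (_ : \sum_(0 <= p' < H | prime p' && (z <= p')%N) L p' * (L N * mass) <= _).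
  by apply: ler_sum => p' _; rewrite ler_wpM2l ?log_nat_ge0 // inner // q1 -ltnS.
by rewrite -mulr_suml; apply: ler_wpM2r; rewrite ?chebyshev_from // mulr_ge0.
Qed.

Lemma dyadic_sum (F : nat -> R) (b : R) J : (forall j, (0 < j)%N -> `|\sum_(2 ^ j <= m < 2 * 2 ^ j) F m| <= b) ->
  0 <= b -> `|\sum_(2 <= m < 2 ^ J) F m| <= J%:R * b.
Proof.
move=> h b0; elim: J => [|[|J] IH]; [by rewrite big_geq // normr0 mul0r|by rewrite big_geq // normr0 mul1r|].
rewrite (@big_cat_nat _ _ _ (2 ^ J.+1)) /=; last 2 first.
- by rewrite -[leqLHS](expn1 2) leq_exp2l.
- by rewrite leq_exp2l.
apply: le_trans (ler_normD _ _) _; rewrite -[leRHS]/(J.+2%:R * b) -natr1 mulrDl mul1r lerD //.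
by rewrite [(2 ^ J.+2)%N]expnS h.
Qed.

(** Here [d] is the density [2 / log y] and [H] the range of the primes. The hypothesis
    [LN * d <= K] is where no logarithm is lost: the density of the majorant pays for the weight
    [log N] of a prime. *)
Lemma block_numeric (d M H s s1 T J Q Q1 K LN A A1 Y eta : R) :
  0 <= d -> 0 <= M -> 1 <= H -> 0 < s -> 0 < s1 -> 0 < T -> 0 < J -> 0 <= Q -> 0 <= Q1 -> 0 <= LN ->
  LN * d <= K -> 0 <= Y -> Y <= d * M -> Y <= d * H -> 0 <= A1 -> A <= d * M / s -> A1 <= d * H / s1 ->
  126 / s + 36 * Q * K * (7 / s1 + 3 * Q1 * (T^-1 + J^-1)) <= eta ^+ 2 ->
  2 * (3 * d * (2 * M) / s + A) * (3 * H) ^+ 2 +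
  (2 * M * d + Y) * (Q * (3 * H * (LN * (4 * (3 * d * (H + 1) / s1 + A1 + ((H + 1) * d + Y) * Q1 * (T^-1 + J^-1)))))) <=
  d * M * H ^+ 2 * eta ^+ 2.
Proof.
move=> d0 M0 H1 s0 s10 T0 J0 Q0 Q10 LN0 LK Y0 YM YH A10 hA hA1 he.
have H0 : 0 <= H by lra.
have dM : 0 <= d * M by rewrite mulr_ge0.
have dH : 0 <= d * H by rewrite mulr_ge0.
have TJ : 0 <= T^-1 + J^-1 by rewrite addr_ge0 // invr_ge0 ltW.
have s1i : 0 <= s1^-1 by rewrite invr_ge0 ltW.
apply: le_trans (ler_wpM2l (mulr_ge0 dM (sqr_ge0 H)) he).
have -> : d * M * H ^+ 2 * (126 / s + 36 * Q * K * (7 / s1 + 3 * Q1 * (T^-1 + J^-1))) =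
  2 * (7 * (d * M / s)) * (3 * H) ^+ 2 + (3 * (d * M)) * (Q * (3 * H * (K * (4 * (7 * (H / s1) + 3 * H * Q1 * (T^-1 + J^-1)))))).
  ring.
apply: lerD.
  rewrite ler_wpM2r ?sqr_ge0 // ler_wpM2l //.
  have -> : 3 * d * (2 * M) / s = 6 * (d * M / s) by ring.
  by lra.
have inn : 3 * d * (H + 1) / s1 + A1 + ((H + 1) * d + Y) * Q1 * (T^-1 + J^-1) <=
    d * (7 * (H / s1) + 3 * H * Q1 * (T^-1 + J^-1)).
  have e1 : 3 * d * (H + 1) / s1 <= 6 * (d * H / s1).
    rewrite [leRHS]mulrA ler_wpM2r //; nra.
  have e2 : ((H + 1) * d + Y) * Q1 * (T^-1 + J^-1) <= (3 * (d * H)) * Q1 * (T^-1 + J^-1).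
    rewrite ler_wpM2r // ler_wpM2r //; nra.
  have -> : d * (7 * (H / s1) + 3 * H * Q1 * (T^-1 + J^-1)) = 7 * (d * H / s1) + 3 * (d * H) * Q1 * (T^-1 + J^-1) by ring.
  lra.
set I := 7 * (H / s1) + _ in inn *; set I' := 3 * d * _ / _ + _ + _ in inn *.
have I0 : 0 <= I.
  by rewrite addr_ge0 ?mulr_ge0.
have I'0 : 0 <= I'.
  rewrite !addr_ge0 // ?mulr_ge0 // ?mulr_ge0 // ?addr_ge0 // ?mulr_ge0 // ?addr_ge0 //.
apply: ler_pM.
- by rewrite addr_ge0 // mulr_ge0 // mulr_ge0.
- by rewrite mulr_ge0 // mulr_ge0 ?mulr_ge0 // ?mulr_ge0.
- by have -> : 2 * M * d = 2 * (d * M) by [ring]; lra.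
rewrite ler_wpM2l // ler_wpM2l ?mulr_ge0 //.
rewrite [leLHS]mulrCA [leRHS]mulrCA ler_wpM2l //.
apply: le_trans (ler_wpM2l LN0 inn) _.
by rewrite mulrA ler_wpM2r.
Qed.

End Blocks.

Section BlockBound.
Context {R : realType}.
Local Notation L := (@log_nat R).
Implicit Types (e x w t eta K : R).

Lemma rough_ge z m : rough z m -> (1 < m)%N -> (z <= m)%N.
Proof.
move=> /roughP[m0 h] m1; rewrite leqNgt; apply/negP => mz.
have := h _ (pdiv_prime m1) (leq_ltn_trans (pdiv_leq m0) mz).
by rewrite pdiv_dvd.
Qed.

Lemma rough_nu y z m : (0 < y < z)%N -> rough z m -> nu y m = 1 :> R.
Proof.
move=> /andP[y0 yz] /roughP[_ h]; apply: nu_one => // p pp py.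
by apply: h => //; apply: leq_ltn_trans yz.
Qed.

Lemma amgm_norm (b w : R) : 0 < w -> `|b| <= b ^+ 2 * (2 * w)^-1 + w / 2.
Proof.
move=> w0; have b2 : `|b| ^+ 2 = b ^+ 2 by rewrite real_normK ?num_real.
rewrite -b2; set c := `|b|.
have : 0 <= (c - w) ^+ 2 * (2 * w)^-1 by rewrite mulr_ge0 ?sqr_ge0 // invr_ge0 mulr_ge0 // ltW.
have -> : (c - w) ^+ 2 * (2 * w)^-1 = c ^+ 2 * (2 * w)^-1 - c + w / 2 by field; rewrite gt_eqF.
lra.
Qed.

Lemma fejer_width y : (0 < y)%N -> let e : R := (8 * y%:R ^+ 3)^-1 in
  [/\ 0 < e <= 1, 2 * y%:R ^+ 2 * e < 1, (y ^ 3)%:R * e <= 8^-1 & y%:R ^+ 6 / e = 8 * y%:R ^+ 9].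
Proof.
move=> y0 e; have y1 : 1 <= y%:R :> R by rewrite ler1n.
have y0' : 0 < y%:R :> R by lra.
have p0 : 0 < 8 * y%:R ^+ 3 :> R by rewrite mulr_gt0 // exprn_gt0.
have p1 : 1 <= y%:R ^+ 3 :> R by rewrite exprn_ege1.
split.
- by rewrite invr_gt0 p0 invf_le1 //; lra.
- rewrite -[_ * _ * _]/(2 * y%:R ^+ 2 / (8 * y%:R ^+ 3)) ltr_pdivrMr // mul1r.
  rewrite exprS; have : 0 < y%:R ^+ 2 :> R by rewrite exprn_gt0.
  by move: y1; move: (y%:R) (y%:R ^+ 2) => a b a1 b0; nra.
- by rewrite natrX /e invfM mulrCA divff ?mulr1 // gt_eqF // exprn_gt0.
- by rewrite /e invrK -[9%N]/(6 + 3)%N exprD; ring.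
Qed.

Lemma block_le y z s s1 T N M x t eta K : (1 < y < z)%N -> (0 < s)%N -> (0 < s1)%N -> (0 < T)%N ->
  (1 < M)%N -> far_multiples s s1 T (8 * y%:R ^+ 3)^-1 x -> L N * (2 / L y) <= K -> 0 < eta ->
  y%:R ^+ 6 <= 2 / L y * (z%:R / 2) ->
  (s%:R + 3) * (8 * y%:R ^+ 9) <= 2 / L y * (z%:R / 2) / s%:R ->
  (s1%:R + 3) * (8 * y%:R ^+ 9) <= 2 / L y * (z%:R / 2) / s1%:R ->
  126 / s%:R + 36 * (square_bound s)%:R * K *
    (7 / s1%:R + 3 * (square_bound s1)%:R * (T%:R^-1 + (y ^ 3)%:R^-1)) <= eta ^+ 2 ->
  `|\sum_(M <= m < 2 * M | rough z m) prime_block z N M x t m| <= 2 * eta * (2 / L y) * N%:R.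
Proof.
move=> /andP[y1 yz] s0 s10 T0 M1 far LK eta0 cY cs0 cs1 hk; have y0 := ltnW y1.
have M0 := ltnW M1.
have [e01 De Je eY] := fejer_width y0; set e : R := (8 * _)^-1 in far e01 De Je eY.
have d0 : 0 <= 2 / L y by rewrite divr_ge0 ?log_nat_ge0.
have rhs0 : 0 <= 2 * eta * (2 / L y) * N%:R by rewrite mulr_ge0 // mulr_ge0 // mulr_ge0 // ltW.
(* A block with [2 M <= z] contains no rough [m], and for [N / M < z] there is no prime in range.
   Otherwise [M] and [N / M] are at least [z / 2], which absorbs the error terms. *)
have [zM|Mz] := leqP (2 * M) z.
  rewrite big_nat_cond big1 ?normr0 // => m /andP[/andP[Mm mM] rm].
  by have := rough_ge rm (leq_trans M1 Mm); rewrite leqNgt (leq_trans mM zM).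
have [Hz|zH] := ltnP (N %/ M) z.
  rewrite big1 ?normr0 // => m _; rewrite /prime_block big_nat_cond big1 // => p.
  by move=> /and3P[/andP[_ pH] _ zp]; move: pH; rewrite ltnS leqNgt (leq_trans Hz zp).
set d := 2 / L y in d0 rhs0 cY cs0 cs1 LK *; set H := (N %/ M)%N in zH *.
have H1 : 1 <= H%:R :> R by rewrite ler1n; apply: leq_trans zH; apply: leq_trans (ltnW yz).
have zM : z%:R / 2 <= M%:R :> R.
  by rewrite ler_pdivrMr // -natrM ler_nat mulnC ltnW.
have zH' : z%:R / 2 <= H%:R :> R.
  by rewrite ler_pdivrMr // -natrM ler_nat; apply: leq_trans zH _; rewrite leq_pmulr.
have sq := @block_square R y z s N M e x t y1 s0 (ltnW (ltn_trans y1 yz)) e01 De.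
have y30 : (0 < y ^ 3)%N by rewrite expn_gt0 y0.
have yz' : (1 < y < z)%N by rewrite y1.
have np := @near_pairs_le R y z s s1 T (y ^ 3) N M e x yz' s10 T0 y30 M0 e01 De Je far.
rewrite -/d -/H in np; have dz c : z%:R / 2 <= c -> d * (z%:R / 2) <= d * c by move=> h; rewrite ler_wpM2l.
have sqb : \sum_(M <= m < 2 * M) nu y m * prime_block z N M x t m ^+ 2 <= d * M%:R * H%:R ^+ 2 * eta ^+ 2.
  apply: le_trans sq _; rewrite -/d -/H natrM.
  have B0 : 0 <= 2 * M%:R * d + y%:R ^+ 6 by rewrite addr_ge0 ?exprn_ge0 // mulr_ge0 // mulr_ge0.
  apply: le_trans (lerD (lexx _) (ler_wpM2l B0 np)) _; rewrite -[H.+1%:R]natr1.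
  rewrite -!(mulrA _ (y%:R ^+ 6)) eY.
  apply: (@block_numeric R d M%:R H%:R s%:R s1%:R T%:R (y ^ 3)%:R (square_bound s)%:R (square_bound s1)%:R
    K (L N) ((s%:R + 3) * (8 * y%:R ^+ 9)) ((s1%:R + 3) * (8 * y%:R ^+ 9)) (y%:R ^+ 6) eta) => //.
  - by rewrite ltr0n.
  - by rewrite ltr0n.
  - by rewrite ltr0n.
  - by rewrite ltr0n expn_gt0 y0.
  - exact: log_nat_ge0.
  - exact: exprn_ge0.
  - exact: le_trans cY (dz _ zM).
  - exact: le_trans cY (dz _ zH').
  - by apply: mulr_ge0; rewrite ?addr_ge0 // mulr_ge0 // exprn_ge0.
  - by apply: le_trans cs0 _; rewrite ler_wpM2r ?dz // invr_ge0.
  - by apply: le_trans cs1 _; rewrite ler_wpM2r ?dz // invr_ge0.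
(* AM-GM against the target size [eta H] of a single block takes the place of Cauchy-Schwarz. *)
have w0 : 0 < eta * H%:R by rewrite mulr_gt0 //; lra.
apply: le_trans (ler_norm_sum _ _ _) _.
apply: le_trans (_ : \sum_(M <= m < 2 * M) (nu y m * prime_block z N M x t m ^+ 2 * (2 * (eta * H%:R))^-1 +
   nu y m * (eta * H%:R / 2)) <= _).
  rewrite big_mkcond; apply: ler_sum => m _; case: ifP => rm.
    by rewrite (@rough_nu y z) ?y0 // !mul1r amgm_norm.
  have w0' := ltW w0.
  rewrite addr_ge0 // mulr_ge0 ?nu_ge0 ?divr_ge0 //; first by rewrite mulr_ge0 ?nu_ge0 ?sqr_ge0.
  by rewrite invr_ge0 mulr_ge0.
rewrite big_split /= -!mulr_suml.
have numass : \sum_(M <= m < 2 * M) nu y m <= 3 * (d * M%:R).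
  apply: le_trans (_ : \sum_(0 <= m < 2 * M) nu y m <= _).
    rewrite [leRHS](@big_cat_nat _ _ _ M) ?leq_pmull //= -[leLHS]add0r lerD // sumr_ge0 // => *.
    exact: nu_ge0.
  apply: le_trans (nu_mean _ y1) _; rewrite -/d natrM; have := le_trans cY (dz _ zM).
  by rewrite [2 * _ * d]mulrC mulrCA; lra.
have W1 : 0 <= (2 * (eta * H%:R))^-1 by rewrite invr_ge0; apply: mulr_ge0 => //; apply: ltW.
have W2 : 0 <= eta * H%:R / 2 by apply: divr_ge0 => //; apply: ltW.
apply: le_trans (lerD (ler_wpM2r W1 sqb) (ler_wpM2r W2 numass)) _.
have -> : d * M%:R * H%:R ^+ 2 * eta ^+ 2 * (2 * (eta * H%:R))^-1 + 3 * (d * M%:R) * (eta * H%:R / 2) =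
    2 * eta * d * (M%:R * H%:R).
  field; rewrite !gt_eqF //; lra.
rewrite ler_wpM2l //; last by rewrite -natrM ler_nat mulnC leq_divM.
by rewrite mulr_ge0 // mulr_ge0 // ltW.
Qed.

End BlockBound.

(** * From rough numbers to primes *)

Section PrimeSum.
Context {R : realType}.
Local Notation L := (@log_nat R).
Implicit Types (e x w t eta K : R).

Lemma rough_primeM z p m : (0 < z)%N -> prime p -> (z <= p)%N -> rough z (p * m) = rough z m.
Proof.
move=> z0 pp zp; have p0 := prime_gt0 pp.
apply/roughP/roughP => -[]; rewrite muln_gt0 p0 /= => m0 h; split=> // q pq qz.
  by apply: contra (h q pq qz) => qm; rewrite dvdn_mull.
rewrite Euclid_dvdM // negb_or h // andbT dvdn_prime2 // neq_ltn.
by rewrite (leq_trans qz zp).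
Qed.

Lemma rough_decomposition z N (F : nat -> R) : (0 < z)%N ->
  \sum_(0 <= n < N.+1 | rough z n) (\sum_(0 <= p < N.+1 | [&& prime p, (z <= p)%N & (p %| n)%N]) L p) * F n =
  \sum_(0 <= m < N.+1 | rough z m) \sum_(0 <= p < N.+1 | prime p && (z <= p)%N)
     (if (p * m <= N)%N then L p else 0) * F (p * m)%N.
Proof.
move=> z0; under eq_bigr do rewrite mulr_suml.
rewrite (exchange_big_dep (fun p => prime p && (z <= p)%N)) /=; last by move=> n p _ /and3P[-> ->].
rewrite [RHS]exchange_big /=; apply: eq_bigr => p /andP[pp zp].
rewrite (eq_bigl (fun n => (p %| n)%N && rough z n)); last by move=> n; rewrite pp zp andbC.
rewrite big_nat_multiples ?prime_gt0 // big_mkcond [RHS]big_mkcond; apply: eq_bigr => m _.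
rewrite rough_primeM // ltnS; case: (rough z m); rewrite ?andbF // andbT.
by case: ifP => // _; rewrite mul0r.
Qed.

(** The sum counts each prime divisor once, so it falls short of [log n] only if the square of a
    prime divides [n]. For rough [n] that prime is at least [z], which makes such [n] rare. *)
Lemma log_rough_excess z N n : (0 < n <= N)%N -> rough z n ->
  0 <= L n - \sum_(0 <= p < N.+1 | [&& prime p, (z <= p)%N & (p %| n)%N]) L p <=
  L N * \sum_(z <= k < N.+1) ((k ^ 2 %| n)%N : nat)%:R.
Proof.
move=> /andP[n0 nN] rn.
have pz p : prime p -> (p %| n)%N -> (z <= p)%N.
  by move=> pp pn; rewrite leqNgt; apply/negP => /(proj2 (roughP _ _ rn) _ pp); rewrite pn.
have ln : L n = \sum_(0 <= p < N.+1 | prime p) (logn p n)%:R * L p.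
  by apply: log_factor => // p pp pn; rewrite ltnS (leq_trans (dvdn_leq n0 pn)).
have e : \sum_(0 <= p < N.+1 | [&& prime p, (z <= p)%N & (p %| n)%N]) L p =
    \sum_(0 <= p < N.+1 | prime p) ((p %| n)%N : nat)%:R * L p.
  rewrite big_mkcond [RHS]big_mkcond; apply: eq_bigr => p _; case: ifP => [/and3P[-> _ ->]|]; first by rewrite mul1r.
  case pp: (prime p) => //=; case pn: (p %| n)%N; rewrite ?mul0r // andbT => /negP[].
  exact: pz.
have val p : prime p -> ((p %| n)%N <= logn p n)%N.
  by move=> pp; case pn: (p %| n)%N => //; rewrite logn_gt0 mem_primes pp n0.
rewrite e {1}ln subr_ge0; apply/andP; split.
  by apply: ler_sum => p pp; rewrite ler_wpM2r ?log_nat_ge0 // ler_nat val.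
have S0 : 0 <= \sum_(z <= k < N.+1) ((k ^ 2 %| n)%N : nat)%:R :> R by apply: sumr_ge0.
have [/hasP[p]|/hasPn h] := boolP (has (fun p => (p ^ 2 %| n)%N) (primes n)).
  rewrite mem_primes => /and3P[pp _ pn] p2n.
  apply: le_trans (_ : L N * 1 <= _); last first.
    rewrite ler_wpM2l ?log_nat_ge0 //; apply: le_trans (@sumr_ge_term _ _ _ _ _ p _ _ _) => //.
      by rewrite p2n.
    by rewrite mem_index_iota pz // ltnS (leq_trans (dvdn_leq n0 pn)).
  rewrite mulr1; apply: le_trans (_ : L n <= _); last exact: log_nat_le.
  by rewrite gerBl; apply: sumr_ge0 => q _; rewrite mulr_ge0 ?log_nat_ge0.
apply: le_trans (mulr_ge0 (log_nat_ge0 _) S0); rewrite ln subr_le0.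
apply: ler_sum => p pp; rewrite ler_wpM2r ?log_nat_ge0 // ler_nat.
case pn: (p %| n)%N; last by rewrite lognE pn !andbF.
have := h p; rewrite mem_primes pp n0 pn => /(_ isT); rewrite pfactor_dvdn // -ltnNge ltnS.
by [].
Qed.

Lemma square_multiples_le z N : (1 < z)%N ->
  \sum_(1 <= n < N.+1) \sum_(z <= k < N.+1) ((k ^ 2 %| n)%N : nat)%:R <= N%:R / (z%:R - 1) :> R.
Proof.
move=> z1; rewrite exchange_big /=.
have tel M : (z <= M)%N -> \sum_(z <= k < M) (k%:R ^+ 2)^-1 <= (z%:R - 1)^-1 - (M%:R - 1)^-1 :> R.
  elim: M => [|M IH]; first by rewrite leqn0 => /eqP zz; rewrite zz in z1.
  rewrite leq_eqVlt => /orP[/eqP <-|zM]; first by rewrite big_geq // subrr.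
  rewrite big_nat_recr //=; apply: le_trans (lerD (IH zM) (lexx _)) _.
  have M1 : 2 <= M%:R :> R by rewrite ler_nat (leq_trans z1).
  rewrite -addrA lerD2l -natr1 addrK; move: M1; move: (M%:R) => c c2.
  rewrite -subr_ge0 (_ : _ - _ = (c ^+ 2 * (c - 1))^-1).
    by rewrite invr_ge0 mulr_ge0 ?sqr_ge0 //; lra.
  by field; rewrite !gt_eqF //; lra.
have [zN|Nz] := leqP z N.+1; last first.
  rewrite big_geq; last exact: ltnW.
  by rewrite divr_ge0 // subr_ge0 ler1n ltnW.
apply: le_trans (_ : \sum_(z <= k < N.+1) N%:R * (k%:R ^+ 2)^-1 <= _).
  rewrite big_nat [leRHS]big_nat; apply: ler_sum => k _.
  by rewrite -natr_sum -natrX -divn_count_dvd natr_div_le.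
rewrite -mulr_sumr ler_wpM2l //; apply: le_trans (tel _ zN) _.
by rewrite gerBl invr_ge0 subr_ge0 ler1n.
Qed.

(** Partial summation: against a density of order [1 / log y], replacing [log N] by [log n] costs
    [O (N / log y)] and not [O (N)]. *)
Lemma log_defect_mass y N : (1 < y)%N -> (0 < N)%N ->
  \sum_(1 <= n < N.+1) nu y n * (L N - L n) <= 2 * (2 / L y) * N%:R + y%:R ^+ 6 * (1 + L N).
Proof.
move=> y1; have d0 : 0 <= 2 / L y by rewrite divr_ge0 ?log_nat_ge0.
have Y0 : 0 <= y%:R ^+ 6 :> R by apply: exprn_ge0.
case: N => // N _; have mean n := @nu_mean R y n y1.
set d := 2 / L y in d0 mean *; move: (y%:R ^+ 6) Y0 mean => Y Y0 mean.
suff : \sum_(1 <= n < N.+2) nu y n * (L N.+1 - L n) <= 2 * d * N.+1%:R + Y * \sum_(1 <= k < N.+1) k%:R^-1.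
  move=> /le_trans -> //; rewrite lerD2l ler_wpM2l //; apply: le_trans (harmonic_le _) _.
  case: N => [|N]; rewrite lerD2l; [by rewrite /log_nat ln0 // log_nat_ge0|exact: log_nat_le].
elim: N => [|N IH].
  by rewrite big_nat1 subrr mulr0 big_geq // mulr0 addr0 mulr_ge0 // mulr_ge0.
rewrite big_nat_recr //= subrr mulr0 addr0.
have -> : \sum_(1 <= n < N.+2) nu y n * (L N.+2 - L n) =
   \sum_(1 <= n < N.+2) nu y n * (L N.+1 - L n) + (L N.+2 - L N.+1) * \sum_(1 <= n < N.+2) nu y n.
  by rewrite mulr_sumr -big_split /=; apply: eq_bigr => n _; ring.
have st := @log_step_le R N.+1 isT.
have h2 : \sum_(1 <= n < N.+2) nu y n <= N.+2%:R * d + Y.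
  apply: le_trans (mean _); rewrite [leRHS]big_ltn // lerDr; exact: nu_ge0.
have sn0 : 0 <= \sum_(1 <= n < N.+2) nu y n :> R by apply: sumr_ge0 => *; apply: nu_ge0.
apply: le_trans (lerD IH (ler_wpM2r sn0 st)) _.
have i0 : 0 <= N.+1%:R^-1 :> R by rewrite invr_ge0.
apply: le_trans (lerD (lexx _) (ler_wpM2l i0 h2)) _.
rewrite [X in _ <= _ + Y * X]big_nat_recr //= -[N.+2%:R]natr1.
have i1 : N.+1%:R^-1 * N.+1%:R = 1 :> R by rewrite mulVf ?pnatr_eq0.
have i2 : N.+1%:R^-1 <= 1 :> R by rewrite invf_le1 ?ler1n ?ltr0n.
move: (\sum_(_ <= _ < _) _) i0 i1 i2; move: (N.+1%:R : R) => n S i0 i1 i2.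
have -> : n^-1 * ((n + 1) * d + Y) = (n^-1 * n) * d + n^-1 * d + n^-1 * Y by ring.
by rewrite i1; move: (n^-1) i0 i2 => c c0 c1; nra.
Qed.

Lemma prime_block_full z N M x t m : (0 < M <= m)%N ->
  prime_block z N M x t m =
  \sum_(0 <= p < N.+1 | prime p && (z <= p)%N) (if (p * m <= N)%N then L p else 0) * cs ((p * m)%:R * x + t).
Proof.
move=> /andP[M0 Mm]; rewrite /prime_block (big_nat_widen _ _ N.+1) ?ltnS ?leq_div //.
rewrite big_mkcond [RHS]big_mkcond; apply: eq_bigr => p _; rewrite ltnS leq_divRL //.
case: (prime p && _) => //=; case hm: (p * m <= N)%N; last by rewrite !mul0r; case: ifP.
by rewrite (leq_trans _ hm) // leq_mul2l Mm orbT.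
Qed.

Lemma rough_blocks_le z N x t b : (0 < z)%N -> (3 < N)%N -> 0 <= b ->
  (forall M, (1 < M)%N -> `|\sum_(M <= m < 2 * M | rough z m) prime_block z N M x t m| <= b) ->
  `|\sum_(2 <= m < N.+1 | rough z m) prime_block z N 1 x t m| <= 3 * L N * b.
Proof.
move=> z0 N3 b0 h.
pose F m := if rough z m then prime_block z N 1 x t m else 0.
pose J := (trunc_log 2 N).+1; have N0 : (0 < N)%N by apply: leq_trans N3.
have NJ : (N.+1 <= 2 ^ J)%N by apply: trunc_log_ltn.
have -> : \sum_(2 <= m < N.+1 | rough z m) prime_block z N 1 x t m = \sum_(2 <= m < 2 ^ J) F m.
  rewrite (@big_cat_nat _ _ _ N.+1 2 (2 ^ J)) //=.
  rewrite [X in _ = _ + X]big_nat_cond [X in _ = _ + X]big1 ?addr0; last first.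
    move=> m /andP[/andP[Nm _] _]; rewrite /F; case: ifP => // _; rewrite /prime_block.
    rewrite big1 // => p /andP[pp _]; case: ifP; rewrite ?mul0r // leqNgt => /negP[].
    by apply: leq_trans Nm _; rewrite leq_pmull // prime_gt0.
  by rewrite big_mkcond.
have J3 : J%:R <= 3 * L N.
  have l2 : 2^-1 <= L 2 by have := @log_step_ge R 1 isT; rewrite {2}/log_nat ln1 subr0.
  have l4 : 1 <= L N by apply: log_ge1.
  have : L (2 ^ trunc_log 2 N) <= L N by apply: log_nat_le; rewrite ?expn_gt0 // trunc_logP.
  rewrite log_natX // /J -natr1; have : 0 <= (trunc_log 2 N)%:R :> R by [].
  by move: (_%:R) => j j0; nra.
apply: le_trans (ler_wpM2r b0 J3); apply: dyadic_sum => // j j0.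
have -> : \sum_(2 ^ j <= m < 2 * 2 ^ j) F m = \sum_(2 ^ j <= m < 2 * 2 ^ j | rough z m) prime_block z N (2 ^ j) x t m.
  rewrite big_nat [RHS]big_mkcond [RHS]big_nat; apply: eq_bigr => m /andP[jm _].
  rewrite /F; case: ifP => // _; rewrite !prime_block_full ?expn_gt0 //=.
  by apply: leq_trans jm; rewrite expn_gt0.
by apply: h; rewrite -[X in (X < _)%N](expn0 2) ltn_exp2l.
Qed.

(** The bound lists, in this order: the primes below [z]; [log N] times the Fourier coefficient of
    the rough numbers; the passage from [log N] to [log n]; the rough [n] divisible by a large
    square; the terms [n = p m] with [m > 1]. *)
Lemma prime_sum_le y z u s s1 s2 T N e x t eta K : (1 < y < z)%N -> (3 < z <= N)%N -> (1 < u)%N ->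
  (0 < s)%N -> (0 < s1)%N -> (0 < s2)%N -> (0 < T)%N ->
  far_multiples s s1 T (8 * y%:R ^+ 3)^-1 x ->
  (forall q, (0 < q <= square_bound s2)%N -> ~ nearint e (q%:R * x)) ->
  0 < e <= 1 -> 2 * (z ^ u)%:R ^+ 2 * e < 1 ->
  L N * (2 / L y) <= K -> 0 < eta ->
  y%:R ^+ 6 <= 2 / L y * (z%:R / 2) ->
  (s%:R + 3) * (8 * y%:R ^+ 9) <= 2 / L y * (z%:R / 2) / s%:R ->
  (s1%:R + 3) * (8 * y%:R ^+ 9) <= 2 / L y * (z%:R / 2) / s1%:R ->
  126 / s%:R + 36 * (square_bound s)%:R * K *
    (7 / s1%:R + 3 * (square_bound s1)%:R * (T%:R^-1 + (y ^ 3)%:R^-1)) <= eta ^+ 2 ->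
  `|\sum_(0 <= p < N.+1 | prime p) L p * cs (p%:R * x + t)| <=
    3 * z%:R + (L N * (N.+1%:R * (32 * expR 5 / L z) * (3 / s2%:R + 4 / u%:R ^+ 2) +
      ((s2%:R + 3) * (z ^ u)%:R ^+ 6 / e + z%:R * (32 * expR 5 + (z ^ u)%:R ^+ 6))) +
    (2 * (2 / L y) * N%:R + y%:R ^+ 6 * (1 + L N))) + L N * (N%:R / (z%:R - 1)) +
    3 * L N * (2 * eta * (2 / L y) * N%:R).
Proof.
move=> yz /andP[z3 zN] u1 s0 s10 s20 T0 far far2 e01 De LK eta0 cY cs0 cs1 hk.
have /andP[y1 yz'] := yz; have z0 : (0 < z)%N by apply: leq_trans z3.
pose g n := cs (n%:R * x + t) : R; have g1 n : `|g n| <= 1 by apply: cs_le1.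
have N0 : (0 < N)%N by apply: leq_trans zN.
have LN0 : 0 <= L N by apply: log_nat_ge0.
rewrite (bigID (fun p => (p < z)%N)) /=.
have h0 : `|\sum_(0 <= p < N.+1 | prime p && (p < z)%N) L p * g p| <= 3 * z%:R.
  apply: le_trans (ler_norm_sum _ _ _) _; apply: le_trans (chebyshev z).
  rewrite -(big_nat_widen 0 z N.+1 (fun p => prime p) (fun p => `|L p * g p|)); last exact: leqW.
  rewrite [leRHS](@big_cat_nat _ _ _ z) //= -[leLHS]addr0 lerD //.
    by apply: ler_sum => p _; rewrite normrM ger0_norm ?log_nat_ge0 // ler_piMr ?log_nat_ge0.
  by apply: sumr_ge0 => *; apply: log_nat_ge0.
rewrite [X in `|_ + X|](eq_bigl (fun p => prime p && (z <= p)%N)); last by move=> p; rewrite -leqNgt.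
set A := \sum_(0 <= p < N.+1 | prime p && (z <= p)%N) _.
pose T2 := \sum_(2 <= m < N.+1 | rough z m) prime_block z N 1 x t m.
pose RS := \sum_(0 <= n < N.+1 | rough z n)
  (\sum_(0 <= p < N.+1 | [&& prime p, (z <= p)%N & (p %| n)%N]) L p) * g n.
have r0 : rough z 0 = false by [].
have r1 : rough z 1 by [].
have eRS : RS = A + T2.
  rewrite /RS rough_decomposition // big_mkcond big_ltn // r0 /= add0r big_ltn ?r1 //; congr (_ + _).
    rewrite /A big_nat_cond [RHS]big_nat_cond; apply: eq_bigr => p /andP[/andP[_ pN] _].
    by rewrite muln1 -ltnS pN.
  rewrite /T2 [RHS]big_mkcond big_nat [RHS]big_nat; apply: eq_bigr => m /andP[m2 _].
  by case: ifP => // _; rewrite prime_block_full // (ltnW m2).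
have hT2 : `|T2| <= 3 * L N * (2 * eta * (2 / L y) * N%:R).
  apply: rough_blocks_le => //; first exact: leq_trans zN.
    by rewrite mulr_ge0 // mulr_ge0 ?divr_ge0 ?log_nat_ge0 // mulr_ge0 // ltW.
  by move=> M M1; apply: (@block_le R y z s s1 T N M x t eta K).
pose RL := \sum_(0 <= n < N.+1 | rough z n) L n * g n.
have hex : `|RL - RS| <= L N * (N%:R / (z%:R - 1)).
  apply: le_trans (ler_wpM2l LN0 (square_multiples_le N (ltnW (ltnW z3)))).
  rewrite /RL /RS -sumrB big_mkcond big_ltn // r0 /= add0r mulr_sumr.
  apply: le_trans (ler_norm_sum _ _ _) _; rewrite big_nat [leRHS]big_nat; apply: ler_sum => n /andP[n1 nN].
  case: ifP => rn; last by rewrite normr0 mulr_ge0 // sumr_ge0.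
  have nb : (0 < n <= N)%N by rewrite n1.
  have /andP[ex0 ex1] := @log_rough_excess z N n nb rn; rewrite -mulrBl normrM ger0_norm //.
  by apply: le_trans ex1; rewrite ler_piMr.
have hRL : `|RL| <= L N * (N.+1%:R * (32 * expR 5 / L z) * (3 / s2%:R + 4 / u%:R ^+ 2) +
      ((s2%:R + 3) * (z ^ u)%:R ^+ 6 / e + z%:R * (32 * expR 5 + (z ^ u)%:R ^+ 6))) +
    (2 * (2 / L y) * N%:R + y%:R ^+ 6 * (1 + L N)).
  have [[q [hq hn]]|h] := @rough_fourier R z u s2 e x t N.+1 z3 u1 s20 e01 De.
    by case: (far2 q hq).
  have -> : RL = L N * (\sum_(0 <= n < N.+1 | rough z n) g n) - \sum_(0 <= n < N.+1 | rough z n) (L N - L n) * g n.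
    by rewrite mulr_sumr -sumrB; apply: eq_bigr => n _; ring.
  apply: le_trans (ler_normB _ _) _; apply: lerD.
    by rewrite normrM ger0_norm // ler_wpM2l.
  apply: le_trans (log_defect_mass y1 N0); rewrite big_mkcond big_ltn // r0 /= add0r.
  apply: le_trans (ler_norm_sum _ _ _) _; rewrite [leLHS]big_nat [leRHS]big_nat; apply: ler_sum => n /andP[n1 nN].
  have D0 : 0 <= L N - L n by rewrite subr_ge0 log_nat_le.
  case: ifP => rn; last by rewrite normr0 mulr_ge0 ?nu_ge0.
  by rewrite (@rough_nu R y z) ?(ltnW y1) // mul1r normrM ger0_norm // ler_piMr.
have nA : `|A| <= `|RL| + `|RL - RS| + `|T2|.
  have -> : A = RL - (RL - RS) - T2 by rewrite eRS; ring.
  by apply: le_trans (ler_normB _ _) _; rewrite lerD2r ler_normB.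
apply: le_trans (ler_normD _ _) (le_trans (lerD h0 (le_trans nA (lerD (lerD hRL hex) hT2))) _).
by rewrite le_eqVlt; apply/orP; left; apply/eqP; ring.
Qed.

End PrimeSum.

(** * Choice of the parameters *)

Section ExpSum.
Context {R : realType}.
Local Notation L := (@log_nat R).
Implicit Types (e x w t eta K : R).

Lemma ex_nat_ge (c : R) : exists2 n, (0 < n)%N & c <= n%:R.
Proof.
exists (Num.bound c).+1 => //; apply: le_trans (_ : (Num.bound c)%:R <= _); last by rewrite ler_nat.
apply: le_trans (ler_norm c) _; rewrite -[Num.bound c]/(Num.bound c).
by apply: ltW; have := archi_boundP (normr_ge0 c); rewrite /Num.bound normr_id.
Qed.

Lemma ex_nat_ge_seq (cs : seq R) : exists2 n, (1 < n)%N & forall c, c \in cs -> c <= n%:R.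
Proof.
elim: cs => [|c cs [n n1 hn]]; first by exists 2%N.
have [m _ hm] := ex_nat_ge c; exists (n + m)%N; first exact: leq_trans (leq_addr _ _).
move=> d; rewrite inE => /orP[/eqP ->|/hn h]; [apply: le_trans hm _|apply: le_trans h _].
  by rewrite ler_nat leq_addl.
by rewrite ler_nat leq_addr.
Qed.

(** The integer [a]-th root of [N]. It keeps [log N / log y] below [2 a], while [N] dominates every
    power [y ^ j] with [j <= a]. *)
Lemma root_bracket a y0 N : (1 < y0)%N -> (0 < a)%N -> (y0 ^ a <= N)%N ->
  exists2 y, (y0 <= y)%N & (y ^ a <= N < y ^ (2 * a))%N.
Proof.
move=> y1 a0 h0.
have hb i : (i ^ a <= N)%N -> (i <= N)%N.
  move=> h; apply: leq_trans h; case: i => // i.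
  by rewrite -[leqLHS]expn1 leq_pexp2l.
have ex : exists i, (i ^ a <= N)%N by exists y0.
have [y hy ymax] := ex_maxnP ex hb.
exists y; first exact: ymax.
rewrite hy expnM ltnNge; apply/negP => h.
have y2 : (1 < y)%N by apply: leq_trans y1 (ymax _ h0).
have : (y ^ 2 <= y)%N := ymax _ h; rewrite expnS expn1 leqNgt => /negP[].
by rewrite ltn_Pmulr // ltnW.
Qed.

(* The primes are detected by [log n = sum over p | n of log p] on rough numbers [n];
   rough numbers themselves have small Fourier coefficients by [rough_fourier], and
   the terms [n = p m] with [m > 1] form bilinear sums. *)
Lemma prime_exponential_sum eps : 0 < eps -> exists2 Q, (0 < Q)%N &
  forall l, (0 < l)%N -> exists N0, forall N, (N0 <= N)%N -> forall x t,
    (forall q, (0 < q <= Q)%N -> ~ nearint l%:R^-1 (q%:R * x)) ->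
    `|\sum_(0 <= p < N.+1 | prime p) L p * cs (p%:R * x + t)| <= eps * N%:R.
Proof.
move=> eps0; have [B eB] : exists B : R, B = 32 * expR 5 by eexists.
have B0 : 0 < B by rewrite eB mulr_gt0 // expR_gt0.
have [u u1 hu'] := ex_nat_ge_seq [:: 1920 * B / eps].
have {hu'} hu : 1920 * B / eps <= u%:R by apply: hu'; rewrite inE eqxx.
have u0 : (0 < u)%N by apply: ltnW.
have uR : 0 < u%:R :> R by rewrite ltr0n.
have [s2 s20 hs2] := ex_nat_ge (1440 * u%:R * B / eps).
(* This exceeds every exponent of [y] in the error terms, of which [180 u + 1] is the largest. *)
have [a ea] : exists a, a = (200 * u + 40)%N by eexists.
have a0 : (0 < a)%N by rewrite ea addn_gt0 orbT.
have aR : 0 < a%:R :> R by rewrite ltr0n.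
have [K eK] : exists K : R, K = 4 * a%:R by eexists.
have K0 : 0 < K by rewrite eK mulr_gt0.
have [eta eeta] : exists eta : R, eta = eps / (60 * K) by eexists.
have eta0 : 0 < eta by rewrite eeta divr_gt0 // mulr_gt0.
have eta2 : 0 < eta ^+ 2 by rewrite exprn_gt0.
(* Since [504 = 4 * 126], and below [28 = 4 * 7] and [12 = 4 * 3], each of the four terms in [hk]
   gets a quarter of [eta ^ 2]. The order matters: [s1] depends on [s], and [T] on both. *)
have [s s0 hs] := ex_nat_ge (504 / eta ^+ 2).
have [Ks eKs] : exists Ks : R, Ks = 36 * (square_bound s)%:R * K by eexists.
have Ks0 : 0 < Ks by rewrite eKs mulr_gt0 // mulr_gt0 // ltr0n square_bound_gt0.
have [s1 s10 hs1] := ex_nat_ge (28 * Ks / eta ^+ 2).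
have [Q1 eQ1] : exists Q1 : R, Q1 = (square_bound s1)%:R by eexists.
have Q10 : 0 < Q1 by rewrite eQ1 ltr0n square_bound_gt0.
have [T T0 hT] := ex_nat_ge (12 * Ks * Q1 / eta ^+ 2).
exists (square_bound s * square_bound s1 * T + square_bound s2)%N.
  by rewrite addn_gt0 square_bound_gt0 orbT.
move=> l l0.
have [y0 y01 hy0] := ex_nat_ge_seq [:: 4; l%:R; 8 * (s%:R * (s%:R + 3)); 8 * (s1%:R * (s1%:R + 3));
  12 * Ks * Q1 / eta ^+ 2; 10 * 3 / eps; 10 * (2 * a%:R * (s2%:R + 3)) / eps;
  10 * (2 * a%:R * (B + 1)) / eps; expR (40 / eps); 10 * (2 * a%:R + 1) / eps].
exists (y0 ^ a)%N => N hN x t far.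
have [y y0y /andP[yN Ny]] := root_bracket y01 a0 hN.
have {y0 y01 hN hy0 y0y} [yp big] : (1 < y)%N /\ forall c : R, c \in [:: 4; l%:R; 8 * (s%:R * (s%:R + 3)); 8 * (s1%:R * (s1%:R + 3));
  12 * Ks * Q1 / eta ^+ 2; 10 * 3 / eps; 10 * (2 * a%:R * (s2%:R + 3)) / eps;
  10 * (2 * a%:R * (B + 1)) / eps; expR (40 / eps); 10 * (2 * a%:R + 1) / eps] -> c <= y%:R.
  split; first exact: leq_trans y0y.
  by move=> c /hy0 h; apply: le_trans h _; rewrite ler_nat.
have Y4 : 4 <= y%:R :> R by apply: big; rewrite !inE eqxx.
have hl : l%:R <= y%:R :> R by apply: big; rewrite !inE eqxx ?orbT.
have hsy : 8 * (s%:R * (s%:R + 3)) <= y%:R :> R by apply: big; rewrite !inE eqxx ?orbT.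
have hs1y : 8 * (s1%:R * (s1%:R + 3)) <= y%:R :> R by apply: big; rewrite !inE eqxx ?orbT.
have hyT : 12 * Ks * Q1 / eta ^+ 2 <= y%:R by apply: big; rewrite !inE eqxx ?orbT.
have hy2 : 10 * 3 / eps <= y%:R by apply: big; rewrite !inE eqxx ?orbT.
have hy3 : 10 * (2 * a%:R * (s2%:R + 3)) / eps <= y%:R by apply: big; rewrite !inE eqxx ?orbT.
have hy4 : 10 * (2 * a%:R * (B + 1)) / eps <= y%:R by apply: big; rewrite !inE eqxx ?orbT.
have hy5 : expR (40 / eps) <= y%:R by apply: big; rewrite !inE eqxx ?orbT.
have {big} hy6 : 10 * (2 * a%:R + 1) / eps <= y%:R by apply: big; rewrite !inE eqxx ?orbT.
have y_0 : (0 < y)%N by apply: ltnW.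
have Y1 : 1 <= y%:R :> R by clear - Y4; lra.
have Y0 : 0 < y%:R :> R by clear - Y4; lra.
have Ly0 : 0 < L y by apply: log_gt0.
have LyY : L y <= y%:R by apply: log_nat_lt.
have N0 : (0 < N)%N by apply: leq_trans yN; rewrite expn_gt0 y_0.
have n0 : 0 < N%:R :> R by rewrite ltr0n.
have LN0 : 0 <= L N by apply: log_nat_ge0.
have LN : L N <= 2 * a%:R * L y.
  rewrite -[2]/(2%:R) -natrM -log_natX //; apply: log_nat_le => //; exact: ltnW.
have LNY : L N <= 2 * a%:R * y%:R.
  by apply: le_trans LN _; rewrite ler_wpM2l // mulr_ge0 // ltW.
have nY j : (j <= a)%N -> y%:R ^+ j <= N%:R :> R.
  move=> ja; rewrite -natrX ler_nat; apply: leq_trans yN; exact: leq_pexp2l.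
have small C j : 10 * C / eps <= y%:R -> (j < a)%N -> C * y%:R ^+ j <= eps / 10 * N%:R.
  move=> hC ja; rewrite ler_pdivrMr // in hC.
  apply: le_trans (_ : eps / 10 * y%:R ^+ j.+1 <= _).
    rewrite exprS mulrA ler_wpM2r ?exprn_ge0 //; clear - hC; lra.
  by rewrite ler_wpM2l ?nY // divr_ge0 // ltW.
have pw j k : (j <= k)%N -> y%:R ^+ j <= y%:R ^+ k :> R by move=> jk; apply: ler_weXn2l.
(* The exponent [20] makes [z] dominate the errors of order [y ^ 9] of the bilinear part; [e] is
   smaller than [(z ^ u) ^ -2 = y ^ (- 40 u)], as the sieve of level [z ^ u] requires. *)
pose z := (y ^ 20)%N; pose e : R := (y%:R ^+ (60 * u))^-1.
have zR : z%:R = y%:R ^+ 20 :> R by rewrite /z natrX.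
have zu k : (z ^ u)%:R ^+ k = y%:R ^+ (20 * u * k) :> R by rewrite /z !natrX !exprM.
have yz : (1 < y < z)%N by rewrite yp /z -[X in (X < _)%N]expn1 ltn_exp2l.
have z3 : (3 < z <= N)%N.
  apply/andP; split; first by rewrite -(ler_nat R) zR; apply: le_trans Y4 (pw 1%N 20%N _).
  by apply: leq_trans yN; rewrite /z leq_pexp2l // ea; clear; lia.
have e01 : 0 < e <= 1 by rewrite invr_gt0 exprn_gt0 // invf_le1 ?exprn_gt0 // exprn_ege1.
have De : 2 * (z ^ u)%:R ^+ 2 * e < 1.
  rewrite zu ltr_pdivrMr ?exprn_gt0 // mul1r.
  apply: lt_le_trans (pw (20 * u * 2).+1 (60 * u)%N _); last by clear - u0; lia.
  rewrite exprS ltr_pM2r ?exprn_gt0 //; clear - Y4; lra.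
have LK : L N * (2 / L y) <= K.
  rewrite eK mulrA ler_pdivrMr //; clear - LN; lra.
have d10 c : 0 <= c -> 8 * c <= y%:R -> c * (8 * y%:R ^+ 9) <= 2 / L y * (z%:R / 2).
  move=> c0 hc; have -> : 2 / L y * (z%:R / 2) = z%:R / L y by field; rewrite gt_eqF.
  rewrite ler_pdivlMr // zR; apply: le_trans (pw 11%N 20%N _) => //.
  have -> : c * (8 * y%:R ^+ 9) * L y = (8 * c) * y%:R ^+ 9 * L y by ring.
  rewrite -[11%N]/(1 + 9 + 1)%N !exprD !expr1; apply: ler_pM => //.
  - by rewrite mulr_ge0 ?exprn_ge0 // mulr_ge0.
  - exact: ltW.
  - by rewrite ler_wpM2r ?exprn_ge0.
have cY : y%:R ^+ 6 <= 2 / L y * (z%:R / 2).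
  have c8 : 0 <= 8^-1 :> R by rewrite invr_ge0.
  have h8 : 8 * 8^-1 <= y%:R :> R by clear - Y4; lra.
  apply: le_trans (d10 _ c8 h8); apply: le_trans (pw 6%N 9%N isT) _.
  by have := exprn_ge0 9 (ltW Y0); clear; lra.
have csx (k : nat) : (0 < k)%N -> 8 * (k%:R * (k%:R + 3)) <= y%:R :> R ->
   (k%:R + 3) * (8 * y%:R ^+ 9) <= 2 / L y * (z%:R / 2) / k%:R.
  move=> k0 hk; have c0 : 0 <= k%:R * (k%:R + 3) :> R by rewrite mulr_ge0 // addr_ge0.
  rewrite ler_pdivlMr ?ltr0n //; apply: le_trans (d10 _ c0 hk).
  by rewrite le_eqVlt; apply/orP; left; apply/eqP; ring.
have sR : 0 < s%:R :> R by rewrite ltr0n.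
have s1R : 0 < s1%:R :> R by rewrite ltr0n.
have s2R : 0 < s2%:R :> R by rewrite ltr0n.
have TR : 0 < T%:R :> R by rewrite ltr0n.
have quart c v : 0 < v -> 4 * c / eta ^+ 2 <= v -> c / v <= eta ^+ 2 / 4.
  by move=> v0; rewrite ler_pdivrMr // ler_pdivrMr // => h; clear - h; lra.
have hk : 126 / s%:R + 36 * (square_bound s)%:R * K *
    (7 / s1%:R + 3 * (square_bound s1)%:R * (T%:R^-1 + (y ^ 3)%:R^-1)) <= eta ^+ 2.
  rewrite -eKs -eQ1.
  have -> : Ks * (7 / s1%:R + 3 * Q1 * (T%:R^-1 + (y ^ 3)%:R^-1)) =
     7 * Ks / s1%:R + 3 * Ks * Q1 / T%:R + 3 * Ks * Q1 / (y ^ 3)%:R by ring.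
  have q1 : 126 / s%:R <= eta ^+ 2 / 4 by apply: quart => //; apply: le_trans hs; rewrite ler_pM2r ?invr_gt0 //; clear; lra.
  have q2 : 7 * Ks / s1%:R <= eta ^+ 2 / 4 by apply: quart => //; apply: le_trans hs1; rewrite ler_pM2r ?invr_gt0 //; clear - Ks0; lra.
  have q3 : 3 * Ks * Q1 / T%:R <= eta ^+ 2 / 4 by apply: quart => //; apply: le_trans hT; rewrite ler_pM2r ?invr_gt0 //; clear; lra.
  have q4 : 3 * Ks * Q1 / (y ^ 3)%:R <= eta ^+ 2 / 4.
    apply: quart; first by rewrite ltr0n expn_gt0 y_0.
    apply: le_trans (_ : y%:R <= _); last by rewrite natrX; apply: (pw 1%N 3%N).
    by apply: le_trans hyT; rewrite ler_pM2r ?invr_gt0 //; clear; lra.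
  by clear - q1 q2 q3 q4; lra.
have il v : y%:R <= v -> v^-1 <= l%:R^-1 :> R.
  move=> h; rewrite lef_pV2 ?posrE ?ltr0n //; last exact: lt_le_trans h.
  exact: le_trans h.
have far1 : far_multiples s s1 T (8 * y%:R ^+ 3)^-1 x.
  move=> i q q0 /andP[i0 iT] /andP[q_0 qs] /andP[q00 q0s] h; apply: (far (q * q0 * i)%N).
    rewrite !muln_gt0 q_0 q00 i0 /=; apply: leq_trans (leq_addr _ _).
    by rewrite leq_mul ?(ltnW iT) // mulnC leq_mul.
  apply: nearint_le h; have -> : 2 * (8 * y%:R ^+ 3)^-1 = (4 * y%:R ^+ 3)^-1 :> R.
    by field; rewrite gt_eqF.
  apply: il; have := pw 1%N 3%N isT; rewrite expr1; clear - Y0; lra.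
have far2 q : (0 < q <= square_bound s2)%N -> ~ nearint e (q%:R * x).
  move=> /andP[q0 qs] h; apply: (far q); first by rewrite q0 (leq_trans qs) // leq_addl.
  apply: nearint_le h; apply: il; rewrite -[X in X <= _]expr1; apply: pw.
  by clear - u0; lia.
have := @prime_sum_le R y z u s s1 s2 T N e x t eta K yz z3 u1 s0 s10 s20 T0 far1 far2 e01 De LK eta0 cY
  (csx s s0 hsy) (csx s1 s10 hs1y) hk.
move=> /le_trans; apply; rewrite -eB.
have Lz : L z = 20 * L y by rewrite /z log_natX.
have Lz0 : 0 < L z by rewrite Lz mulr_gt0.
have b1 : 3 * z%:R <= eps / 10 * N%:R by rewrite zR; apply: small; rewrite // ea; clear; lia.
have b2 : L N * (N.+1%:R * (B / L z) * (3 / s2%:R + 4 / u%:R ^+ 2)) <= eps / 10 * N%:R + eps / 10 * N%:R.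
  have r1 : L N / L z <= 22 * u%:R.
    rewrite ler_pdivrMr // Lz; apply: le_trans LN _.
    rewrite ea natrD natrM; have : 2 <= u%:R :> R by rewrite ler_nat.
    move: Ly0 (u%:R : R) => /ltW; move: (L y) => v v0 w w2.
    by rewrite mulrA ler_wpM2r //; clear - w2; lra.
  have r2 : N.+1%:R <= 2 * N%:R :> R by rewrite -natrM ler_nat; clear - N0; lia.
  have c0 : 0 <= B * (3 / s2%:R + 4 / u%:R ^+ 2).
    apply: mulr_ge0; first exact: ltW.
    by rewrite addr_ge0 // divr_ge0 // ?exprn_ge0.
  have -> : L N * (N.+1%:R * (B / L z) * (3 / s2%:R + 4 / u%:R ^+ 2)) =
     ((L N / L z) * N.+1%:R) * (B * (3 / s2%:R + 4 / u%:R ^+ 2)) by ring.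
  apply: le_trans (_ : (22 * u%:R * (2 * N%:R)) * (B * (3 / s2%:R + 4 / u%:R ^+ 2)) <= _).
    rewrite ler_wpM2r //; apply: ler_pM => //; apply: divr_ge0 => //; exact: ltW.
  have -> : 22 * u%:R * (2 * N%:R) * (B * (3 / s2%:R + 4 / u%:R ^+ 2)) =
     (132 * u%:R * B / s2%:R) * N%:R + (176 * B / u%:R) * N%:R.
    by field; rewrite !gt_eqF.
  have Bu : 0 < B * u%:R by rewrite mulr_gt0.
  apply: lerD; rewrite ler_wpM2r // ler_pdivrMr //.
    by move: hs2; rewrite ler_pdivrMr //; clear - Bu; lra.
  by move: hu; rewrite ler_pdivrMr //; clear - B0; lra.
have b3 : L N * ((s2%:R + 3) * (z ^ u)%:R ^+ 6 / e) <= eps / 10 * N%:R.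
  apply: le_trans (small _ (180 * u + 1)%N hy3 _); last by rewrite ea; clear - u0; lia.
  have -> : (s2%:R + 3) * (z ^ u)%:R ^+ 6 / e = (s2%:R + 3) * y%:R ^+ (180 * u).
    by rewrite zu invrK -mulrA -exprD; congr (_ * _ ^+ _); clear; lia.
  have q0 : 0 <= (s2%:R + 3) * y%:R ^+ (180 * u) :> R by rewrite mulr_ge0 ?exprn_ge0 // addr_ge0.
  apply: le_trans (ler_wpM2r q0 LNY) _; rewrite addn1 exprS.
  by rewrite le_eqVlt; apply/orP; left; apply/eqP; ring.
have b4 : L N * (z%:R * (B + (z ^ u)%:R ^+ 6)) <= eps / 10 * N%:R.
  apply: le_trans (small _ (120 * u + 21)%N hy4 _); last by rewrite ea; clear - u0; lia.
  have -> : (z ^ u)%:R ^+ 6 = y%:R ^+ (120 * u) :> R by rewrite zu; congr (_ ^+ _); clear; lia.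
  rewrite zR exprD; have P1 : 1 <= y%:R ^+ (120 * u) :> R by rewrite exprn_ege1.
  have Z0 : 0 <= y%:R ^+ 20 :> R by rewrite exprn_ge0.
  rewrite [y%:R ^+ 21]exprS.
  have q0 : 0 <= y%:R ^+ 20 * (B + y%:R ^+ (120 * u)) :> R by rewrite mulr_ge0 // addr_ge0 ?exprn_ge0 // ltW.
  apply: le_trans (ler_wpM2r q0 LNY) _.
  have ayz : 0 <= 2 * a%:R * y%:R * y%:R ^+ 20 :> R by rewrite mulr_ge0 // mulr_ge0 ?mulr_ge0.
  have -> : 2 * a%:R * y%:R * (y%:R ^+ 20 * (B + y%:R ^+ (120 * u))) =
    2 * a%:R * y%:R * y%:R ^+ 20 * (B + y%:R ^+ (120 * u)) by ring.
  have -> : 2 * a%:R * (B + 1) * (y%:R ^+ (120 * u) * (y%:R * y%:R ^+ 20)) =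
    2 * a%:R * y%:R * y%:R ^+ 20 * ((B + 1) * y%:R ^+ (120 * u)) by ring.
  by rewrite ler_wpM2l //; clear - B0 P1; nra.
have b5 : 2 * (2 / L y) * N%:R <= eps / 10 * N%:R.
  rewrite ler_wpM2r // mulrA ler_pdivrMr //.
  have : 40 / eps <= L y by rewrite -(expRK (40 / eps)) ler_ln ?posrE ?expR_gt0.
  by rewrite ler_pdivrMr // mulrC => h; clear - h; lra.
have b6 : y%:R ^+ 6 * (1 + L N) <= eps / 10 * N%:R.
  apply: le_trans (small _ 7%N hy6 _); last by rewrite ea; clear; lia.
  have -> : (2 * a%:R + 1) * y%:R ^+ 7 = y%:R ^+ 6 * (2 * a%:R * y%:R + y%:R) :> R.
    by rewrite [y%:R ^+ 7]exprS; ring.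
  by rewrite ler_wpM2l ?exprn_ge0 //; clear - LNY Y1; lra.
have b7 : L N * (N%:R / (z%:R - 1)) <= eps / 10 * N%:R.
  have z2 : y%:R ^+ 2 <= z%:R - 1 :> R.
    have : y%:R ^+ 3 <= z%:R :> R by rewrite zR pw.
    by rewrite exprS; have := exprn_ege1 2 Y1; clear - Y4; nra.
  have Y2 : 0 < y%:R ^+ 2 :> R by rewrite exprn_gt0.
  rewrite mulrCA [leRHS]mulrC ler_wpM2l // ler_pdivrMr; last exact: lt_le_trans z2.
  apply: le_trans LNY _; apply: le_trans (_ : eps / 10 * y%:R ^+ 2 <= _); last first.
    by rewrite ler_wpM2l // divr_ge0 // ltW.
  rewrite expr2 mulrA ler_wpM2r //.
  by move: hy6; rewrite ler_pdivrMr //; clear - aR; lra.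
have b8 : 3 * L N * (2 * eta * (2 / L y) * N%:R) <= eps / 10 * N%:R.
  have -> : 3 * L N * (2 * eta * (2 / L y) * N%:R) = 6 * eta * (L N * (2 / L y)) * N%:R by ring.
  rewrite ler_wpM2r //; apply: le_trans (_ : 6 * eta * K <= _).
    by rewrite ler_wpM2l // mulr_ge0 // ltW.
  by rewrite eeta le_eqVlt; apply/orP; left; apply/eqP; field; rewrite gt_eqF.
rewrite [L N * (_ + _)]mulrDr [L N * (_ / e + _)]mulrDr.
apply: le_trans (lerD (lerD (lerD b1 (lerD (lerD b2 (lerD b3 b4)) (lerD b5 b6))) b7) b8) _.
have : 0 < eps * N%:R by rewrite mulr_gt0.
by clear; lra.
Qed.

End ExpSum.

(** * Primes in arithmetic progressions *)

Section VonMangoldt.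
Context {R : realType}.
Local Notation L := (@log_nat R).
Implicit Types (F G : nat -> R).

Lemma sum_multiples F d X : (0 < d)%N ->
  \sum_(1 <= n < X.+1 | (d %| n)%N) F n = \sum_(1 <= m < (X %/ d).+1) F (d * m)%N.
Proof.
move=> d0.
have e1 : \sum_(1 <= n < X.+1 | (d %| n)%N) F n = \sum_(0 <= n < X.+1 | (d %| n)%N && (0 < n)%N) F n.
  rewrite [RHS]big_mkcond big_ltn //= andbF add0r [LHS]big_mkcond big_nat [RHS]big_nat.
  by apply: eq_bigr => n /andP[n1 _]; rewrite n1 andbT.
have e2 : \sum_(1 <= m < (X %/ d).+1) F (d * m)%N = \sum_(0 <= m < X.+1 | (m <= X %/ d)%N && (0 < m)%N) F (d * m)%N.
  rewrite [RHS]big_mkcond [RHS]big_ltn //= ?andbF add0r.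
  rewrite (big_nat_widen 1 (X %/ d).+1 X.+1) ?ltnS ?leq_div // big_mkcond big_nat [RHS]big_nat.
  by apply: eq_bigr => m /andP[m1 _]; rewrite m1 andbT ltnS.
rewrite e1 e2 big_nat_multiples //; apply: eq_bigl => m.
by rewrite ltnS leq_divRL // [(m * d)%N]mulnC muln_gt0 d0.
Qed.

Lemma sum_divisors_exchange (g F : nat -> R) X :
  \sum_(1 <= n < X.+1) (\sum_(1 <= d < X.+1 | (d %| n)%N) g d) * F n =
  \sum_(1 <= d < X.+1) g d * \sum_(1 <= m < (X %/ d).+1) F (d * m)%N.
Proof.
under eq_bigr do rewrite mulr_suml big_mkcond.
rewrite exchange_big /= big_nat [RHS]big_nat; apply: eq_bigr => d /andP[d1 _].
by rewrite -big_mkcond -mulr_sumr sum_multiples.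
Qed.

(** Stopping both ranges at [n] loses nothing, as [p ^ k = n] with [k >= 1] forces [p, k <= n]. *)
Definition mangoldt n : R := \sum_(0 <= p < n.+1 | prime p) \sum_(1 <= k < n.+1) (if (p ^ k == n)%N then L p else 0).

Lemma mangoldt_ge0 n : 0 <= mangoldt n.
Proof. by apply: sumr_ge0 => p _; apply: sumr_ge0 => k _; case: ifP => // _; apply: log_nat_ge0. Qed.

Lemma leq_pow_exp p k : prime p -> (k <= p ^ k)%N.
Proof. by move=> /prime_gt1 p1; apply: ltnW; apply: ltn_expl. Qed.

Lemma mangoldt_widen n B : (n <= B)%N ->
  mangoldt n = \sum_(0 <= p < B.+1 | prime p) \sum_(1 <= k < B.+1) (if (p ^ k == n)%N then L p else 0).
Proof.
move=> nB; rewrite /mangoldt (big_nat_widen _ _ B.+1) // big_mkcond [RHS]big_mkcond; apply: eq_bigr => p _.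
case pp: (prime p) => //=.
have ew : \sum_(1 <= k < n.+1) (if (p ^ k == n)%N then L p else 0) =
   \sum_(1 <= k < B.+1) (if (p ^ k == n)%N then L p else 0).
  rewrite (big_nat_widen _ _ B.+1) // big_mkcond; apply: eq_bigr => k _; rewrite ltnS.
  case: leqP => // nk; case: eqP => // e; move: nk; rewrite -e ltnNge leq_pow_exp //.
case: ifP => [_|/negbT]; first exact: ew.
rewrite ltnS -ltnNge => np; rewrite big_nat big1 // => k /andP[k1 _]; case: eqP => // e.
by move: np; rewrite -e ltnNge -{1}(expn1 p) leq_exp2l ?prime_gt1 // k1.
Qed.

Lemma mangoldt_sum G X : \sum_(1 <= n < X.+1) mangoldt n * G n =
  \sum_(0 <= p < X.+1 | prime p) L p * \sum_(1 <= k < X.+1) (if (p ^ k <= X)%N then G (p ^ k)%N else 0).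
Proof.
have -> : \sum_(1 <= n < X.+1) mangoldt n * G n = \sum_(1 <= n < X.+1)
    \sum_(0 <= p < X.+1 | prime p) \sum_(1 <= k < X.+1) (if (p ^ k == n)%N then L p * G n else 0).
  rewrite big_nat [RHS]big_nat; apply: eq_bigr => n /andP[_ nX].
  rewrite (@mangoldt_widen n X) // mulr_suml; apply: eq_bigr => p _; rewrite mulr_suml; apply: eq_bigr => k _.
  by case: ifP => // _; rewrite mul0r.
rewrite exchange_big /=; apply: eq_bigr => p pp; rewrite exchange_big mulr_sumr /=.
apply: eq_bigr => k _.
have q0 : (0 < p ^ k)%N by rewrite expn_gt0 prime_gt0.
case: leqP => h.
  rewrite -big_mkcond /= (eq_bigl (fun n => n == (p ^ k)%N)); last by move=> n; rewrite eq_sym.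
  by rewrite big_nat1_eq q0 ltnS h.
rewrite mulr0 big_nat big1 // => n /andP[_ nX]; case: eqP => // e.
by move: nX; rewrite -e ltnS leqNgt h.
Qed.

Lemma mangoldt_dvd_sum n X : (0 < n <= X)%N -> \sum_(1 <= d < X.+1 | (d %| n)%N) mangoldt d = L n.
Proof.
move=> /andP[n0 nX].
have -> : \sum_(1 <= d < X.+1 | (d %| n)%N) mangoldt d = \sum_(1 <= d < X.+1) mangoldt d * ((d %| n)%N : nat)%:R.
  by rewrite big_mkcond; apply: eq_bigr => d _; case: ifP; rewrite ?mulr1 ?mulr0.
rewrite mangoldt_sum (@log_factor R n X.+1) //; last by move=> p _ pn; rewrite ltnS (leq_trans (dvdn_leq n0 pn)).
apply: eq_bigr => p pp; rewrite mulrC; congr (_ * _).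
transitivity ((\sum_(1 <= k < X.+1) ((p ^ k %| n)%N : nat))%:R : R).
  rewrite natr_sum; apply: eq_bigr => k _; case: leqP => // h.
  by case e: (_ %| _)%N => //; have := dvdn_leq n0 e; rewrite leqNgt (leq_ltn_trans nX h).
congr (_%:R); rewrite (eq_bigr (fun k => (k <= logn p n)%N : nat)); last by move=> k _; rewrite pfactor_dvdn.
have lX : (logn p n <= X)%N by apply: leq_trans (ltnW (ltn_logl p n0)) nX.
rewrite (@big_cat_nat _ _ _ (logn p n).+1) //= [X in (_ + X)%N]big1_seq ?addn0; last first.
  by move=> k; rewrite mem_index_iota => /andP[_ /andP[h _]]; rewrite leqNgt h.
rewrite big_nat (eq_bigr (fun=> 1%N)); last by move=> k /andP[_]; rewrite ltnS => ->.
by rewrite -big_nat sum_nat_const_nat muln1 subSS subn0.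
Qed.

Lemma mangoldt_pow_tail p K : prime p -> \sum_(2 <= k < K) (p%:R ^+ k)^-1 <= (p%:R * (p%:R - 1))^-1 :> R.
Proof.
move=> pp; have p2 : 2 <= p%:R :> R by apply: prime_ge2.
have p0 : 0 < p%:R :> R by lra.
have p1 : 0 < p%:R * (p%:R - 1) :> R by rewrite mulr_gt0 //; lra.
case: (leqP K 2) => [K2|K2]; first by rewrite big_geq // invr_ge0 ltW.
suff -> : \sum_(2 <= k < K) (p%:R ^+ k)^-1 = (p%:R * (p%:R - 1))^-1 - (p%:R ^+ K.-1 * (p%:R - 1))^-1 :> R.
  by rewrite gerBl invr_ge0 mulr_ge0 ?exprn_ge0 //; lra.
case: K K2 => // K; rewrite ltnS /=; elim: K => // K IH; rewrite leq_eqVlt => /orP[/eqP <-|K2].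
  rewrite big_nat1; move: p2; move: (p%:R : R) => v v2; field; rewrite !gt_eqF //; lra.
have K1 : (1 < K.+1)%N by apply: ltnW.
rewrite big_nat_recr //= IH // exprS; have q0 : 0 < p%:R ^+ K :> R by rewrite exprn_gt0.
by move: q0 p2; move: (p%:R ^+ K : R) (p%:R : R) => q v q0 v2; field; rewrite !gt_eqF //; lra.
Qed.

Lemma mangoldt_prime_powers X : \sum_(0 <= p < X.+1 | prime p) L p * \sum_(2 <= k < X.+1) (p%:R ^+ k)^-1 <= 2.
Proof.
apply: le_trans (sum_log_sq_le X).
case: X => [|[|X]].
- by rewrite [leRHS]big_geq // big_mkcond big_nat1.
- by rewrite [leRHS]big_geq // big_mkcond big_ltn // big_nat1 /= addr0.
rewrite big_mkcond big_ltn //= add0r big_ltn //= add0r; apply: ler_sum => p _; case: ifP => pp.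
  by rewrite ler_wpM2l ?log_nat_ge0 // mangoldt_pow_tail.
case: p pp => [|p _]; first by rewrite mul0r invr0 mulr0.
by rewrite divr_ge0 ?log_nat_ge0 // mulr_ge0 // subr_ge0 ler1n.
Qed.

Lemma mangoldt_primes X F B : (forall n, `|F n| <= B) ->
  `|\sum_(1 <= n < X.+1) mangoldt n / n%:R * F n - \sum_(0 <= p < X.+1 | prime p) L p / p%:R * F p| <= 2 * B.
Proof.
move=> FB; have B0 : 0 <= B by apply: le_trans (FB 0%N).
have -> : \sum_(1 <= n < X.+1) mangoldt n / n%:R * F n = \sum_(1 <= n < X.+1) mangoldt n * (n%:R^-1 * F n).
  by apply: eq_bigr => n _; rewrite mulrA.
rewrite mangoldt_sum -sumrB; apply: le_trans (ler_norm_sum _ _ _) _.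
apply: le_trans (ler_wpM2r B0 (mangoldt_prime_powers X)); rewrite mulr_suml big_nat_cond [leRHS]big_nat_cond.
apply: ler_sum => p /andP[/andP[_ pX] pp]; rewrite ltnS in pX.
have X1 : (0 < X)%N by apply: leq_trans pX; apply: prime_gt0.
rewrite big_ltn ?ltnS // expn1 pX mulrDr mulrA addrAC subrr add0r normrM ger0_norm ?log_nat_ge0 // -mulrA.
rewrite ler_wpM2l ?log_nat_ge0 //; apply: le_trans (ler_norm_sum _ _ _) _; rewrite mulr_suml.
apply: ler_sum => k _; case: ifP => _; last by rewrite normr0 mulr_ge0 // invr_ge0 exprn_ge0.
by rewrite normrM -natrX ger0_norm ?invr_ge0 // ler_wpM2l ?invr_ge0.
Qed.

Lemma psi_le X : \sum_(1 <= n < X.+1) mangoldt n <= 5 * X%:R.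
Proof.
have -> : \sum_(1 <= n < X.+1) mangoldt n = \sum_(1 <= n < X.+1) mangoldt n * 1 by apply: eq_bigr => n _; rewrite mulr1.
rewrite mangoldt_sum.
have -> : 5 * X%:R = 3 * X%:R + 2 * X%:R :> R by ring.
apply: le_trans (lerD (chebyshev X) (ler_wpM2r _ (mangoldt_prime_powers X))) => //.
rewrite mulr_suml -big_split /= big_nat_cond [leRHS]big_nat_cond; apply: ler_sum => p /andP[/andP[_ pX] pp].
rewrite ltnS in pX; have X1 : (0 < X)%N by apply: leq_trans pX; apply: prime_gt0.
rewrite big_ltn ?ltnS // expn1 pX mulrDr mulr1 lerD2l -mulrA ler_wpM2l ?log_nat_ge0 // mulr_suml.
apply: ler_sum => k _; case: ifP => h; last by rewrite mulr_ge0 // invr_ge0 exprn_ge0.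
by rewrite -natrX mulrC ler_pdivlMr ?ltr0n ?expn_gt0 ?prime_gt0 // mul1r ler_nat.
Qed.

Definition mu d : R := if sqfree d then mob d else 0.

(** The squarefree divisors of [p ^ k.+1 m] are [d] and [p d] for the squarefree divisors [d] of
    [m], with opposite signs. Taking [h = 1] and [h = log] gives the two classical divisor sums of
    the Moebius function. *)
Lemma mu_split (h : nat -> R) p m n X : prime p -> ~~ (p %| m)%N -> (0 < m)%N ->
  (exists k, n = (p ^ k.+1 * m)%N) -> (n <= X)%N ->
  \sum_(1 <= d < X.+1 | (d %| n)%N) mu d * h d = \sum_(1 <= d < X.+1 | (d %| m)%N) mu d * (h d - h (p * d)%N).
Proof.
move=> pp pm m0 [k nE] nX; have p0 := prime_gt0 pp.
have n0 : (0 < n)%N by rewrite nE muln_gt0 expn_gt0 p0 m0.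
have dn d : sqfree d -> ~~ (p %| d)%N -> (d %| n)%N = (d %| m)%N.
  move=> sd pd; rewrite nE Gauss_dvdr //.
  by rewrite coprimeXr // coprime_sym prime_coprime.
have pdn d : sqfree (p * d) -> ~~ (p %| d)%N -> (p * d %| n)%N = (d %| m)%N.
  move=> sd pd; rewrite nE expnS -mulnA dvdn_pmul2l // Gauss_dvdr //.
  by rewrite coprimeXr // coprime_sym prime_coprime.
rewrite (bigID (fun d => (p %| d)%N)) /= addrC.
have -> : \sum_(1 <= d < X.+1 | (d %| n)%N && ~~ (p %| d)%N) mu d * h d = \sum_(1 <= d < X.+1 | (d %| m)%N) mu d * h d.
  rewrite big_mkcond [RHS]big_mkcond; apply: eq_bigr => d _; rewrite /mu.
  case sd: (sqfree d); last by rewrite mul0r; do 2 case: ifP.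
  have [pd|pd] := boolP (p %| d)%N; last by rewrite dn // andbT.
  by rewrite andbF; case: ifP => // dm; case/negP: pm; apply: dvdn_trans dm.
have -> : \sum_(1 <= d < X.+1 | (d %| n)%N && (p %| d)%N) mu d * h d =
    - \sum_(1 <= d < X.+1 | (d %| m)%N) mu d * h (p * d)%N.
  rewrite -sumrN.
  rewrite (eq_bigl (fun d => (p %| d)%N && (d %| n)%N)); last by move=> d; rewrite andbC.
  rewrite big_mkcondr /= sum_multiples //.
  rewrite [LHS](big_nat_widen _ _ X.+1) ?ltnS ?leq_div // big_mkcond [RHS]big_mkcond.
  rewrite [LHS]big_nat [RHS]big_nat; apply: eq_bigr => d /andP[d1 _]; rewrite ltnS leq_divRL //= mulnC.
  have [pd|pd] := boolP (p %| d)%N.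
    have -> : (d %| m)%N = false by apply/negP => dm; case/negP: pm; apply: dvdn_trans dm.
    case: ifP => // _; case: ifP => // _; rewrite /mu; case: ifP => [/sqfreeP[_ /(_ p pp)]|]; last by rewrite mul0r.
    by rewrite -mulnn dvdn_pmul2l // pd.
  rewrite /mu sqfree_primeM //; case sd: (sqfree d); last by rewrite !mul0r oppr0 !if_same.
  have sd' : sqfree (p * d) by rewrite sqfree_primeM.
  rewrite pdn //; case dm: (d %| m)%N => //; last by rewrite if_same.
  rewrite (leq_trans _ nX); last by rewrite dvdn_leq // pdn.
  by rewrite /mob primeprodM // mulN1r mulNr.
by rewrite -sumrB; apply: eq_bigr => d _; rewrite mulrBr.
Qed.

Lemma pow_factor n : (1 < n)%N -> exists p m, [/\ prime p, ~~ (p %| m)%N, (0 < m)%N & exists k, n = (p ^ k.+1 * m)%N].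
Proof.
move=> n1; have n0 := ltnW n1; have pp := pdiv_prime n1.
have [m cm nE] := pfactor_coprime pp n0; exists (pdiv n), m; split=> //.
- by rewrite -prime_coprime.
- by move: n0; rewrite nE muln_gt0 => /andP[].
- exists (logn (pdiv n) n).-1; rewrite prednK 1?mulnC //.
  by rewrite logn_gt0 mem_primes pp n0 pdiv_dvd.
Qed.

Lemma mu_sum n X : (0 < n <= X)%N -> \sum_(1 <= d < X.+1 | (d %| n)%N) mu d = ((n == 1%N) : nat)%:R.
Proof.
move=> /andP[n0 nX]; have e : \sum_(1 <= d < X.+1 | (d %| n)%N) mu d = \sum_(1 <= d < X.+1 | (d %| n)%N) mu d * 1.
  by apply: eq_bigr => d _; rewrite mulr1.
rewrite e; have [n1|n1] := leqP n 1.
  have -> : n = 1%N by apply/eqP; rewrite eqn_leq n1.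
  rewrite (eq_bigl (fun d => d == 1%N)); last by move=> d; rewrite dvdn1.
  by rewrite big_nat1_eq /= ltnS (leq_trans n0 nX) mulr1 /mu /mob primeprod1.
have [p [m [pp pm m0 hk]]] := pow_factor n1.
rewrite (mu_split _ pp pm m0 hk nX) big1 => [|d _]; last by rewrite subrr mulr0.
by case: eqP n1 => // ->.
Qed.

Lemma mangoldt_factor p m k : prime p -> ~~ (p %| m)%N -> (0 < m)%N ->
  mangoldt (p ^ k.+1 * m) = ((m == 1%N) : nat)%:R * L p.
Proof.
move=> pp pm m0; have [->|m1] := eqVneq m 1%N; last first.
  rewrite mul0r /mangoldt big1 // => q qq; rewrite big1 // => j _; case: eqP => // e.
  have m2 : (1 < m)%N by case: m m0 m1 {pm e} => [|[]].
  have hq r : prime r -> (r %| p ^ k.+1 * m)%N -> r = q.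
    by move=> rr; rewrite -e Euclid_dvdX // dvdn_prime2 // => /andP[/eqP].
  have e1 : p = q by apply: hq => //; rewrite dvdn_mulr // expnS dvdn_mulr.
  have e2 : pdiv m = q by apply: hq; rewrite ?pdiv_prime // dvdn_mull // pdiv_dvd.
  by case/negP: pm; rewrite e1 -e2 pdiv_dvd.
rewrite mul1r muln1 /mangoldt.
have eqq q j : prime q -> (0 < j)%N -> (q ^ j == p ^ k.+1)%N = (q == p) && (j == k.+1).
  move=> qq j0; apply/eqP/andP => [e|[/eqP -> /eqP ->]//].
  have qp : q = p.
    apply/eqP; rewrite -dvdn_prime2 //; have : (q %| p ^ k.+1)%N by rewrite -e; case: j j0 {e} => // j _; rewrite expnS dvdn_mulr.
    by rewrite Euclid_dvdX // => /andP[].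
  by split; [rewrite qp|move/eqP: e; rewrite qp eqn_exp2l // prime_gt1].
have pX : (p < (p ^ k.+1).+1)%N by rewrite ltnS -{1}(expn1 p) leq_exp2l ?prime_gt1.
have kX : (k.+1 < (p ^ k.+1).+1)%N by rewrite ltnS leq_pow_exp.
transitivity (\sum_(0 <= q < (p ^ k.+1).+1 | q == p) \sum_(1 <= j < (p ^ k.+1).+1 | j == k.+1) L q); last first.
  by rewrite big_nat1_eq pX big_nat1_eq kX.
rewrite big_mkcond [RHS]big_mkcond; apply: eq_bigr => q _.
case: eqP => [->|qp]; last first.
  case: ifP => // qq; rewrite big_nat big1 // => j /andP[j1 _]; rewrite eqq //.
  by case: eqP.
rewrite pp [RHS]big_mkcond [LHS]big_nat [RHS]big_nat; apply: eq_bigr => j /andP[j1 _].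
by rewrite eqq // eqxx.
Qed.

Lemma mu_log_sum n X : (0 < n <= X)%N -> \sum_(1 <= d < X.+1 | (d %| n)%N) mu d * L d = - mangoldt n.
Proof.
move=> /andP[n0 nX]; have [n1|n1] := leqP n 1.
  have -> : n = 1%N by apply/eqP; rewrite eqn_leq n1.
  rewrite (eq_bigl (fun d => d == 1%N)); last by move=> d; rewrite dvdn1.
  rewrite big_nat1_eq /= ltnS (leq_trans n0 nX) /log_nat ln1 mulr0 /mangoldt big1 ?oppr0 // => p pp.
  rewrite big_nat big1 // => k /andP[k1 _]; case: eqP => // /eqP; rewrite -(expn0 p) eqn_exp2l ?prime_gt1 //.
  by move=> /eqP k0; rewrite k0 in k1.
have [p [m [pp pm m0 hk]]] := pow_factor n1.
rewrite (mu_split _ pp pm m0 hk nX); case: hk => k nE; rewrite nE mangoldt_factor //.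
have mX : (0 < m <= X)%N by rewrite m0 (leq_trans _ nX) // nE leq_pmull // expn_gt0 prime_gt0.
rewrite -(mu_sum mX) mulr_suml -sumrN big_nat_cond [RHS]big_nat_cond; apply: eq_bigr => d /andP[/andP[d1 _] _].
by rewrite log_natM ?(prime_gt0 pp) //; ring.
Qed.

End VonMangoldt.

(** * Periodic functions of sum zero and their series at [1] *)

Section Periodic.
Context {R : realType} (w : nat).
Local Notation L := (@log_nat R).
Local Notation Z := 'I_w.+2.
Implicit Types (f : Z -> R) (v : nat -> R).

Lemma natr_period n : (n + w.+2)%:R = n%:R :> Z.
Proof. by rewrite natrD (pchar_Zp (isT : 1 < w.+2)%N) addr0. Qed.

Lemma sum_residues f : \sum_(0 <= n < w.+2) f n%:R = \sum_a f a.
Proof. by rewrite big_mkord; apply: eq_bigr => a _; rewrite natr_Zp. Qed.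

Lemma abel_le (F v : nat -> R) (C : R) m n : (forall k, `|\sum_(m <= i < k) F i| <= C) ->
  (forall i, (m <= i)%N -> 0 <= v i.+1 <= v i) -> 0 <= v m ->
  `|\sum_(m <= i < n) F i * v i| <= C * v m.
Proof.
move=> FC dec v0; have C0 : 0 <= C by apply: le_trans (FC 0%N).
have [nm|mn] := leqP n m; first by rewrite big_geq // normr0 mulr_ge0.
have vn k : (m <= k)%N -> 0 <= v k.
  by rewrite leq_eqVlt => /orP[/eqP <-//|]; case: k => // k mk; case/andP: (dec k mk).
have key k : (m <= k)%N -> \sum_(m <= i < k) F i * v i =
    \sum_(m <= i < k) (\sum_(m <= j < i.+1) F j) * (v i - v i.+1) + (\sum_(m <= j < k) F j) * v k.
  elim: k => [|k IH] mk; first by rewrite !big_geq // mul0r addr0.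
  move: mk; rewrite leq_eqVlt => /orP[/eqP <-|mk]; first by rewrite !big_geq // mul0r addr0.
  by rewrite big_nat_recr //= [in RHS]big_nat_recr //= IH // !big_nat_recr //=; ring.
rewrite key 1?ltnW //; apply: le_trans (ler_normD _ _) _.
apply: le_trans (_ : \sum_(m <= i < n) C * (v i - v i.+1) + C * v n <= _).
  apply: lerD; last by rewrite normrM (ger0_norm (vn _ (ltnW mn))) ler_wpM2r // vn // ltnW.
  apply: le_trans (ler_norm_sum _ _ _) _; rewrite big_nat [leRHS]big_nat; apply: ler_sum => i /andP[mi _].
  by case/andP: (dec i mi) => h1 h2; rewrite normrM (ger0_norm (_ : 0 <= v i - v i.+1)) ?subr_ge0 // ler_wpM2r ?subr_ge0.
rewrite -mulr_sumr -mulrDr (@telescope_sumr_eq _ _ _ (fun k => - v k)) ?(ltnW mn) //.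
  by rewrite opprK addrAC addNr add0r.
by move=> k _; rewrite opprK addrC.
Qed.

(* The functions for which [sum f(b n) / n] converges. *)
Definition admissible f := (forall a, a \isn't a GRing.unit -> f a = 0) /\ \sum_a f a = 0.

Lemma admissibleM f b : admissible f -> \sum_a f (b * a) = 0.
Proof.
move=> [f0 fs]; have [ub|nb] := boolP (b \is a GRing.unit).
  by rewrite -[RHS]fs [RHS](reindex_inj (mulrI ub)).
by rewrite big1 // => a _; apply: f0; rewrite unitrM negb_and nb.
Qed.

Lemma periodic_partial f b (B : R) m k : admissible f -> (forall a, `|f a| <= B) ->
  `|\sum_(m <= i < k) f (b * i%:R)| <= 2 * (w.+2%:R * B).
Proof.
move=> hf fB; have B0 : 0 <= B by apply: le_trans (fB 0).
have pre X : `|\sum_(0 <= i < X) f (b * i%:R)| <= w.+2%:R * B.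
  rewrite {1}(divn_eq X w.+2) sum_periodic_blocks => [|n]; last by rewrite natr_period.
  rewrite (sum_residues (fun a => f (b * a))) admissibleM // mulr0 add0r.
  apply: le_trans (ler_norm_sum _ _ _) _; apply: le_trans (_ : \sum_(0 <= i < X %% w.+2) B <= _).
    by apply: ler_sum => i _.
  by rewrite sumr_const_nat subn0 -[leLHS]mulr_natl ler_wpM2r // ler_nat ltnW // ltn_pmod.
have [km|mk] := leqP k m; first by rewrite big_geq // normr0 mulr_ge0 // mulr_ge0.
have -> : \sum_(m <= i < k) f (b * i%:R) = \sum_(0 <= i < k) f (b * i%:R) - \sum_(0 <= i < m) f (b * i%:R).
  by rewrite [X in _ = X - _](@big_cat_nat _ _ _ m) ?(ltnW mk) //= [X in X - _]addrC addrK.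
by apply: le_trans (ler_normB _ _) _; rewrite mulr2n mulrDl mul1r lerD.
Qed.

Lemma periodic_tail f b (B : R) m n : admissible f -> (forall a, `|f a| <= B) -> (0 < m)%N ->
  `|\sum_(m <= i < n) f (b * i%:R) / i%:R| <= 2 * (w.+2%:R * B) / m%:R.
Proof.
move=> hf fB m0; apply: (@abel_le (fun i => f (b * i%:R)) (fun i => i%:R^-1)).
- by move=> k; apply: periodic_partial.
- move=> i mi; have i0 := leq_trans m0 mi; rewrite invr_ge0 ler0n /=.
  by rewrite lef_pV2 ?posrE ?ltr0n // ler_nat.
- by rewrite invr_ge0.
Qed.

Lemma periodic_log f b (B : R) X : admissible f -> (forall a, `|f a| <= B) ->
  `|\sum_(1 <= i < X.+1) f (b * i%:R) * (L i / i%:R)| <= 3 * B + 2 * (w.+2%:R * B) * (L 4 / 4).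
Proof.
move=> hf fB; have B0 : 0 <= B by apply: le_trans (fB 0).
have term i : `|f (b * i%:R) * (L i / i%:R)| <= B.
  rewrite normrM -[leRHS]mulr1 ler_pM // ger0_norm ?divr_ge0 ?log_nat_ge0 //.
  case: i => [|i]; first by rewrite invr0 mulr0.
  by rewrite ler_pdivrMr ?ltr0n // mul1r log_nat_lt.
have c0 : 0 <= 2 * (w.+2%:R * B) * (L 4 / 4) by rewrite mulr_ge0 ?divr_ge0 ?log_nat_ge0 // mulr_ge0 // mulr_ge0.
have head n : (n <= 4)%N -> `|\sum_(1 <= i < n) f (b * i%:R) * (L i / i%:R)| <= 3 * B.
  move=> n4; apply: le_trans (ler_norm_sum _ _ _) _; apply: le_trans (_ : \sum_(1 <= i < n) B <= _).
    by apply: ler_sum => i _.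
  by rewrite sumr_const_nat -[leLHS]mulr_natl ler_wpM2r // ler_nat; case: n n4 => // n; rewrite subn1.
have [X2|X2] := leqP X 3.
  by apply: le_trans (head _ _) _; rewrite ?lerDl.
rewrite (@big_cat_nat _ _ _ 4) //=; last exact: ltnW.
apply: le_trans (ler_normD _ _) _; apply: lerD; first exact: head.
apply: (@abel_le (fun i => f (b * i%:R)) (fun i => L i / i%:R)).
- by move=> k; apply: periodic_partial.
- move=> i i3; have i0 : (0 < i)%N by apply: leq_trans i3.
  rewrite divr_ge0 ?log_nat_ge0 //= ler_pdivrMr ?ltr0n // mulrAC ler_pdivlMr ?ltr0n //.
  have st := @log_step_le R i i0; have Li : 1 <= L i by apply: (@log_ge1 R).
  have iR : 0 < i%:R :> R by rewrite ltr0n.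
  have := ler_wpM2l (ltW iR) st; rewrite divff ?gt_eqF // -natr1; nra.
- by rewrite divr_ge0 ?log_nat_ge0.
Qed.

(** The limit is the supremum of the lower bounds [u m - C / m], all of which lie below all the
    upper bounds [u m + C / m]. *)
Lemma limit_rate (u : nat -> R) (C : R) : 0 <= C -> (forall m n, (0 < m <= n)%N -> `|u n - u m| <= C / m%:R) ->
  exists l, forall m, (0 < m)%N -> `|u m - l| <= C / m%:R.
Proof.
move=> C0 h; pose E : set R := [set x | exists2 m, (0 < m)%N & x = u m - C / m%:R]%classic.
have Cm m : 0 <= C / m%:R by rewrite divr_ge0.
have le_uv m n : (0 < m)%N -> (0 < n)%N -> u n - C / n%:R <= u m + C / m%:R.
  move=> m0 n0; have [mn|nm] := leqP m n.
    have := h m n; rewrite m0 mn => /(_ isT); rewrite ler_norml => /andP[_]; have := Cm n; lra.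
  have := h n m; rewrite n0 (ltnW nm) => /(_ isT); rewrite ler_norml => /andP[+ _]; have := Cm m; lra.
have ubE m : (0 < m)%N -> ubound E (u m + C / m%:R) by move=> m0 x [n n0 ->]; apply: le_uv.
have E0 : (E !=set0)%classic by exists (u 1%N - C / 1%:R), 1%N.
exists (sup E) => m m0; rewrite ler_norml; apply/andP; split.
  by have := ge_sup E0 (ubE m m0); lra.
have : u m - C / m%:R <= sup E; last by lra.
by apply: ub_le_sup; [exists (u 1%N + C / 1%:R); apply: ubE|exists m].
Qed.

Definition unit_count : R := #|[set a : Z | a \is a GRing.unit]|%:R.

(** The class of [c] with its mean over the units removed. For units [c] these functions span the
    admissible ones. *)
Definition unit_delta (c a : Z) : R :=
  if a \is a GRing.unit then ((a == c) : nat)%:R - unit_count^-1 else 0.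

Lemma unit_count_gt0 : 0 < unit_count.
Proof. by rewrite ltr0n; apply/card_gt0P; exists 1; rewrite inE unitr1. Qed.

Lemma sum_units : \sum_(a : Z | a \is a GRing.unit) 1 = unit_count.
Proof. by rewrite sumr_const /unit_count cardsE. Qed.

Lemma unit_delta_adm c : c \is a GRing.unit -> admissible (unit_delta c).
Proof.
move=> uc; split=> [a na|]; first by rewrite /unit_delta (negbTE na).
rewrite /unit_delta -big_mkcond /= big_split /= sumrN.
have -> : \sum_(a : Z | a \is a GRing.unit) unit_count^-1 = 1.
  rewrite -[RHS](@mulfV _ unit_count) ?gt_eqF ?unit_count_gt0 // -sum_units mulr_suml.
  by apply: eq_bigr => a _; rewrite mul1r.
by rewrite (bigD1 c) //= eqxx big1 ?addr0 ?subrr // => a /andP[_ /negbTE ->].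
Qed.

Lemma unit_delta_le c a : `|unit_delta c a| <= 1.
Proof.
have c1 : 1 <= unit_count by have := unit_count_gt0; rewrite /unit_count ltr0n ler1n.
have c01 : 0 <= unit_count^-1 <= 1 by rewrite invr_ge0 invf_le1 ?unit_count_gt0 // c1 ltW ?unit_count_gt0.
by rewrite /unit_delta; case: ifP => _; rewrite ?normr0 // ler_norml; case: eqP => _ /=; lra.
Qed.

(* [ell c] is the value at [1] of the Dirichlet series with coefficients [unit_delta c]. *)
Lemma ell_exists : exists (ell : Z -> R) (C : R), 0 <= C /\ forall f (B : R) b X, admissible f -> (forall a, `|f a| <= B) ->
  `|\sum_(1 <= i < X.+1) f (b * i%:R) / i%:R - \sum_(c | c \is a GRing.unit) ell c * f (b * c)| <= C * B / X.+1%:R.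
Proof.
pose C0 : R := 2 * (w.+2%:R * 1).
have C00 : 0 <= C0 by rewrite /C0 mulr_ge0 // mulr_ge0.
have ex c : exists l, c \is a GRing.unit -> forall m, (0 < m)%N ->
    `|\sum_(1 <= i < m) unit_delta c i%:R / i%:R - l| <= C0 / m%:R.
  have [uc|nc] := boolP (c \is a GRing.unit); last by exists 0.
  have [|l hl] := @limit_rate (fun m => \sum_(1 <= i < m) unit_delta c i%:R / i%:R) C0 C00; last by exists l.
  move=> m n /andP[m0 mn]; rewrite (@big_cat_nat _ _ _ m 1 n) //= addrAC subrr add0r.
  have := @periodic_tail (unit_delta c) 1 1 m n (unit_delta_adm uc) (unit_delta_le c) m0.
  have -> // : \sum_(m <= i < n) unit_delta c (1 * i%:R) / i%:R = \sum_(m <= i < n) unit_delta c i%:R / i%:R.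
  by apply: eq_bigr => i _; congr (unit_delta c _ / _); apply: mul1r.
have [ell hell] := choice ex.
exists ell, (unit_count * C0); split; first by rewrite mulr_ge0 // ltW ?unit_count_gt0.
move=> f B b X hf fB.
have fe i : f (b * i%:R) = \sum_(c | c \is a GRing.unit) f (b * c) * unit_delta c i%:R.
  have [ui|ni] := boolP ((i%:R : Z) \is a GRing.unit); last first.
    rewrite hf.1; last by rewrite unitrM negb_and ni orbT.
    by rewrite big1 // => c _; rewrite /unit_delta (negbTE ni) mulr0.
  rewrite /unit_delta ui; under eq_bigr do rewrite mulrBr.
  rewrite sumrB -mulr_suml (_ : \sum_(c | c \is a GRing.unit) f (b * c) = 0) ?mul0r ?subr0.
    by rewrite (bigD1 i%:R) //= eqxx mulr1 big1 ?addr0 // => c /andP[_ h]; rewrite eq_sym (negbTE h) mulr0.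
  rewrite -[RHS](@admissibleM f b hf) [RHS](bigID (fun c => c \is a GRing.unit)) /= [X in _ = _ + X]big1 ?addr0 //.
  by move=> c nc; rewrite hf.1 // unitrM negb_and nc orbT.
have -> : \sum_(1 <= i < X.+1) f (b * i%:R) / i%:R - \sum_(c | c \is a GRing.unit) ell c * f (b * c) =
  \sum_(c | c \is a GRing.unit) f (b * c) * (\sum_(1 <= i < X.+1) unit_delta c i%:R / i%:R - ell c).
  under eq_bigr do rewrite fe mulr_suml.
  rewrite exchange_big /= -sumrB; apply: eq_bigr => c _.
  rewrite mulrBr [ell c * _]mulrC mulr_sumr; congr (_ - _); apply: eq_bigr => i _; by rewrite mulrA.
apply: le_trans (ler_norm_sum _ _ _) _.
apply: le_trans (_ : \sum_(c : Z | c \is a GRing.unit) 1 * (B * (C0 / X.+1%:R)) <= _).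
  by apply: ler_sum => c uc; rewrite mul1r normrM ler_pM // hell.
by rewrite -mulr_suml sum_units le_eqVlt; apply/orP; left; apply/eqP; ring.
Qed.

End Periodic.

(** * Sums of the von Mangoldt function against kernel and image *)

Section Characters.
Context {R : realType} (w : nat).
Local Notation L := (@log_nat R).
Local Notation Z := 'I_w.+2.
Implicit Types (f g : Z -> R).

(** For the [ell] of [ell_exists] this is the sum of [f (b n) / n] over all [n >= 1]. As a function
    of [b] it is a convolution over the group of units, a real substitute for the values
    [L (1, chi)] of all nontrivial characters at once. *)
Definition Lseries (ell : Z -> R) f b := \sum_(c | c \is a GRing.unit) ell c * f (b * c).

Context (ell : Z -> R) (C : R).
Context (C0 : 0 <= C) (ellP : forall f (B : R) b X, admissible f -> (forall a, `|f a| <= B) ->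
  `|\sum_(1 <= i < X.+1) f (b * i%:R) / i%:R - Lseries ell f b| <= C * B / X.+1%:R).

Lemma truncated_error f (B : R) b d X : admissible f -> (forall a, `|f a| <= B) -> (0 < d <= X)%N ->
  `|\sum_(1 <= m < (X %/ d).+1) f (b * (d * m)%:R) / (d * m)%:R - Lseries ell f (b * d%:R) / d%:R| <= C * B / X%:R.
Proof.
move=> hf fB /andP[d0 dX]; have B0 : 0 <= B by apply: le_trans (fB 0).
have dR : 0 < d%:R :> R by rewrite ltr0n.
have XR : 0 < X%:R :> R by rewrite ltr0n (leq_trans d0).
have -> : \sum_(1 <= m < (X %/ d).+1) f (b * (d * m)%:R) / (d * m)%:R =
   d%:R^-1 * \sum_(1 <= m < (X %/ d).+1) f (b * d%:R * m%:R) / m%:R.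
  rewrite mulr_sumr; apply: eq_bigr => m _; rewrite !natrM mulrA invfM; ring.
rewrite [Lseries _ _ _ / _]mulrC -mulrBr normrM ger0_norm ?invr_ge0 //.
apply: le_trans (ler_wpM2l _ (ellP _ _ hf fB)) _; first by rewrite invr_ge0.
rewrite mulrCA ler_wpM2l ?mulr_ge0 // -invfM lef_pV2 ?posrE ?mulr_gt0 ?ltr0n //.
  by rewrite -natrM ler_nat mulnC ltnW // ltn_ceil.
exact: leq_trans dX.
Qed.

(** Convolving the von Mangoldt function with [1] gives [log], so the sum turns into that of
    [g (b n) log n / n], bounded by partial summation. Chebyshev's bound controls the truncation of
    the inner sums. *)
Lemma image_part g (B : R) b X : admissible g -> (forall a, `|g a| <= B) -> (0 < X)%N ->
  `|\sum_(1 <= d < X.+1) mangoldt d / d%:R * Lseries ell g (b * d%:R)| <=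
  3 * B + 2 * (w.+2%:R * B) * (L 4 / 4) + 5 * (C * B).
Proof.
move=> hg gB X0; have B0 : 0 <= B by apply: le_trans (gB 0).
have XR : 0 < X%:R :> R by rewrite ltr0n.
have e1 := @sum_divisors_exchange R mangoldt (fun n => g (b * n%:R) / n%:R) X.
have e2 : \sum_(1 <= n < X.+1) (\sum_(1 <= d < X.+1 | (d %| n)%N) mangoldt d) * (g (b * n%:R) / n%:R) =
    \sum_(1 <= n < X.+1) g (b * n%:R) * (L n / n%:R).
  by rewrite big_nat [RHS]big_nat; apply: eq_bigr => n /andP[n1 nX]; rewrite mangoldt_dvd_sum ?n1 //; ring.
have -> : \sum_(1 <= d < X.+1) mangoldt d / d%:R * Lseries ell g (b * d%:R) =
  \sum_(1 <= n < X.+1) g (b * n%:R) * (L n / n%:R) - \sum_(1 <= d < X.+1) mangoldt d *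
   (\sum_(1 <= m < (X %/ d).+1) g (b * (d * m)%:R) / (d * m)%:R - Lseries ell g (b * d%:R) / d%:R).
  rewrite -e2 e1 -sumrB; apply: eq_bigr => d _; ring.
apply: le_trans (ler_normB _ _) _; apply: lerD; first exact: periodic_log.
apply: le_trans (ler_norm_sum _ _ _) _.
apply: le_trans (_ : \sum_(1 <= d < X.+1) mangoldt d * (C * B / X%:R) <= _).
  rewrite big_nat [leRHS]big_nat; apply: ler_sum => d /andP[d1 dX].
  by rewrite normrM ger0_norm ?mangoldt_ge0 // ler_wpM2l ?mangoldt_ge0 // truncated_error // d1.
rewrite -mulr_suml; apply: le_trans (ler_wpM2r _ (psi_le X)) _; first by rewrite divr_ge0 // mulr_ge0.
by rewrite le_eqVlt; apply/orP; left; apply/eqP; field; rewrite gt_eqF.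
Qed.

Lemma sum_log_fact X : \sum_(1 <= d < X.+1) L d = L X`!.
Proof.
elim: X => [|n IH]; first by rewrite big_geq // /log_nat ln1.
by rewrite big_nat_recr //= IH factS log_natM ?fact_gt0 // addrC.
Qed.

(** The function [mu d (log X - log d)] convolved with [1] is the von Mangoldt function, plus
    [log X] at [n = 1]. The inner sums are of order [1 / X], since their limits vanish, and the
    weights [log X - log d] add up to at most [X], so the total stays bounded. *)
Lemma kernel_part f (B : R) b X : admissible f -> (forall a, `|f a| <= B) -> (forall a, Lseries ell f a = 0) -> (0 < X)%N ->
  `|\sum_(1 <= n < X.+1) mangoldt n / n%:R * f (b * n%:R) + f b * L X| <= C * B.
Proof.
move=> hf fB ker X0; have B0 : 0 <= B by apply: le_trans (fB 0).
have XR : 0 < X%:R :> R by rewrite ltr0n.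
have e1 := @sum_divisors_exchange R (fun d => mu d * (L X - L d)) (fun n => f (b * n%:R) / n%:R) X.
have e2 : \sum_(1 <= n < X.+1) (\sum_(1 <= d < X.+1 | (d %| n)%N) mu d * (L X - L d)) * (f (b * n%:R) / n%:R) =
    \sum_(1 <= n < X.+1) mangoldt n / n%:R * f (b * n%:R) + f b * L X.
  transitivity (\sum_(1 <= n < X.+1) (mangoldt n / n%:R * f (b * n%:R) + (if n == 1%N then f b * L X else 0))).
    rewrite big_nat [RHS]big_nat; apply: eq_bigr => n /andP[n1 nX].
    under eq_bigr do rewrite mulrBr.
    rewrite sumrB -mulr_suml mu_sum ?n1 // mu_log_sum ?n1 //.
    case: eqP => [->|_] /=; last by ring.
    by rewrite mulr1 invr1; ring.
  by rewrite big_split /= -big_mkcond /= big_nat1_eq /= ltnS X0.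
rewrite -e2 e1; apply: le_trans (ler_norm_sum _ _ _) _.
apply: le_trans (_ : \sum_(1 <= d < X.+1) (L X - L d) * (C * B / X%:R) <= _).
  rewrite big_nat [leRHS]big_nat; apply: ler_sum => d /andP[d1 dX].
  have h0 : 0 <= L X - L d by rewrite subr_ge0 log_nat_le.
  rewrite !normrM (ger0_norm h0); have := @truncated_error f B b d X hf fB; rewrite d1 -ltnS dX ker mul0r subr0.
  move=> /(_ isT) h; rewrite -[leRHS]mul1r -mulrA ler_pM // ?mulr_ge0 //; last by rewrite ler_wpM2l.
  by rewrite /mu; case: ifP => _; rewrite ?normr0 // norm_mob.
rewrite -mulr_suml sumrB sumr_const_nat subSS subn0.
rewrite sum_log_fact -[_ *+ X]mulr_natl; apply: le_trans (_ : X%:R * (C * B / X%:R) <= _).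
  rewrite ler_wpM2r ?divr_ge0 ?mulr_ge0 //; have := @log_fact_ge R X; lra.
by rewrite le_eqVlt; apply/orP; left; apply/eqP; field; rewrite gt_eqF.
Qed.

Lemma mangoldt_le X : (0 < X)%N -> \sum_(1 <= n < X.+1) mangoldt n / n%:R <= L X + 5.
Proof.
move=> X0; have n1 : forall n : nat, `|1 : R| <= 1 by rewrite normr1.
have := @mangoldt_primes R X (fun=> 1) 1 n1; under eq_bigr do rewrite mulr1.
under [X in _ - X]eq_bigr do rewrite mulr1.
rewrite ler_norml => /andP[_]; have := @mertens_le R X X0.
by clear; move: (L X) (\sum_(_ <= _ < _) _) (\sum_(_ <= _ < _ | _) _) => a b c; lra.
Qed.

Lemma mangoldt_ge X : (0 < X)%N -> L X - 1 <= \sum_(1 <= n < X.+1) mangoldt n / n%:R.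
Proof.
move=> X0; have XR : 0 < X%:R :> R by rewrite ltr0n.
rewrite -(ler_pM2l XR) mulrBr mulr1; apply: le_trans (log_fact_ge X) _.
rewrite -sum_log_fact; have e := @sum_divisors_exchange R mangoldt (fun=> 1) X.
have -> : \sum_(1 <= d < X.+1) L d = \sum_(1 <= n < X.+1) (\sum_(1 <= d < X.+1 | (d %| n)%N) mangoldt d) * 1 :> R.
  by rewrite big_nat [RHS]big_nat; apply: eq_bigr => n hn; rewrite mulr1 mangoldt_dvd_sum.
rewrite e mulr_sumr; apply: ler_sum => d _.
rewrite sumr_const_nat subSS subn0 mulrCA ler_wpM2l ?mangoldt_ge0 //.
by rewrite -[leLHS]/((X %/ d)%:R) natr_div_le.
Qed.

Lemma unit_natE n : ((n%:R : Z) \is a GRing.unit) = coprime w.+2 n.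
Proof. exact: (@unitZpE w.+2 n isT). Qed.

Lemma nonunit_lam_le X : `|\sum_(1 <= n < X.+1) mangoldt n / n%:R * (((n%:R : Z) \isn't a GRing.unit) : nat)%:R| <= L w.+2 + 5.
Proof.
set F := fun n => (((n%:R : Z) \isn't a GRing.unit) : nat)%:R : R.
have F1 n : `|F n| <= 1 by rewrite /F; case: (_ \is a _); rewrite ?normr0 ?normr1.
have h := @mangoldt_primes R X F 1 F1.
have hp : `|\sum_(0 <= p < X.+1 | prime p) L p / p%:R * F p| <= L w.+2 + 3.
  apply: le_trans (@mertens_le R w.+2 isT); rewrite ger0_norm; last first.
    by apply: sumr_ge0 => p _; rewrite mulr_ge0 ?divr_ge0 ?log_nat_ge0.
  apply: le_trans (_ : \sum_(0 <= p < (X + w.+2).+1 | prime p) L p / p%:R * F p <= _).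
    rewrite [leRHS](@big_cat_nat _ _ _ X.+1) ?ltnS ?leq_addr //= lerDl.
    by apply: sumr_ge0 => p _; rewrite mulr_ge0 ?divr_ge0 ?log_nat_ge0.
  rewrite [leRHS](big_nat_widen _ _ (X + w.+2).+1) ?ltnS ?leq_addl //.
  rewrite big_mkcond [leRHS]big_mkcond; apply: ler_sum => p _; case pp: (prime p) => //=.
  rewrite /F unit_natE; case cp: (coprime w.+2 p) => /=.
    by rewrite mulr0; case: ifP => // _; rewrite divr_ge0 ?log_nat_ge0.
  rewrite coprime_sym prime_coprime // in cp; move/negbFE: cp => pw.
  by rewrite ltnS (dvdn_leq _ pw) // mulr1.
set A := \sum_(_ <= _ < _) _ in h *; set B := \sum_(_ <= _ < _ | _) _ in h hp.
have -> : A = (A - B) + B by rewrite subrK.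
by apply: le_trans (ler_normD _ _) _; lra.
Qed.

End Characters.

(** * The convolution operator as a normal matrix *)

Section Spectral.
Context {R : realType} (w : nat).
Local Notation Z := 'I_w.+2.
Implicit Types (f g : Z -> R).

Definition group_mx (l : Z -> R) : 'M[R]_w.+2 :=
  \matrix_(j, i) (if (i \is a GRing.unit) && (j \is a GRing.unit) then l (i^-1 * j) else 0).

Lemma group_mxE l (u : 'rV[R]_w.+2) (i : Z) : i \is a GRing.unit ->
  (u *m group_mx l) ord0 i = \sum_(c : Z | c \is a GRing.unit) l c * u ord0 (i * c).
Proof.
move=> ui; rewrite mxE.
rewrite (reindex_inj (mulrI ui)) [RHS]big_mkcond; apply: eq_bigr => c _; rewrite mxE ui unitrM ui /=.
by case: ifP => _; rewrite ?mulr0 // mulKr // mulrC.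
Qed.

(** The matrix and its transpose act by convolution over a commutative group, hence commute; the
    substitution of [i k / j] for [j] exchanges the two sums. *)
Lemma group_mx_normal l : (group_mx l)^T *m group_mx l = group_mx l *m (group_mx l)^T.
Proof.
apply/matrixP => i k; rewrite !mxE.
have [ui|ni] := boolP ((i : Z) \is a GRing.unit); last first.
  by rewrite !big1 // => j _; rewrite !mxE (negbTE ni) ?andbF ?mul0r.
have [uk|nk] := boolP ((k : Z) \is a GRing.unit); last first.
  by rewrite !big1 // => j _; rewrite !mxE (negbTE nk) ?andbF ?mulr0.
rewrite (bigID (fun j : Z => j \is a GRing.unit)) /= [X in _ + X]big1 ?addr0; last first.
  by move=> j nj; rewrite !mxE (negbTE nj) andbF mul0r.
rewrite [RHS](bigID (fun j : Z => j \is a GRing.unit)) /= [X in _ = _ + X]big1 ?addr0; last first.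
  by move=> j nj; rewrite !mxE (negbTE nj) mul0r.
have uik : (i * k : Z) \is a GRing.unit by rewrite unitrM ui uk.
rewrite [RHS](reindex_onto (fun j : Z => i * k * j^-1) (fun j : Z => i * k * j^-1)) /=; last first.
  by move=> j uj; rewrite invrM ?unitrV // invrK mulrCA divrr ?mulr1.
apply: eq_big => [j|j uj].
  case uj: ((j : Z) \is a GRing.unit) => /=.
    by rewrite unitrM uik unitrV uj /= invrM ?unitrV // invrK mulrCA divrr ?mulr1 // eqxx.
  by rewrite unitrM unitrV uj andbF.
rewrite !mxE ui uk uj /= unitrM uik unitrV uj /=.
have uu : (i * k * j^-1 : Z) \is a GRing.unit by rewrite unitrM uik unitrV.
have e1 : (i * k * j^-1 : Z)^-1 * i = k^-1 * j.
  apply: (mulrI uu); rewrite mulVKr //; transitivity (i * (k * k^-1) * (j^-1 * j) : Z); last by ring.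
  by rewrite divrr // mulVr // !mulr1.
have e2 : (i * k * j^-1 : Z)^-1 * k = i^-1 * j.
  apply: (mulrI uu); rewrite mulVKr //; transitivity (k * (i * i^-1) * (j^-1 * j) : Z); last by ring.
  by rewrite divrr // mulVr // !mulr1.
by rewrite e1 e2 mulrC.
Qed.

(* For normal [A] the whole space is the orthogonal sum of the kernel and the image of [A]. *)
Lemma normal_split n (A : 'M[R]_n) (v : 'rV[R]_n) : A^T *m A = A *m A^T ->
  exists u x : 'rV[R]_n, [/\ v = u + x *m A, u *m A = 0 & forall h : 'rV[R]_n, h *m A = 0 -> v *m h^T = u *m h^T].
Proof.
move=> nA.
have sq0 (u : 'rV[R]_n) : u *m u^T = 0 -> u = 0.
  move=> h; apply/rowP => i; rewrite mxE; move/matrixP: h => /(_ ord0 ord0); rewrite !mxE => /eqP.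
  rewrite psumr_eq0 => [/allP /(_ i)|j _]; last by rewrite mxE -expr2 sqr_ge0.
  by rewrite mem_index_enum mxE mulf_eq0 orbb => /(_ isT) /eqP.
have ker (u : 'rV[R]_n) : u *m A = 0 -> u *m A^T = 0.
  move=> uA; apply: sq0; rewrite trmx_mul trmxK mulmxA -(mulmxA u) nA mulmxA uA.
  by rewrite !mul0mx.
have cap0 : (kermx A :&: A)%MS = 0.
  apply/eqP/rowV0P => u; rewrite sub_capmx => /andP[/sub_kermxP uA /submxP[x xE]].
  apply: sq0; rewrite {1}xE -mulmxA -[A *m _]trmxK trmx_mul trmxK ker // trmx0.
  by rewrite mulmx0.
have full : row_full (kermx A + A)%MS.
  rewrite /row_full; have := mxrank_sum_cap (kermx A) A; rewrite cap0 mxrank0 addn0 mxrank_ker => ->.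
  by rewrite subnK // rank_leq_row.
have /sub_addsmxP[[u x] /= vE] := submx_full v full.
exists (u *m kermx A), x; split=> [//||h hA]; first by rewrite -mulmxA mulmx_ker mulmx0.
rewrite vE mulmxDl -[x *m A *m _]mulmxA -[A *m h^T]trmxK trmx_mul trmxK ker // trmx0.
by rewrite mulmx0 addr0.
Qed.

(* [f] is the orthogonal projection of [unit_delta 1] onto a translation-invariant
   space, hence its reproducing kernel: this is the last clause. *)
Lemma spectral_split l : \sum_(c : Z | c \is a GRing.unit) l c = 1 ->
  exists f g : Z -> R, [/\ admissible f, admissible g,
   (forall a : Z, a \is a GRing.unit -> unit_delta 1 a = f a + Lseries l g a),
   (forall a : Z, a \is a GRing.unit -> Lseries l f a = 0) &
   forall a : Z, a \is a GRing.unit -> f a = \sum_(b : Z | b \is a GRing.unit) f b * f (a * b)].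
Proof.
move=> l1; pose A := group_mx l; pose v : 'rV[R]_w.+2 := \row_i unit_delta 1 i.
have [u [x [vE uA rep]]] := normal_split v (group_mx_normal l).
have An (y : 'rV[R]_w.+2) (i : Z) : i \isn't a GRing.unit -> (y *m group_mx l) ord0 i = 0.
  by move=> ni; rewrite mxE big1 // => j _; rewrite mxE (negbTE ni) mulr0.
have u0 (a : Z) : a \isn't a GRing.unit -> u ord0 a = 0.
  move=> na; have := congr1 (fun m : 'rV[R]_w.+2 => m ord0 a) vE; rewrite !mxE.
  have := An x a na; rewrite mxE => ->; rewrite addr0 => <-.
  by rewrite /unit_delta (negbTE na).
(* As [l] has sum [1], the operator preserves sums. So [f] has sum zero because it is annihilated,
   and [g] because [unit_delta 1] and [f] both have sum zero. *)
have mean (h : Z -> R) : (forall a : Z, a \isn't a GRing.unit -> h a = 0) ->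
    \sum_(a : Z | a \is a GRing.unit) Lseries l h a = \sum_a h a.
  move=> h0; rewrite /Lseries exchange_big /=.
  transitivity (\sum_(c : Z | c \is a GRing.unit) l c * \sum_a h a); last by rewrite -mulr_suml l1 mul1r.
  apply: eq_bigr => c uc; rewrite -mulr_sumr; congr (_ * _).
  rewrite [RHS](reindex_inj (mulIr uc)) /= [RHS](bigID (fun a : Z => a \is a GRing.unit)) /=.
  by rewrite [X in _ = _ + X]big1 ?addr0 // => a na; rewrite h0 // unitrM negb_and na.
have Lu (a : Z) : a \is a GRing.unit -> Lseries l (fun a => u ord0 a) a = 0.
  by move=> ua; rewrite /Lseries -group_mxE // uA mxE.
have fs : \sum_a u ord0 a = 0 by rewrite -mean // big1.
have fadm : admissible (fun a => u ord0 a) by [].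
pose g (a : Z) : R := if a \is a GRing.unit then x ord0 a else 0.
have g0 (a : Z) : a \isn't a GRing.unit -> g a = 0 by move=> na; rewrite /g (negbTE na).
have split_ (a : Z) : a \is a GRing.unit -> unit_delta 1 a = u ord0 a + Lseries l g a.
  move=> ua; have := congr1 (fun m : 'rV[R]_w.+2 => m ord0 a) vE; rewrite [LHS]mxE [RHS]mxE => ->.
  rewrite group_mxE //; congr (_ + _); apply: eq_bigr => c uc.
  by rewrite /g unitrM ua uc.
have gs : \sum_a g a = 0.
  rewrite -mean //; transitivity (\sum_(a : Z | a \is a GRing.unit) (unit_delta 1 a - u ord0 a : R)).
    by apply: eq_bigr => a ua; rewrite split_ // addrC addKr.
  have un (h : Z -> R) : (forall a : Z, a \isn't a GRing.unit -> h a = 0) -> \sum_(a : Z | a \is a GRing.unit) h a = \sum_a h a.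
    by move=> h0; rewrite [RHS](bigID (fun a : Z => a \is a GRing.unit)) /= [X in _ = _ + X]big1 ?addr0.
  have [d0 ds] := @unit_delta_adm R w 1 (unitr1 _).
  by rewrite sumrB !un // ds fs subrr.
exists (fun a => u ord0 a), g; split=> // a ua.
(* The translate of [f] by [a] lies in the kernel too, so it has the same pairing with
   [unit_delta 1] as with [f]; the former pairing is [f a]. *)
pose h : 'rV[R]_w.+2 := \row_b u ord0 (a * b).
have hA : h *m group_mx l = 0.
  apply/rowP => i; rewrite [RHS]mxE; have [ui|ni] := boolP ((i : Z) \is a GRing.unit); last exact: An.
  rewrite group_mxE //; under eq_bigr do rewrite mxE mulrA.
  by rewrite -[LHS]/(Lseries l (fun a => u ord0 a) (a * i)) Lu // unitrM ua.
have key : \sum_(j : Z) v ord0 j * h ord0 j = \sum_(j : Z) u ord0 j * h ord0 j.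
  have := congr1 (fun m : 'M[R]_1 => m ord0 ord0) (rep h hA); rewrite mxE [RHS]mxE.
  have e (y : 'rV[R]_w.+2) : \sum_j y ord0 j * h^T j ord0 = \sum_j y ord0 j * h ord0 j.
    by apply: eq_bigr => j _; rewrite [h^T _ _]mxE.
  by rewrite !e.
transitivity (\sum_(j : Z) v ord0 j * h ord0 j); last first.
  rewrite key (bigID (fun j : Z => j \is a GRing.unit)) /= [X in _ + X]big1 ?addr0; last first.
    by move=> j nj; rewrite u0 // mul0r.
  by apply: eq_bigr => j _; rewrite mxE.
have ms : \sum_(j : Z) u ord0 (a * j) = 0 by apply: (@admissibleM R w (fun a => u ord0 a)).
transitivity (\sum_(j : Z) ((if j == 1 then u ord0 a else 0) - (unit_count w)^-1 * u ord0 (a * j)) : R).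
  by rewrite sumrB -mulr_sumr ms mulr0 subr0 -big_mkcond big_pred1_eq.
apply: eq_bigr => j _; rewrite !mxE /unit_delta; case uj: ((j : Z) \is a GRing.unit); last first.
  rewrite (u0 (a * j)) ?mulr0 ?mul0r ?subr0; last by rewrite unitrM negb_and uj orbT.
  by case: eqP => // j1; rewrite j1 unitr1 in uj.
by rewrite mulrBl; case: eqP => [->|_] /=; rewrite ?mulr1 ?mul1r ?mul0r.
Qed.

End Spectral.

(** * Nonvanishing for real characters *)

Section RealCharacters.
Context {R : realType} (w : nat).
Local Notation Z := 'I_w.+2.

(** Here [x] stands for the value of a real character at a prime [p], and the sum for its divisor
    sum at [p ^ j]. *)
Lemma geo_sign (x : R) j : x = 0 \/ x ^+ 2 = 1 ->
  0 <= \sum_(0 <= i < j.+1) x ^+ i /\ (~~ odd j -> 1 <= \sum_(0 <= i < j.+1) x ^+ i).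
Proof.
move=> [->|x2].
  have -> : \sum_(0 <= i < j.+1) (0 : R) ^+ i = 1 by rewrite big_nat_recl //= expr0 big1 ?addr0 // => i _; rewrite exprS mul0r.
  by split.
have x1 : x <= 1 /\ -1 <= x by split; nra.
have par j0 : (if odd j0 then 1 + x else 1) <= \sum_(0 <= i < j0.+1) x ^+ i.
  elim: j0 => [|j0 IH]; first by rewrite big_nat1.
  rewrite big_nat_recr //=; have e : x ^+ j0.+1 = if odd j0 then 1 else x.
    rewrite -[j0.+1]odd_double_half exprD /=; case: (odd j0) => /=.
      by rewrite expr0 mul1r -muln2 mulnC exprM x2 expr1n.
    by rewrite expr1 -muln2 mulnC exprM x2 expr1n mulr1.
  by rewrite e; move: IH; case: (odd j0) => /=; lra.
split; have := par j; last by case: (odd j).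
case: (odd j); lra.
Qed.

Lemma bernoulli_le (x : R) n : 0 <= x <= 1 -> 1 - n%:R * x <= (1 - x) ^+ n.
Proof.
move=> /andP[x0 x1]; elim: n => [|n IH]; first by rewrite mul0r subr0 expr0.
rewrite exprS; apply: le_trans (ler_wpM2l _ IH); last by lra.
by rewrite -natr1; have : 0 <= n%:R :> R by []; move: (n%:R : R) => c c0; nra.
Qed.

Section Lambert.
Context (q : R) (q01 : 0 < q < 1).
Local Notation t := (q ^+ 2).
Local Notation S n := (\sum_(0 <= i < n) t ^+ i).

(** AM-GM for the pairs [t ^ i], [t ^ (n - i)]. The variable [t] is written as a square so that the
    geometric mean [t ^ (n / 2)] is the polynomial [q ^ n]. *)
Lemma geo_ge n : n.+1%:R * q ^+ n <= S n.+1.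
Proof.
have /andP[q0 q1] := q01.
suff : n.+1%:R * q ^+ n <= S n.+1 /\ n.+2%:R * q ^+ n.+1 <= S n.+2 by case.
elim: n => [|n [IH1 IH2]].
  rewrite !big_nat_recr ?big_geq //= !expr0 !expr1 !add0r !mulr1; split=> //.
  have := sqr_ge0 (1 - q); rewrite sqrrB expr1n mul1r; lra.
split=> //; rewrite [leRHS]big_nat_recr // big_nat_recl //=.
have -> : \sum_(0 <= i < n.+1) t ^+ i.+1 = t * S n.+1.
  by rewrite mulr_sumr; apply: eq_bigr => i _; rewrite exprS.
have := ler_wpM2l (sqr_ge0 q) IH1; have := sqr_ge0 (1 - q ^+ n.+2).
have -> : t ^+ n.+2 = (q ^+ n.+2) ^+ 2 by rewrite -!exprM mulnC.
have -> : q ^+ n.+2 = t * q ^+ n by rewrite -exprD.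
move: (q ^+ n) => c; rewrite expr0 -[n.+3%:R]natr1 -[n.+2%:R]natr1; move: (n.+1%:R : R) (q ^+ 2) (S n.+1) => v e s; lra.
Qed.

Lemma geo_closed n : 1 - t ^+ n = (1 - t) * S n.
Proof.
elim: n => [|n IH]; first by rewrite big_geq // mulr0 expr0 subrr.
by rewrite big_nat_recr //= mulrDr -IH exprS; ring.
Qed.

(** The defect between [1 / (n (1 - t))], which brings in the value at [1], and the Lambert term
    [t ^ n / (1 - t ^ n)]. It decreases in [n] from the value [1], so partial summation bounds its
    sum against a character uniformly in [t]. *)
Definition lambert_gap n := n%:R^-1 / (1 - t) - t ^+ n / (1 - t ^+ n).

Lemma lambert_base : 0 < t < 1 /\ forall n, 0 < S n.+1.
Proof.
have /andP[q0 q1] := q01; have t0 : 0 < t by rewrite exprn_gt0.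
split; first by rewrite t0 exprn_ilt1 // ltW.
by move=> n; apply: lt_le_trans (geo_ge n); rewrite mulr_gt0 ?ltr0n // exprn_gt0.
Qed.

Lemma lambert_gapE n : lambert_gap n.+1 = (n.+1%:R^-1 - t ^+ n.+1 / S n.+1) / (1 - t).
Proof.
have [/andP[t0 t1] S0] := lambert_base.
have n0 : n.+1%:R != 0 :> R by rewrite pnatr_eq0.
have s0 : S n.+1 != 0 by rewrite gt_eqF.
have d0 : 1 - t != 0 by rewrite gt_eqF // subr_gt0.
rewrite /lambert_gap geo_closed; move: n0 s0 d0; move: (n.+1%:R : R) (S n.+1) (t ^+ n.+1) t => a b c d n0 s0 d0.
by field; rewrite n0 s0 d0.
Qed.

Lemma lambert_gap_decr n : (0 < n)%N -> 0 <= lambert_gap n.+1 <= lambert_gap n.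
Proof.
case: n => // n _; have [/andP[t0 t1] S0] := lambert_base; have /andP[q0 q1] := q01.
have d0 : 0 < (1 - t)^-1 by rewrite invr_gt0 subr_gt0.
rewrite !lambert_gapE; apply/andP; split.
  rewrite mulr_ge0 ?(ltW d0) // subr_ge0 ler_pdivrMr // ler_pdivlMl ?ltr0n //.
  apply: le_trans (geo_ge n.+1); rewrite ler_wpM2l // -exprM ler_wiXn2l ?(ltW q0) ?(ltW q1) //; lia.
rewrite ler_pM2r // -subr_ge0.
have e : S n.+2 = S n.+1 + t ^+ n.+1 by rewrite big_nat_recr.
have e1 : (1 - t) * S n.+1 = 1 - t ^+ n.+1 by rewrite geo_closed.
have gap : n.+1%:R * n.+2%:R * t ^+ n.+1 <= S n.+1 * S n.+2.
  apply: le_trans (_ : (n.+1%:R * q ^+ n) * (n.+2%:R * q ^+ n.+1) <= _); last first.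
    by apply: ler_pM; rewrite ?geo_ge ?mulr_ge0 ?exprn_ge0 // ltW.
  have -> : n.+1%:R * q ^+ n * (n.+2%:R * q ^+ n.+1) = n.+1%:R * n.+2%:R * (q ^+ n * q ^+ n.+1) by ring.
  rewrite ler_wpM2l ?mulr_ge0 // -exprD -exprM ler_wiXn2l ?(ltW q0) ?(ltW q1) //; lia.
have nR : 0 < n.+1%:R :> R by rewrite ltr0n.
have -> : n.+1%:R^-1 - t ^+ n.+1 / S n.+1 - (n.+2%:R^-1 - t ^+ n.+2 / S n.+2) =
   (S n.+1 * S n.+2 - n.+1%:R * n.+2%:R * t ^+ n.+1) / (n.+1%:R * n.+2%:R * (S n.+1 * S n.+2)).
  have tS : t ^+ n.+2 / S n.+2 = t ^+ n.+1 / S n.+1 - t ^+ n.+1 / (S n.+1 * S n.+2).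
    have h1 : S n.+1 != 0 by rewrite gt_eqF.
    have h2 : S n.+2 != 0 by rewrite gt_eqF.
    have -> : t ^+ n.+2 / S n.+2 = t * t ^+ n.+1 * S n.+1 / (S n.+1 * S n.+2).
      by rewrite exprS -[S n.+1 * S n.+2]mulrC -mulf_div divff // mulr1.
    have -> : t * t ^+ n.+1 * S n.+1 = t ^+ n.+1 * (S n.+2 - 1).
      have -> : t * t ^+ n.+1 * S n.+1 = t ^+ n.+1 * (S n.+1 - (1 - t) * S n.+1) by ring.
      by rewrite e1 e; congr (_ * _); ring.
    by move: h1 h2; move: (S n.+1) (S n.+2) (t ^+ n.+1) => a b c h1 h2; field; rewrite h1 h2.
  rewrite tS -[n.+2%:R]natr1; have h1 : S n.+1 != 0 by rewrite gt_eqF.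
  have h2 : S n.+2 != 0 by rewrite gt_eqF.
  move: nR h1 h2; move: (S n.+1) (S n.+2) (t ^+ n.+1) (n.+1%:R : R) => a b c v v0 h1 h2.
  by field; rewrite h1 h2 !gt_eqF //; lra.
rewrite divr_ge0 ?subr_ge0 //; apply: mulr_ge0; apply: mulr_ge0 => //; exact: ltW.
Qed.

Lemma lambert_gap1 : lambert_gap 1 = 1.
Proof.
have [/andP[t0 t1] _] := lambert_base; rewrite /lambert_gap invr1 expr1; move: t1; move: t => v v1.
by field; rewrite gt_eqF // subr_gt0.
Qed.

End Lambert.

(* A nontrivial real character has a nonzero L-value at [1]: with [r n] the sum of
   [chi d] over the divisors [d] of [n], the series of [r n * t ^ n] is at least the
   sum over squares, hence unbounded as [t] tends to [1], whereas as a Lambert series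
   it would be bounded if the L-value, given by [chiL], were zero. *)
Section VanishingRealCharacter.
Context (chi : Z -> R) (C : R).
Context (chiM : forall a b, chi (a * b) = chi a * chi b).
Context (chi0 : forall a, a \isn't a GRing.unit -> chi a = 0).
Context (chi1 : forall a, a \is a GRing.unit -> chi a ^+ 2 = 1).
Context (chis : \sum_a chi a = 0).
Context (chiL : forall X, `|\sum_(1 <= i < X.+1) chi i%:R / i%:R| <= C / X.+1%:R).
Local Notation X n := (chi (n%:R)).

Lemma chi_one : chi 1 = 1.
Proof.
have := chi1 (unitr1 _); have := chiM 1 1; rewrite mulr1 => e; rewrite expr2 -e => ->; by [].
Qed.

Lemma chi_exp p k : X (p ^ k) = X p ^+ k.
Proof.
elim: k => [|k IH]; first by rewrite expn0 expr0 chi_one.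
by rewrite expnS natrM chiM IH exprS.
Qed.

Lemma divisor_sum_pow p m k N : prime p -> ~~ (p %| m)%N -> (0 < m)%N -> (p ^ k * m <= N)%N ->
  \sum_(1 <= d < N.+1 | (d %| p ^ k * m)%N) X d =
  (\sum_(0 <= i < k.+1) X p ^+ i) * \sum_(1 <= d < N.+1 | (d %| m)%N) X d.
Proof.
move=> pp pm m0; have p0 := prime_gt0 pp; elim: k => [|k IH] hN.
  by rewrite big_nat1 expr0 mul1r expn0 mul1n.
have pk0 : (0 < p ^ k.+1)%N by rewrite expn_gt0 p0.
have hN' : (p ^ k * m <= N)%N by apply: leq_trans hN; rewrite leq_mul2r leq_exp2l ?prime_gt1 // leqnSn orbT.
rewrite big_nat_recr //= mulrDl -(IH hN') (bigID (fun d => (p ^ k.+1 %| d)%N)) /= addrC; congr (_ + _).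
  apply: eq_bigl => d; apply/andP/idP => [[dn nd]|dn].
    have d0 : (0 < d)%N by apply: dvdn_gt0 dn; rewrite muln_gt0 pk0.
    have [e ce dE] := pfactor_coprime pp d0; have lk : (logn p d <= k)%N by rewrite -ltnS ltnNge -pfactor_dvdn.
    rewrite dE mulnC dvdn_mul ?dvdn_exp2l //.
    have : (e %| p ^ k.+1 * m)%N by apply: dvdn_trans dn; rewrite dE dvdn_mulr.
    by rewrite Gauss_dvdr // coprimeXr // coprime_sym.
  split; first by apply: dvdn_trans dn _; rewrite dvdn_mul // dvdn_exp2l.
  apply: contra pm => h; have := dvdn_trans h dn.
  by rewrite expnSr dvdn_pmul2l // expn_gt0 p0.
rewrite (eq_bigl (fun d => (p ^ k.+1 %| d)%N && (d %| p ^ k.+1 * m)%N)); last by move=> d; rewrite andbC.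
rewrite big_mkcondr /= sum_multiples // mulr_sumr.
rewrite (big_nat_widen _ _ N.+1) ?ltnS ?leq_div // [LHS]big_mkcond [RHS]big_mkcond [LHS]big_nat [RHS]big_nat.
apply: eq_bigr => d /andP[d1 dN]; rewrite dvdn_pmul2l // ltnS leq_divRL //=.
case dm: (d %| m)%N; last by rewrite if_same.
rewrite (leq_trans _ hN); last by rewrite mulnC leq_mul2l dvdn_leq ?orbT.
by rewrite natrM chiM chi_exp.
Qed.

Lemma chi_sign a : chi a = 0 \/ chi a ^+ 2 = 1.
Proof. by have [ua|na] := boolP (a \is a GRing.unit); [right; apply: chi1|left; apply: chi0]. Qed.

Lemma divisor_sum_one N : (0 < N)%N -> \sum_(1 <= d < N.+1 | (d %| 1)%N) X d = 1.
Proof.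
move=> N0; rewrite (eq_bigl (fun d => d == 1%N)); last by move=> d; rewrite dvdn1.
by rewrite big_nat1_eq /= ltnS N0 chi_one.
Qed.

Lemma divisor_sum_ge0 n N : (0 < n <= N)%N -> 0 <= \sum_(1 <= d < N.+1 | (d %| n)%N) X d.
Proof.
have [b] := ubnP n; elim: b n => // b IH n; rewrite ltnS => nb /andP[n0 nN].
have [n1|n1] := leqP n 1.
  have -> : n = 1%N by apply/eqP; rewrite eqn_leq n1.
  by rewrite divisor_sum_one // (leq_trans n0).
have [p [m [pp pm m0 [k nE]]]] := pow_factor n1.
have mn : (m < n)%N by rewrite nE ltn_Pmull // -(expn0 p) ltn_exp2l ?prime_gt1.
rewrite {1}nE divisor_sum_pow -?nE // mulr_ge0 //; first by have [] := geo_sign k.+1 (chi_sign p%:R).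
by apply: IH; rewrite ?(leq_trans mn) // m0 (leq_trans (ltnW mn)).
Qed.

Lemma divisor_sum_square n N : (0 < n)%N -> (n ^ 2 <= N)%N -> 1 <= \sum_(1 <= d < N.+1 | (d %| n ^ 2)%N) X d.
Proof.
have [b] := ubnP n; elim: b n => // b IH n; rewrite ltnS => nb n0 nN.
have [n1|n1] := leqP n 1.
  have n1' : n = 1%N by apply/eqP; rewrite eqn_leq n1.
  by rewrite n1' exp1n divisor_sum_one // (leq_trans _ nN) // n1'.
have [p [m [pp pm m0 [k nE]]]] := pow_factor n1.
have mn : (m < n)%N by rewrite nE ltn_Pmull // -(expn0 p) ltn_exp2l ?prime_gt1.
have n2E : (n ^ 2 = p ^ (k.+1 * 2) * m ^ 2)%N by rewrite nE expnMn expnM.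
rewrite {1}n2E divisor_sum_pow -?n2E ?expn_gt0 ?m0 ?Euclid_dvdX ?(negbTE pm) //.
have [_ h] := geo_sign (k.+1 * 2) (chi_sign p%:R).
rewrite -[leLHS]mulr1 ler_pM // ?h ?oddM ?andbF // IH ?(leq_trans mn) //.
by apply: leq_trans nN; rewrite leq_exp2r // ltnW.
Qed.

Lemma chi_adm : admissible chi. Proof. by []. Qed.

Lemma chi_le1 a : `|chi a| <= 1.
Proof.
have [->|h] := chi_sign a; first by rewrite normr0.
by rewrite -(expr_le1 (n := 2)) // real_normK ?num_real // h.
Qed.

Lemma pow_decay (q : R) n : 0 < q < 1 -> (n%:R * (1 - q)) * q ^+ n <= 1.
Proof.
move=> /andP[q0 q1]; suff : (1 + n%:R * (1 - q)) * q ^+ n <= 1.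
  by apply: le_trans; rewrite ler_wpM2r ?exprn_ge0 ?(ltW q0) // lerDr.
elim: n => [|n IH]; first by rewrite mul0r addr0 expr0 mulr1.
apply: le_trans IH; rewrite exprS mulrA ler_wpM2r ?exprn_ge0 ?(ltW q0) //.
rewrite -natr1; have : 0 <= (n%:R + 1) * (1 - q) ^+ 2 by rewrite mulr_ge0 ?sqr_ge0 // addr_ge0.
by move: (n%:R : R) => c; lra.
Qed.

Definition theta_sum (q : R) N := \sum_(1 <= n < N.+1) (\sum_(1 <= d < N.+1 | (d %| n)%N) X d) * (q ^+ 2) ^+ n.

(** The three terms are the partial sum of the vanishing value at [1], the sum of [lambert_gap]
    against the character, and the truncation of the Lambert series. *)
Lemma theta_upper (q : R) N : 0 < q < 1 ->
  theta_sum q N <= C / N.+1%:R / (1 - q ^+ 2) + 2 * w.+2%:R + N%:R * (q ^+ 2) ^+ N / (1 - q ^+ 2).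
Proof.
move=> q01; have [/andP[t0 t1] _] := lambert_base q01; set t := q ^+ 2 in t0 t1 *.
have d0 : 0 < 1 - t by rewrite subr_gt0.
have td d : (0 < d)%N -> 1 - t <= 1 - t ^+ d.
  by move=> d1; rewrite lerD2l lerN2 -[leRHS]expr1 ler_wiXn2l // ltW.
have td0 d : (0 < d)%N -> 0 < 1 - t ^+ d by move=> d1; apply: lt_le_trans (td d d1).
have geo (v : R) M : v != 1 -> \sum_(1 <= m < M.+1) v ^+ m = v / (1 - v) - v ^+ M.+1 / (1 - v).
  move=> v1; have v1' : 1 - v != 0 by rewrite subr_eq0 eq_sym.
  elim: M => [|M IH]; first by rewrite big_geq // expr1 subrr.
  by rewrite big_nat_recr //= IH [v ^+ M.+2]exprS; field.
rewrite /theta_sum sum_divisors_exchange -/t.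
have gapE : \sum_(1 <= d < N.+1) X d * lambert_gap q d = (\sum_(1 <= d < N.+1) X d / d%:R) / (1 - t) -
    \sum_(1 <= d < N.+1) X d * (t ^+ d / (1 - t ^+ d)).
  rewrite mulr_suml -sumrB; apply: eq_bigr => d _; rewrite /lambert_gap -/t; ring.
have gap : `|\sum_(1 <= d < N.+1) X d * lambert_gap q d| <= 2 * w.+2%:R.
  have -> : \sum_(1 <= d < N.+1) X d * lambert_gap q d = \sum_(1 <= d < N.+1) chi (1 * d%:R) * lambert_gap q d.
    by apply: eq_bigr => d _; congr (chi _ * _); rewrite mul1r.
  apply: le_trans (@abel_le R (fun d => chi (1 * d%:R)) (lambert_gap q) (2 * (w.+2%:R * 1)) 1 N.+1 _ _ _) _.
  - by move=> k; apply: periodic_partial chi_adm chi_le1.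
  - by move=> d d1; apply: lambert_gap_decr.
  - by rewrite lambert_gap1.
  - by rewrite lambert_gap1 // !mulr1.
have main : (\sum_(1 <= d < N.+1) X d / d%:R) / (1 - t) <= C / N.+1%:R / (1 - t).
  by rewrite ler_pM2r ?invr_gt0 // (le_trans (ler_norm _)).
have err : `|\sum_(1 <= d < N.+1) X d * \sum_(1 <= m < (N %/ d).+1) t ^+ (d * m) -
     \sum_(1 <= d < N.+1) X d * (t ^+ d / (1 - t ^+ d))| <= N%:R * t ^+ N / (1 - t).
  rewrite -sumrB; apply: le_trans (ler_norm_sum _ _ _) _.
  apply: le_trans (_ : \sum_(1 <= d < N.+1) t ^+ N / (1 - t) <= _); last first.
    by rewrite sumr_const_nat subSS subn0 -[leLHS]mulr_natl mulrA.
  rewrite big_nat [leRHS]big_nat; apply: ler_sum => d /andP[d1 dN].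
  have vd := td0 d d1.
  under eq_bigr do rewrite exprM.
  rewrite geo; last by rewrite lt_eqF // -subr_gt0.
  rewrite -mulrBr addrAC subrr add0r normrM normrN -[leRHS]mul1r ler_pM ?chi_le1 //.
  have p0 : 0 <= t ^+ d ^+ (N %/ d).+1 by rewrite -exprM exprn_ge0 // ltW.
  have vi : 0 <= (1 - t ^+ d)^-1 by rewrite invr_ge0 ltW.
  rewrite ger0_norm ?mulr_ge0 //; apply: ler_pM => //.
    by rewrite -exprM ler_wiXn2l ?(ltW t0) ?(ltW t1) // mulnC ltnW // ltn_ceil.
  by rewrite lef_pV2 ?posrE ?td.
move: gap err main; rewrite gapE !ler_norml => /andP[g1 g2] /andP[e1 e2].
move: (_ / (1 - t)) (N%:R * _ / _) (C / _ / _) (2 * _) g1 g2 e1 e2 => M E1 E2 E3.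
move: (\sum_(1 <= d < N.+1) X d * _) (\sum_(1 <= d < N.+1) X d * (_ / _)) => A B; lra.
Qed.

Lemma theta_lower (q : R) N K : 0 < q < 1 -> (K ^ 2 <= N)%N -> 2 * (K ^ 2)%:R * (1 - q) <= 2^-1 -> K%:R / 2 <= theta_sum q N.
Proof.
move=> q01 KN hq; have /andP[q0 q1] := q01.
pose r n : R := (\sum_(1 <= d < N.+1 | (d %| n)%N) X d) * (q ^+ 2) ^+ n.
have r0 n : (0 < n <= N)%N -> 0 <= r n by move=> hn; rewrite mulr_ge0 ?divisor_sum_ge0 // exprn_ge0 ?sqr_ge0.
have step j : (j <= K)%N -> j%:R / 2 <= \sum_(1 <= n < (j ^ 2).+1) r n.
  elim: j => [|j IH] jK; first by rewrite big_geq // mul0r.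
  have j2 : (j.+1 ^ 2 <= N)%N by apply: leq_trans KN; rewrite leq_exp2r.
  rewrite (@big_cat_nat _ _ _ (j ^ 2).+1) //=; last by rewrite ltnS leq_exp2r.
  rewrite -natr1 mulrDl mul1r lerD ?IH ?(ltnW jK) //.
  rewrite big_nat_recr /=; last by rewrite ltn_exp2r.
  rewrite -[leLHS]add0r lerD //.
    rewrite big_nat; apply: sumr_ge0 => n /andP[n1 n2]; apply: r0; rewrite (leq_ltn_trans _ n1) //=.
    by apply: leq_trans j2; apply: ltnW.
  rewrite /r -[leLHS]mul1r ler_pM ?invr_ge0 ?divisor_sum_square //.
  rewrite -exprM; have q1' : 0 <= 1 - q <= 1 by lra.
  have := bernoulli_le (2 * j.+1 ^ 2) q1'; rewrite subKr; apply: le_trans.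
  have : (j.+1 ^ 2)%:R <= (K ^ 2)%:R :> R by rewrite ler_nat leq_exp2r.
  by rewrite natrM; move: ((j.+1 ^ 2)%:R : R) ((K ^ 2)%:R : R) hq => a b; nra.
apply: le_trans (step K (leqnn K)) _; rewrite /theta_sum [leRHS](@big_cat_nat _ _ _ (K ^ 2).+1) //= lerDl.
by rewrite big_nat; apply: sumr_ge0 => n /andP[n1 n2]; apply: r0; rewrite (leq_ltn_trans _ n1).
Qed.

Lemma no_real_character : False.
Proof.
(* The lower bound [K / 2 = 2 (w + 2) + 3] has to beat the upper bound, which is [2 (w + 2)] plus
   two terms of at most [1]. *)
pose K := (4 * w.+2 + 6)%N; have KR : K%:R = 4 * w.+2%:R + 6 :> R by rewrite natrD natrM.
have K2 : 1 <= (K ^ 2)%:R :> R by rewrite ler1n expn_gt0.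
pose x : R := (4 * (K ^ 2)%:R)^-1; have d0 : 0 < 4 * (K ^ 2)%:R :> R by lra.
have x0 : 0 < x by rewrite invr_gt0.
have x1 : x < 1 by rewrite invf_lt1 //; lra.
have xK : 4 * (K ^ 2)%:R * x = 1 by rewrite mulfV // gt_eqF.
(* Squaring [pow_decay] for [q = 1 - x] gives [N q ^ (2 N) <= 1 / (N x ^ 2)], which is at most [x]
   once [N >= x ^ -3]; this absorbs the denominator [1 - q ^ 2 >= x]. *)
have [N1 N10 hN1] := ex_nat_ge (C / x); have [N2 N20 hN2] := ex_nat_ge (x ^- 3).
pose N := (K ^ 2 + N1 + N2)%N.
have q01 : 0 < 1 - x < 1 by lra.
have lo := @theta_lower (1 - x) N K q01; have up := @theta_upper (1 - x) N q01.
have {lo} : K%:R / 2 <= theta_sum (1 - x) N.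
  by apply: lo; [rewrite /N -addnA leq_addr|rewrite subKr; lra].
move=> /le_trans /(_ up); apply/negP; rewrite -ltNge.
have NR : 0 < N%:R :> R by rewrite ltr0n /N addn_gt0 N20 orbT.
have tq : x <= 1 - (1 - x) ^+ 2 by nra.
have t0 : 0 < 1 - (1 - x) ^+ 2 by lra.
have b1 : C / N.+1%:R / (1 - (1 - x) ^+ 2) <= 1.
  rewrite ler_pdivrMr // mul1r; apply: le_trans tq; rewrite ler_pdivrMr ?ltr0n //.
  move: hN1; rewrite ler_pdivrMr // => /le_trans -> //; rewrite mulrC ler_wpM2l ?(ltW x0) // ler_nat.
  by rewrite /N; apply: leqW; rewrite addnAC leq_addl.
have b2 : N%:R * ((1 - x) ^+ 2) ^+ N / (1 - (1 - x) ^+ 2) <= 1.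
  rewrite ler_pdivrMr // mul1r; apply: le_trans tq.
  have := @pow_decay (1 - x) N q01; rewrite subKr => pd.
  have q0 : 0 <= (1 - x) ^+ N by rewrite exprn_ge0 //; lra.
  have : N%:R * x ^+ 3 >= 1.
    rewrite -ler_pdivrMr ?exprn_gt0 // mul1r; apply: le_trans hN2 _; rewrite ler_nat /N leq_addl //.
  rewrite -exprM mulnC exprM; move: ((1 - x) ^+ N) (N%:R : R) q0 pd NR => c v c0 h v0 h1.
  have s1 : x * (v * c) <= 1 by lra.
  have s2 : x ^+ 2 * (v * c ^+ 2) <= x * c.
    by have := ler_wpM2l (mulr_ge0 (ltW x0) c0) s1; lra.
  have x2 : 0 < x ^+ 2 by rewrite exprn_gt0.
  have s4 : v * (x ^+ 2 * (v * c ^+ 2)) <= 1 by apply: le_trans (ler_wpM2l (ltW v0) s2) _; lra.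
  have s5 : v * x ^+ 2 * (v * c ^+ 2) <= v * x ^+ 2 * x.
    have -> : v * x ^+ 2 * (v * c ^+ 2) = v * (x ^+ 2 * (v * c ^+ 2)) by ring.
    have -> : v * x ^+ 2 * x = v * x ^+ 3 by ring.
    exact: le_trans s4 h1.
  by move: s5; rewrite ler_pM2l // mulr_gt0.
apply: le_lt_trans (lerD (lerD b1 (lexx _)) b2) _; rewrite KR.
by move: (w.+2%:R : R) => v; lra.
Qed.

End VanishingRealCharacter.

End RealCharacters.

(** * Primes in a residue class *)

Section Dirichlet.
Context {R : realType} (w : nat).
Local Notation L := (@log_nat R).
Local Notation Z := 'I_w.+2.
Local Notation phiw := (@unit_count R w).

(** Adding a constant to [ell] changes nothing on admissible functions, and sum [1] makes the
    operator preserve sums. *)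
Lemma ell_normalized : exists (ell : Z -> R) (C : R), [/\ 0 <= C, \sum_(c : Z | c \is a GRing.unit) ell c = 1 &
  forall (f : Z -> R) (B : R) b X, admissible f -> (forall a, `|f a| <= B) ->
  `|\sum_(1 <= i < X.+1) f (b * i%:R) / i%:R - Lseries ell f b| <= C * B / X.+1%:R].
Proof.
have [ell [C [C0 h]]] := @ell_exists R w; have u0 := @unit_count_gt0 R w.
pose k := (1 - \sum_(c : Z | c \is a GRing.unit) ell c) / phiw.
exists (fun c => ell c + k), C; split=> //.
  rewrite big_split /=; have -> : \sum_(c : Z | c \is a GRing.unit) k = phiw * k.
    by rewrite -sum_units mulr_suml; apply: eq_bigr => c _; rewrite mul1r.
  by rewrite /k mulrC divfK ?gt_eqF // addrC subrK.
move=> f B b X hf fB; have -> : Lseries (fun c => ell c + k) f b = Lseries ell f b; last exact: h.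
rewrite /Lseries; under eq_bigr do rewrite mulrDl.
rewrite big_split /= -mulr_sumr [X in _ + _ * X](_ : _ = 0) ?mulr0 ?addr0 //.
rewrite -[RHS](@admissibleM R w f b hf) [RHS](bigID (fun c : Z => c \is a GRing.unit)) /= [X in _ = _ + X]big1 ?addr0 //.
by move=> c nc; rewrite hf.1 // unitrM negb_and nc orbT.
Qed.

Lemma log_unbounded (k C : R) : (forall X, (0 < X)%N -> k * L X <= C) -> k <= 0.
Proof.
move=> h; rewrite leNgt; apply/negP => k0.
have [X X0 hX] := ex_nat_ge (expR ((C + 1) / k)).
have : (C + 1) / k <= L X by rewrite -[leLHS]expRK ler_ln ?posrE ?expR_gt0 ?ltr0n.
by rewrite ler_pdivrMr // mulrC; have := h X X0; lra.
Qed.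

(** The value [c = f 1] is the squared norm of [f], and Cauchy-Schwarz gives [|f a| <= c]; summing
    squares, [phiw * c >= 1]. With the assumed upper bound this is an equality, so [|f|] is constant
    on the units, and equality in Cauchy-Schwarz makes [phiw * f] multiplicative. *)
Lemma reproducing_character (f : Z -> R) : admissible f ->
  (forall a : Z, a \is a GRing.unit -> f a = \sum_(b : Z | b \is a GRing.unit) f b * f (a * b)) ->
  (forall a : Z, a \is a GRing.unit -> f a <= phiw^-1) -> f 1 != 0 ->
  (forall a : Z, a \is a GRing.unit -> (phiw * f a) ^+ 2 = 1) /\
  (forall a b : Z, phiw * f (a * b) = (phiw * f a) * (phiw * f b)).
Proof.
move=> [f0 fs] rep fle f1; have u0 := @unit_count_gt0 R w; set c := f 1 in f1.
have cE : \sum_(b : Z | b \is a GRing.unit) f b ^+ 2 = c.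
  by rewrite /c rep ?unitr1 //; apply: eq_bigr => b _; rewrite mul1r expr2.
have c0 : 0 < c by rewrite lt_neqAle eq_sym f1 -cE sumr_ge0 // => b _; apply: sqr_ge0.
have cle : c <= phiw^-1 by apply: fle; apply: unitr1.
have shift (a : Z) : a \is a GRing.unit -> \sum_(b : Z | b \is a GRing.unit) f (a * b) ^+ 2 = c.
  move=> ua; rewrite -cE [RHS](reindex_inj (mulrI ua)); apply: eq_bigl => b; by rewrite unitrM ua.
have bnd (a : Z) : a \is a GRing.unit -> `|f a| <= c.
  move=> ua; rewrite rep //; apply: le_trans (ler_norm_sum _ _ _) _.
  apply: le_trans (_ : \sum_(b : Z | b \is a GRing.unit) (f b ^+ 2 + f (a * b) ^+ 2) / 2 <= _).
    apply: ler_sum => b _; rewrite ler_norml.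
    have := sqr_ge0 (f b - f (a * b)); have := sqr_ge0 (f b + f (a * b)); rewrite sqrrD sqrrB.
    by move: (f b) (f (a * b)) => x y; lra.
  by rewrite -mulr_suml big_split /= cE shift //; lra.
have sqle (a : Z) : a \is a GRing.unit -> f a ^+ 2 <= c ^+ 2.
  by move=> ua; rewrite -[f a ^+ 2]real_normK ?num_real // lerXn2r ?nnegrE ?normr_ge0 ?bnd // ltW.
have cst (k : R) : \sum_(b : Z | b \is a GRing.unit) k = phiw * k.
  by rewrite -sum_units mulr_suml; apply: eq_bigr => b _; rewrite mul1r.
have cphi : phiw * c = 1.
  have h1 : c <= phiw * c ^+ 2 by rewrite -cst -{1}cE; apply: ler_sum => b ub; apply: sqle.
  have h2 : phiw * c <= 1 by rewrite -ler_pdivlMl // mulr1.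
  apply/eqP; rewrite eq_le h2 /= -(ler_pM2r c0) mul1r -mulrA -expr2 //.
have sqE (a : Z) : a \is a GRing.unit -> f a ^+ 2 = c ^+ 2.
  move=> ua; have : \sum_(b : Z | b \is a GRing.unit) (c ^+ 2 - f b ^+ 2) = 0.
    by rewrite sumrB cst cE expr2 mulrA cphi mul1r subrr.
  move/psumr_eq0P => h; apply/eqP; rewrite eq_sym -subr_eq0 h // => b ub.
  by rewrite subr_ge0 sqle.
have mulE (a b : Z) : a \is a GRing.unit -> b \is a GRing.unit -> f b * f (a * b) = c * f a.
  move=> ua ub; have fc : f a = c \/ f a = - c by move/eqP: (sqE a ua); rewrite eqf_sqr => /orP[/eqP|/eqP] ->; [left|right].
  have lo (d : Z) : d \is a GRing.unit -> -(c ^+ 2) <= f d * f (a * d) <= c ^+ 2.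
    move=> ud; have := bnd d ud; have := bnd (a * d); rewrite unitrM ua ud => /(_ isT).
    rewrite -ler_norml normrM expr2; move=> h1 h2; by rewrite ler_pM.
  case: fc => fa.
    have : \sum_(d : Z | d \is a GRing.unit) (c ^+ 2 - f d * f (a * d)) = 0.
      by rewrite sumrB -rep // cst fa expr2 mulrA cphi mul1r subrr.
    move/psumr_eq0P => h; apply/eqP; rewrite eq_sym -subr_eq0 fa -expr2 h // => d ud.
    by rewrite subr_ge0; case/andP: (lo d ud).
  have : \sum_(d : Z | d \is a GRing.unit) (c ^+ 2 + f d * f (a * d)) = 0.
    by rewrite big_split /= -rep // cst fa expr2 mulrA cphi mul1r subrr.
  move/psumr_eq0P => h; apply/eqP; rewrite eq_sym fa mulrN -expr2 eq_sym -addr_eq0 addrC h // => d ud.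
  by rewrite addrC -lerBlDr sub0r; case/andP: (lo d ud).
split=> [a ua|a b]; first by rewrite exprMn sqE // -exprMn cphi expr1n.
have [ua|na] := boolP (a \is a GRing.unit); last first.
  by rewrite (f0 a) // (f0 (a * b)) ?mulr0 ?mul0r // unitrM negb_and na.
have [ub|nb] := boolP (b \is a GRing.unit); last first.
  by rewrite (f0 b) // (f0 (a * b)) ?mulr0 // unitrM negb_and nb orbT.
have := congr1 (fun x => f b * x) (mulE a b ua ub).
rewrite mulrA -expr2 sqE // => h.
have h2 : c * f (a * b) = f b * f a.
  by apply: (mulfI f1); rewrite mulrA -expr2 h; ring.
have -> : phiw * f a * (phiw * f b) = phiw * phiw * (f b * f a) by ring.
by rewrite -h2 mulrA -[phiw * phiw * c]mulrA cphi mulr1.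
Qed.

Definition class_sum b X : R := \sum_(1 <= n < X.+1) mangoldt n / n%:R * ((b * n%:R == 1 :> Z) : nat)%:R.

Lemma unit_lam_sum : exists C : R, forall X, (0 < X)%N ->
  `|\sum_(1 <= n < X.+1) mangoldt n / n%:R * (((n%:R : Z) \is a GRing.unit) : nat)%:R - L X| <= C.
Proof.
exists (L w.+2 + 5 + 5) => X X0; have := @mangoldt_le R X X0; have := @mangoldt_ge R X X0; have := @nonunit_lam_le R w X.
have -> : \sum_(1 <= n < X.+1) mangoldt n / n%:R * (((n%:R : Z) \is a GRing.unit) : nat)%:R =
  \sum_(1 <= n < X.+1) mangoldt n / n%:R - \sum_(1 <= n < X.+1) mangoldt n / n%:R * (((n%:R : Z) \isn't a GRing.unit) : nat)%:R :> R.
  rewrite -sumrB; apply: eq_bigr => n _; case: (_ \is a _) => /=; ring.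
rewrite !ler_norml => /andP[]; move: (\sum_(_ <= _ < _) _) (\sum_(_ <= _ < _) _) (L X) (L w.+2) => a b c d.
by move=> h1 h2 h3 h4; apply/andP; split; lra.
Qed.

(** The function [unit_delta 1] splits into [f] in the kernel and [Lseries ell g] in the image. The
    image contributes [O (1)] and the kernel [- f b log X], so [f] measures the possible failure of
    equidistribution. *)
Lemma class_sum_asymptotic : exists (f : Z -> R), [/\ admissible f,
  (forall a : Z, a \is a GRing.unit -> f a = \sum_(b : Z | b \is a GRing.unit) f b * f (a * b)),
  (exists C : R, forall X, `|\sum_(1 <= i < X.+1) f i%:R / i%:R| <= C / X.+1%:R) &
  exists C : R, forall b X, b \is a GRing.unit -> (0 < X)%N -> `|class_sum b X - (phiw^-1 - f b) * L X| <= C].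
Proof.
have [ell [C [C0 ell1 ellP]]] := ell_normalized.
have [f [g [fadm gadm dec ker rep]]] := spectral_split ell1.
have [Cu hu] := unit_lam_sum; have u0 := @unit_count_gt0 R w.
pose B : R := \sum_a (`|f a| + `|g a|).
have fB a : `|f a| <= B.
  rewrite /B (bigD1 a) //= -addrA lerDl addr_ge0 // sumr_ge0 // => b _; exact: addr_ge0.
have gB a : `|g a| <= B.
  by rewrite /B (bigD1 a) //= [X in X + _]addrC -addrA lerDl addr_ge0 // sumr_ge0 // => b _; exact: addr_ge0.
have nonunit_Lop h (a : Z) : admissible h -> a \isn't a GRing.unit -> Lseries ell h a = 0.
  by move=> hh na; rewrite /Lseries big1 // => c _; rewrite hh.1 ?mulr0 // unitrM negb_and na.
have ker' a : Lseries ell f a = 0.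
  by have [ua|na] := boolP (a \is a GRing.unit); [apply: ker|apply: nonunit_Lop].
have delta (a : Z) : ((a == 1) : nat)%:R = f a + Lseries ell g a + phiw^-1 * ((a \is a GRing.unit) : nat)%:R.
  have [ua|na] := boolP (a \is a GRing.unit); last first.
    rewrite fadm.1 // nonunit_Lop // mulr0 !addr0; case: eqP => // a1; by rewrite a1 unitr1 in na.
  by rewrite -dec // /unit_delta ua mulr1 subrK.
exists f; split=> //.
  exists (C * B) => X; have := ellP f B 1 X fadm fB; rewrite ker' subr0.
  have -> // : \sum_(1 <= i < X.+1) f (1 * i%:R) / i%:R = \sum_(1 <= i < X.+1) f i%:R / i%:R.
  by apply: eq_bigr => i _; congr (f _ / _); apply: mul1r.
exists (C * B + (3 * B + 2 * (w.+2%:R * B) * (L 4 / 4) + 5 * (C * B)) + phiw^-1 * Cu) => b X ub X0.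
have h1 := @kernel_part R w ell C C0 ellP f B b X fadm fB ker' X0.
have h2 := @image_part R w ell C C0 ellP g B b X gadm gB X0.
have h3 := hu X X0.
have -> : class_sum b X - (phiw^-1 - f b) * L X =
  (\sum_(1 <= n < X.+1) mangoldt n / n%:R * f (b * n%:R) + f b * L X) +
  \sum_(1 <= d < X.+1) mangoldt d / d%:R * Lseries ell g (b * d%:R) +
  phiw^-1 * (\sum_(1 <= n < X.+1) mangoldt n / n%:R * (((n%:R : Z) \is a GRing.unit) : nat)%:R - L X).
  rewrite /class_sum; under eq_bigr do rewrite delta unitrM ub /= !mulrDr.
  rewrite !big_split /= mulrBr mulr_sumr.
  have -> : \sum_(1 <= i < X.+1) mangoldt i / i%:R * (phiw^-1 * (((i%:R : Z) \is a GRing.unit) : nat)%:R) =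
    \sum_(1 <= i < X.+1) phiw^-1 * (mangoldt i / i%:R * (((i%:R : Z) \is a GRing.unit) : nat)%:R).
    by apply: eq_bigr => i _; ring.
  by ring.
apply: le_trans (ler_normD _ _) (lerD (le_trans (ler_normD _ _) (lerD h1 h2)) _).
by rewrite normrM ger0_norm ?invr_ge0 ?(ltW u0) // ler_wpM2l // invr_ge0 ltW.
Qed.

(** Class sums are nonnegative, so [f <= 1 / phiw] on units. If [f 1] were nonzero, [phiw * f] would
    be a real character whose value at [1] vanishes. Hence [f 1 = 0], and this is the squared norm
    of [f]. *)
Lemma class_sum_mertens : exists C : R, forall b X, b \is a GRing.unit -> (0 < X)%N ->
  `|class_sum b X - phiw^-1 * L X| <= C.
Proof.
have [f [fadm rep [Cf hf] [C hC]]] := class_sum_asymptotic; have u0 := @unit_count_gt0 R w.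
have fle (a : Z) : a \is a GRing.unit -> f a <= phiw^-1.
  move=> ua; rewrite -subr_le0; apply: (@log_unbounded _ C) => X X0.
  have := hC a X ua X0; rewrite ler_norml => /andP[_].
  have : 0 <= class_sum a X by apply: sumr_ge0 => n _; rewrite mulr_ge0 // divr_ge0 ?mangoldt_ge0.
  move: (class_sum a X) (phiw^-1) (f a) (L X) => x1 x2 x3 x4; lra.
have f1 : f 1 = 0.
  apply/eqP; apply: contraT => f1; have [sq mult] := reproducing_character fadm rep fle f1.
  case: (@no_real_character R w (fun a => phiw * f a) (phiw * Cf)) => //.
  - by move=> a na; rewrite fadm.1 // mulr0.
  - by rewrite -mulr_sumr fadm.2 mulr0.
  - move=> X; under eq_bigr do rewrite -mulrA; rewrite -mulr_sumr normrM ger0_norm ?(ltW u0) //.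
    by rewrite -mulrA ler_wpM2l // ltW.
have f0 (a : Z) : a \is a GRing.unit -> f a = 0.
  have : \sum_(b : Z | b \is a GRing.unit) f b ^+ 2 = 0.
    rewrite -[RHS]f1 [RHS]rep ?unitr1 //; apply: eq_bigr => b _; by rewrite mul1r expr2.
  move/psumr_eq0P => h ua; apply/eqP; rewrite -sqrf_eq0 h // => b _; exact: sqr_ge0.
exists C => b X ub X0; have := hC b X ub X0; by rewrite f0 // subr0.
Qed.

(** If the sums stayed below [k / 2 * N] from [N0] on, partial summation would bound the logarithmic
    sum by [k / 2 * log X + O (1)]. *)
Lemma upper_density (a : nat -> R) (k C : R) : 0 < k -> (forall n, 0 <= a n) ->
  (forall X, (0 < X)%N -> k * L X - C <= \sum_(1 <= n < X.+1) a n / n%:R) ->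
  forall N0, exists2 N, (N0 <= N)%N & k / 2 * N%:R <= \sum_(1 <= n < N.+1) a n.
Proof.
move=> k0 a0 low N0; apply/not_notP => no.
have up N : (N0 <= N)%N -> \sum_(1 <= n < N.+1) a n < k / 2 * N%:R.
  by move=> hN; rewrite ltNge; apply/negP => h; apply: no; exists N.
pose th N := \sum_(1 <= n < N.+1) a n; pose T := th N0.
have th0 N : 0 <= th N by apply: sumr_ge0.
have thT N : th N <= k / 2 * N%:R + T.
  have [h|h] := leqP N0 N; first by apply: le_trans (ltW (up N h)) _; rewrite lerDl; apply: th0.
  have kN : 0 <= k / 2 * N%:R by rewrite mulr_ge0 // divr_ge0 // ltW.
  rewrite -[leLHS]add0r lerD // /T /th [leRHS](@big_cat_nat _ _ _ N.+1) ?ltnS ?(ltnW h) //=.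
  by rewrite lerDl sumr_ge0.
have main X : \sum_(1 <= n < X.+1) a n / n%:R <= th X / X.+1%:R + \sum_(1 <= n < X.+1) (k / 2 * n%:R^-1 + T * (n%:R ^+ 2)^-1).
  elim: X => [|X IH]; first by rewrite !big_geq // addr0 divr_ge0.
  rewrite [leLHS]big_nat_recr //= [X in _ <= _ + X]big_nat_recr //=.
  have thS : th X.+1 = th X + a X.+1 by rewrite /th big_nat_recr.
  have n0 : 0 < X.+1%:R :> R by rewrite ltr0n.
  have step : th X / X.+1%:R + a X.+1 / X.+1%:R <= th X.+1 / X.+2%:R + (k / 2 * X.+1%:R^-1 + T * (X.+1%:R ^+ 2)^-1).
    rewrite -mulrDl -thS -lerBlDl.
    apply: le_trans (_ : (k / 2 * X.+1%:R + T) * (X.+1%:R ^+ 2)^-1 <= _); last first.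
      rewrite le_eqVlt; apply/orP; left; apply/eqP.
      by move: n0; move: (X.+1%:R : R) => v v0; field; rewrite gt_eqF.
    apply: le_trans (_ : th X.+1 * (X.+1%:R ^+ 2)^-1 <= _); last by rewrite ler_wpM2r ?thT // invr_ge0 sqr_ge0.
    rewrite -mulrBr ler_wpM2l // -[X.+2%:R]natr1; move: n0; move: (X.+1%:R : R) => v v0.
    have -> : v^-1 - (v + 1)^-1 = (v * (v + 1))^-1 by field; rewrite !gt_eqF //; lra.
    by rewrite lef_pV2 ?posrE ?exprn_gt0 ?mulr_gt0 // ?expr2; nra.
  move: IH step; set s1 := \sum_(_ <= _ < _) _; set s2 := \sum_(_ <= _ < _) _.
  move: s1 s2 (th X / _) (a X.+1 / _) (th X.+1 / _) (k / 2 * _ + _) => x1 x2 x3 x4 x5 x6; lra.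
have fin X : (0 < X)%N -> k / 2 * L X <= C + (k + 3 * T).
  move=> X0; have := low X X0 => /le_trans /(_ (main X)).
  rewrite big_split /= -!mulr_sumr.
  have T0 : 0 <= T by apply: th0.
  have e1 := ler_wpM2l T0 (@sum_inv_sq_le R X).
  have e2 : k / 2 * \sum_(1 <= n < X.+1) n%:R^-1 <= k / 2 * (1 + L X).
    by rewrite ler_wpM2l ?harmonic_le // divr_ge0 // ltW.
  have e3 : th X / X.+1%:R <= k / 2 + T.
    rewrite ler_pdivrMr ?ltr0n //; apply: le_trans (thT X) _; rewrite -[X.+1%:R]natr1 mulrDr mulr1.
    have : 0 <= X%:R :> R by []; have : 0 <= T * X%:R by rewrite mulr_ge0.
    by move: (X%:R : R) => v; lra.
  move: e1 e2 e3; move: (\sum_(_ <= _ < _) _) (\sum_(_ <= _ < _) _) (th X / _) (L X) => x1 x2 x3 x4; lra.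
have := log_unbounded fin; lra.
Qed.

Lemma dirichlet_density (b : Z) : b \is a GRing.unit -> exists2 c : R, 0 < c &
  forall N0, exists2 N, (N0 <= N)%N &
    c * N%:R <= \sum_(0 <= p < N.+1 | prime p && (b * p%:R == 1)) L p.
Proof.
move=> ub; have u0 := @unit_count_gt0 R w; have [C hC] := class_sum_mertens.
pose a p : R := if prime p && (b * p%:R == 1) then L p else 0.
have a0 p : 0 <= a p by rewrite /a; case: ifP => // _; apply: log_nat_ge0.
have a_0 : a 0%N = 0 by [].
exists (phiw^-1 / 2); first by rewrite divr_gt0 // invr_gt0.
have i0 : 0 < phiw^-1 by rewrite invr_gt0.
move=> N0; have [X X0|N hN h] := @upper_density a phiw^-1 (C + 2) i0 a0 _ N0.
  pose F n : R := ((b * n%:R == 1 :> Z) : nat)%:R.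
  have F1 n : `|F n| <= 1 by rewrite /F; case: eqP; rewrite ?normr0 ?normr1.
  have h1 := @mangoldt_primes R X F 1 F1; have h2 := hC b X ub X0.
  have -> : \sum_(1 <= n < X.+1) a n / n%:R = \sum_(0 <= p < X.+1 | prime p) L p / p%:R * F p.
    rewrite [RHS]big_mkcond [RHS]big_ltn //= add0r; apply: eq_bigr => p _; rewrite /a /F.
    by case: (prime p) => /=; rewrite ?mul0r //; case: eqP; rewrite ?mulr1 ?mulr0 ?mul0r.
  move: h1 h2; rewrite -/(class_sum b X) !ler_norml => /andP[_ h1] /andP[h2 _].
  move: h1 h2; move: (class_sum b X) (\sum_(_ <= _ < _ | _) _) (phiw^-1 * _) => x y v; lra.
exists N => //; apply: le_trans h _; rewrite [leRHS]big_mkcond [leRHS]big_ltn //= add0r.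
exact: lexx.
Qed.

End Dirichlet.

(** * Recurrence for shifted primes *)

Section ShiftKernel.
Context {R : realType}.
Local Notation L := (@log_nat R).
Implicit Types (s : bool) (t x y eps tau : R) (r : seq (R * nat)).

Definition shift s p : nat := if s then p.+1 else p.-1.

Definition shift_sign s : R := if s then -1 else 1.

Lemma shiftE s p : (0 < p)%N -> (shift s p)%:R = p%:R - shift_sign s :> R.
Proof.
rewrite /shift /shift_sign; case: s => [_|p0]; first by rewrite opprK -natr1.
by rewrite -[in RHS](prednK p0) -natr1 addrK.
Qed.

(** If [V] does not divide [n], the sum over [k] periods is [k] times the sum over one, yet
    [periodic_cs_sum] bounds it independently of [k]. *)
Lemma cos_detect V n : (0 < V)%N ->
  \sum_(0 <= a < V) cs (a%:R * (n%:R / V%:R)) = (if (V %| n)%N then V%:R else 0) :> R.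
Proof.
move=> V0; have VR : 0 < V%:R :> R by rewrite ltr0n.
case: ifP => [/dvdnP[k ->]|nV].
  rewrite (eq_bigr (fun=> 1)) => [|a _]; first by rewrite sumr_const_nat subn0.
  have -> : a%:R * ((k * V)%:R / V%:R) = 0 + (a * k)%:R :> R.
    by rewrite !natrM add0r; field; rewrite gt_eqF.
  by rewrite csDnat cs0.
set x := n%:R / V%:R; set S := \sum_(_ <= _ < _) _.
have per m : cs ((m + V)%:R * x) = cs (m%:R * x).
  have -> : (m + V)%:R * x = m%:R * x + n%:R by rewrite natrD /x; field; rewrite gt_eqF.
  exact: csDnat.
have e0 : 0 < (2 * V%:R)^-1 :> R by rewrite invr_gt0 mulr_gt0.
have far : (2 * V%:R)^-1 <= `|sin (pi * x)|.
  apply: far_sin => -[A hA]; case/negP: (negbT nV).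
  have : `|n%:R - A%:~R * V%:R| <= 2^-1 :> R.
    have -> : n%:R - A%:~R * V%:R = (x - A%:~R) * V%:R :> R by rewrite /x; field; rewrite gt_eqF.
    rewrite normrM (ger0_norm (ltW VR)); apply: le_trans (ler_wpM2r (ltW VR) hA) _.
    by rewrite le_eqVlt; apply/orP; left; apply/eqP; field; rewrite gt_eqF.
  rewrite -[n%:R]/(n%:Z%:~R) -[V%:R]/(V%:Z%:~R) -intrM -intrB -intr_norm => h.
  have : `|n%:Z - A * V%:Z| < 1 by rewrite -(ltr_int R) (le_lt_trans h) // invf_lt1 ?ltr1n.
  rewrite -[1]/(1%:Z) -abszE ltz_nat ltnS leqn0 absz_eq0 subr_eq0 => /eqP e.
  have : (V%:Z %| n%:Z)%Z by rewrite e dvdz_mull.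
  by rewrite dvdzE.
have bound k : (2 * V%:R)^-1 * (k%:R * `|S|) <= 1.
  have n1 (m : nat) : `|1 : R| <= 1 by rewrite normr1.
  have := @periodic_cs_sum R (fun=> 1) 1 x 0 1 (k * V) (fun=> erefl) n1; rewrite !mul1r.
  under eq_bigr do rewrite mul1r addr0.
  have := @sum_periodic_blocks R (fun m => cs (m%:R * x)) V k 0 per.
  rewrite addn0 [X in _ + X]big_geq // addr0 => ->; rewrite normrM normr_nat.
  by apply: le_trans; rewrite ler_wpM2r // mulr_ge0.
have [//|S0] := eqVneq S 0.
have S1 : 0 < (2 * V%:R)^-1 * `|S| by rewrite mulr_gt0 // normr_gt0.
have [k _ hk] := ex_nat_ge (2 / ((2 * V%:R)^-1 * `|S|)).
have := bound k; rewrite ler_pdivrMr // in hk; rewrite mulrCA; lra.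
Qed.

Definition shift_kernel s r t : R := \sum_(x <- r) x.1 * cs ((shift s x.2)%:R * t).
Definition mass r : R := \sum_(x <- r) x.1.
Definition prime_weights r := all (fun x : R * nat => (0 <= x.1) && prime x.2) r.

(** The condition modulo [V] is detected by cosines, which move [t] by fractions [a / V].
    Multiplying by [V] turns these into integers, whence the form of the hypothesis on [q * V]. *)
Lemma class_exponential_sum s V eps : (0 < V)%N -> 0 < eps -> exists2 Q, (0 < Q)%N &
  forall l, (0 < l)%N -> exists N0, forall N, (N0 <= N)%N -> forall t,
    (forall q, (0 < q <= Q)%N -> ~ nearint (V%:R / l%:R) ((q * V)%:R * t)) ->
    `|\sum_(0 <= p < N.+1 | prime p && (V %| shift s p)%N) L p * cs ((shift s p)%:R * t)| <= eps * N%:R.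
Proof.
move=> V0 eps0; have VR : 0 < V%:R :> R by rewrite ltr0n.
have [Q Q0 hQ] := @prime_exponential_sum R eps eps0; exists Q => // l l0.
have [N0 hN0] := hQ l l0; exists N0 => N hN t far.
pose E y := \sum_(0 <= p < N.+1 | prime p) L p * cs (p%:R * y + - (shift_sign s * y)).
have hE a (d : bool) : `|E (t + (if d then 1 else -1) * (a%:R / V%:R))| <= eps * N%:R.
  apply: hN0 => // q /andP[q0 qQ] h; apply: (far q); first by rewrite q0.
  have /(nearint_muln V) := h.
  have -> : V%:R * (q%:R * (t + (if d then 1 else -1) * (a%:R / V%:R))) =
     (q * V)%:R * t + ((if d then 1 else -1) * (q * a)%:Z)%:~R :> R.
    have ez : ((q * a)%:Z)%:~R = q%:R * a%:R :> R by rewrite -[LHS]/((q * a)%:R) natrM.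
    rewrite intrM ez !natrM; case: d {h}; rewrite ?mulr1z ?mulrN1z; field; by rewrite gt_eqF.
  by move/nearintDint.
have -> : \sum_(0 <= p < N.+1 | prime p && (V %| shift s p)%N) L p * cs ((shift s p)%:R * t) =
   (2 * V%:R)^-1 * \sum_(0 <= a < V) (E (t + 1 * (a%:R / V%:R)) + E (t + -1 * (a%:R / V%:R))).
  rewrite big_split /= exchange_big /= [X in _ + X]exchange_big /= -big_split /= mulr_sumr.
  rewrite big_mkcondr; apply: eq_bigr => p pp; rewrite -big_split /=.
  transitivity ((2 * V%:R)^-1 * \sum_(0 <= a < V) 2 * (L p * cs ((shift s p)%:R * t)) * cs (a%:R * ((shift s p)%:R / V%:R))).
    rewrite -mulr_sumr cos_detect //; case: ifP => _; rewrite ?mulr0 //.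
    by field; rewrite gt_eqF.
  congr (_ * _); apply: eq_bigr => a _; rewrite (shiftE s (prime_gt0 pp)).
  have -> : p%:R * (t + 1 * (a%:R / V%:R)) + - (shift_sign s * (t + 1 * (a%:R / V%:R))) =
    (p%:R - shift_sign s) * t + a%:R * ((p%:R - shift_sign s) / V%:R) by ring.
  have -> : p%:R * (t + -1 * (a%:R / V%:R)) + - (shift_sign s * (t + -1 * (a%:R / V%:R))) =
    (p%:R - shift_sign s) * t - a%:R * ((p%:R - shift_sign s) / V%:R) by ring.
  by rewrite csD csB; ring.
rewrite normrM ger0_norm; last by rewrite invr_ge0 mulr_ge0 // ltW.
rewrite -ler_pdivlMl ?invr_gt0 ?mulr_gt0 // invrK; apply: le_trans (ler_norm_sum _ _ _) _.
apply: le_trans (_ : \sum_(0 <= a < V) (eps * N%:R + eps * N%:R) <= _).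
  apply: ler_sum => a _; apply: le_trans (ler_normD _ _) _.
  by apply: lerD; [apply: (hE a true)|apply: (hE a false)].
by rewrite sumr_const_nat subn0 -[leLHS]mulr_natl; lra.
Qed.

Lemma kernel_cat s r r' t : shift_kernel s (r ++ r') t = shift_kernel s r t + shift_kernel s r' t.
Proof. exact: big_cat. Qed.

Lemma kernel_le s r t : prime_weights r -> `|shift_kernel s r t| <= mass r.
Proof.
move=> /allP h; apply: le_trans (ler_norm_sum _ _ _) _; rewrite /mass big_seq [leRHS]big_seq.
apply: ler_sum => x xr; have /andP[x0 _] := h x xr.
by rewrite normrM ger0_norm // ler_piMr // cs_le1.
Qed.

End ShiftKernel.

(** * Weights with almost nonnegative cosine sums *)

Section PositiveWeights.
Context {R : realType}.
Local Notation L := (@log_nat R).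
Implicit Types (s : bool) (t x y eps tau : R) (r : seq (R * nat)).

Lemma natr_eq0_mod w n : (n%:R == 0 :> 'I_w.+2) = (w.+2 %| n)%N.
Proof. by rewrite Zp_nat -val_eqE /= /dvdn. Qed.

Lemma class_shift w s p : (0 < p)%N ->
  ((if s then -1 else 1) * p%:R == 1 :> 'I_w.+2) = (w.+2 %| shift s p)%N.
Proof.
move=> p0; rewrite -natr_eq0_mod /shift; case: s.
  by rewrite mulN1r eq_sym -addr_eq0 addrC natr1.
by rewrite mul1r -subr_eq0 -[in p%:R](prednK p0) -natr1 addrK.
Qed.

(* The [k]-th step adds an average over primes modulo [2 W].  At each [t] all but one
   of the steps contribute at least [- eps], and the exceptional one at least [- 1]. *)
Lemma weights_exist s eps k W : 0 < eps -> (0 < W)%N -> exists tau r,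
  [/\ 0 < tau, prime_weights r, mass r = k%:R,
   (forall t, nearint tau (W%:R * t) -> - (eps * k%:R) <= shift_kernel s r t) &
   forall t, - (eps * k%:R) - 1 <= shift_kernel s r t].
Proof.
move=> eps0; elim: k W => [|k IH] W W0.
  exists 1, [::]; split=> //; rewrite /mass /shift_kernel ?big_nil // => t; rewrite ?big_nil ?mulr0 ?oppr0 //.
  by rewrite sub0r lerN10.
(* Doubling makes the modulus at least [2], as the ring ['I_w.+2] requires. *)
have [w Vw] : exists w, (2 * W = w.+2)%N by exists (2 * W.-1)%N; case: (W) W0 => // W' _; rewrite mulnS.
pose b : 'I_w.+2 := if s then -1 else 1.
have ub : b \is a GRing.unit by rewrite /b; case: (s); rewrite ?unitrN unitr1.
have [c c0 dens] := @dirichlet_density R w b ub.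
have V0 : (0 < w.+2)%N by [].
have [Q Q0 minor] := @class_exponential_sum R s w.+2 (eps * c) V0 (mulr_gt0 eps0 c0).
have W20 : (0 < w.+2 * Q`!)%N by rewrite muln_gt0 fact_gt0.
(* The other steps use the modulus [2 W Q!], so every [t] for which [2 W q t] is close enough to an
   integer for some [q <= Q] is good for all of them. *)
have [tauk [rk [tk0 wk mk nk lk]]] := IH _ W20.
have [l l0 hl] := ex_nat_ge (w.+2%:R * Q`!%:R / tauk).
have lR : 0 < l%:R :> R by rewrite ltr0n.
have [N0 hN0] := minor l l0.
have [N hN hdens] := dens N0.+1.
have NR : 0 < N%:R :> R by rewrite ltr0n (leq_trans _ hN).
pose P p := prime p && (w.+2 %| shift s p)%N.
pose T := \sum_(0 <= p < N.+1 | P p) L p.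
have hT : c * N%:R <= T.
  apply: le_trans hdens _; rewrite le_eqVlt; apply/orP; left; apply/eqP; apply: eq_bigl => p.
  by rewrite /P; case pp: (prime p) => //=; rewrite -class_shift ?prime_gt0.
have T0 : 0 < T by apply: lt_le_trans hT; rewrite mulr_gt0.
pose rT := [seq (L p / T, p) | p <- index_iota 0 N.+1 & P p].
have kT t : shift_kernel s rT t = T^-1 * \sum_(0 <= p < N.+1 | P p) L p * cs ((shift s p)%:R * t).
  by rewrite /shift_kernel big_map big_filter mulr_sumr; apply: eq_bigr => p _ /=; ring.
have mT : mass rT = 1 by rewrite /mass big_map big_filter /= -mulr_suml -/T divff // gt_eqF.
have wT : prime_weights rT.
  apply/allP => x /mapP[p]; rewrite mem_filter => /andP[/andP[pp _] _] -> /=.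
  by rewrite pp divr_ge0 ?log_nat_ge0 // ltW.
have N1R : 0 < N.+1%:R :> R by rewrite ltr0n.
(* The first bound keeps [shift s p] times [t] within [1 / 4] of an integer for all primes used up
   to [N]; the second hands nearness on to [rk]. *)
pose tau := Num.min (4 * N.+1%:R)^-1 (tauk / (2 * Q`!%:R)).
have QR : 0 < Q`!%:R :> R by rewrite ltr0n fact_gt0.
have tau0 : 0 < tau by rewrite lt_min invr_gt0 mulr_gt0 //= divr_gt0 // mulr_gt0.
have tau1 : tau <= (4 * N.+1%:R)^-1 by rewrite ge_min lexx.
have tau2 : tau <= tauk / (2 * Q`!%:R) by rewrite ge_min lexx orbT.
have k1 : k.+1%:R = k%:R + 1 :> R by rewrite -natr1.
have ek : eps * k.+1%:R = eps * k%:R + eps by rewrite k1 mulrDr mulr1.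
exists tau, (rk ++ rT); split=> //.
- by rewrite /prime_weights all_cat; apply/andP.
- by rewrite /mass big_cat -/(mass rk) -/(mass rT) mk mT k1.
- move=> t ht; rewrite kernel_cat ek.
  have f1 : - (eps * k%:R) <= shift_kernel s rk t.
    apply: nk; have /(nearint_muln (2 * Q`!)) := ht.
    have -> : (2 * Q`!)%:R * (W%:R * t) = (w.+2 * Q`!)%:R * t by rewrite -Vw !natrM; ring.
    apply: nearint_le; rewrite natrM mulrC -ler_pdivlMr // mulr_gt0 //.
  have f2 : 0 <= shift_kernel s rT t.
    rewrite kT mulr_ge0 ?invr_ge0 ?(ltW T0) // big_nat_cond; apply: sumr_ge0 => p /andP[/andP[_ pN] /andP[pp]].
    rewrite -Vw => /dvdnP[j jE]; rewrite mulr_ge0 ?log_nat_ge0 //; apply: cspi_ge0.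
    have /(nearint_muln (2 * j)) := ht.
    have -> : (2 * j)%:R * (W%:R * t) = (shift s p)%:R * t by rewrite jE !natrM; ring.
    apply: nearint_le; apply: le_trans (ler_wpM2l (ler0n R _) tau1) _.
    have jN : (2 * j <= N.+1)%N.
      apply: leq_trans (_ : shift s p <= _)%N; first by rewrite jE [(j * _)%N]mulnC -mulnA leq_mul2l leq_pmull.
      by rewrite /shift; case: (s) => //; apply: leq_trans (leq_pred _) _; apply: ltnW.
    have : (2 * j)%:R <= N.+1%:R :> R by rewrite ler_nat.
    move: N1R; move: ((2 * j)%:R : R) (N.+1%:R : R) => x y y0 xy.
    rewrite ler_pdivrMr ?mulr_gt0 //; lra.
  by lra.
move=> t; rewrite kernel_cat ek.
have [[q [/andP[q0 qQ] hq]]|far] := pselect (exists q, (0 < q <= Q)%N /\ nearint (w.+2%:R / l%:R) ((q * w.+2)%:R * t)).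
  have f1 : - (eps * k%:R) <= shift_kernel s rk t.
    have qd : (q %| Q`!)%N by apply: dvdn_fact; rewrite q0.
    apply: nk; have /(nearint_muln (Q`! %/ q)) := hq.
    have -> : (Q`! %/ q)%:R * ((q * w.+2)%:R * t) = (w.+2 * Q`!)%:R * t.
      by rewrite mulrA -natrM mulnA divnK // mulnC.
    apply: nearint_le; apply: le_trans (_ : Q`!%:R * (w.+2%:R / l%:R) <= _).
      by rewrite ler_wpM2r ?divr_ge0 // ler_nat leq_div.
    by move: hl; rewrite ler_pdivrMr // mulrA ler_pdivrMr // [Q`!%:R * _]mulrC [tauk * _]mulrC.
  have := kernel_le s t wT; rewrite mT ler_norml => /andP[f2 _]; lra.
have f2 : - eps <= shift_kernel s rT t.
  have h : `|\sum_(0 <= p < N.+1 | P p) L p * cs ((shift s p)%:R * t)| <= eps * c * N%:R.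
    by apply: (hN0 N (ltnW hN) t) => q hq h; apply: far; exists q.
  rewrite kT.
  have : `|T^-1 * \sum_(0 <= p < N.+1 | P p) L p * cs ((shift s p)%:R * t)| <= eps.
    rewrite normrM ger0_norm ?invr_ge0 ?(ltW T0) // ler_pdivrMl //.
    by apply: le_trans h _; rewrite -mulrA mulrC ler_wpM2r // ltW.
  by rewrite ler_norml => /andP[].
by have := lk t; lra.
Qed.

(** Averaging over [k >= 2 / eps] steps dilutes the one exceptional contribution [- 1] to at least
    [- eps / 2]. *)
Theorem positive_kernel s eps : 0 < eps -> exists r,
  [/\ prime_weights r, mass r = 1 & forall t, - eps <= shift_kernel s r t].
Proof.
move=> eps0; have e2 : 0 < eps / 2 by rewrite divr_gt0.
have [k k0 hk] := ex_nat_ge (2 / eps); have kR : 0 < k%:R :> R by rewrite ltr0n.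
have [tau [r [_ wr mr _ lr]]] := @weights_exist s (eps / 2) k 1 e2 isT.
exists [seq (x.1 / k%:R, x.2) | x : R * nat <- r]; split.
- apply/allP => x /mapP[y yr ->] /=; have /andP[y0 ->] := allP wr y yr.
  by rewrite divr_ge0.
- by rewrite /mass big_map /= -mulr_suml -/(mass r) mr divff // gt_eqF.
move=> t; have -> : shift_kernel s [seq (x.1 / k%:R, x.2) | x : R * nat <- r] t = shift_kernel s r t / k%:R.
  by rewrite /shift_kernel big_map /= mulr_suml; apply: eq_bigr => x _; ring.
rewrite ler_pdivlMr //; apply: le_trans (lr t); rewrite ler_pdivrMr // in hk; lra.
Qed.

End PositiveWeights.

(** * Shifted primes among the differences of a dense set *)

Section Recurrence.
Context {R : realType}.

(* Expand the number of [x], [y] in [A] with [y - x = m (p - s)], which is zero, into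
   cosines modulo [Y]; the zero frequency alone contributes [|A| ^ 2]. *)
Lemma shifted_prime_recurrence s m (delta : R) : (0 < m)%N -> 0 < delta ->
  exists X0, forall X, (X0 <= X)%N -> forall A : pred nat,
    delta * X%:R <= (count A (iota 0 X))%:R ->
    exists x y p, [/\ prime p, A x, A y, (x < X)%N & (y < X)%N /\ y = (x + m * shift s p)%N].
Proof.
move=> m0 d0; have e0 : 0 < delta / 4 by rewrite divr_gt0.
have [r [wr mr Kr]] := @positive_kernel R s (delta / 4) e0.
pose D (w : R * nat) := (m * shift s w.2)%N.
pose Dm := \max_(w <- r) D w.
have hD w : w \in r -> (D w <= Dm)%N by move=> wr'; apply: (leq_bigmax_seq (F := D)).
exists Dm.+1 => X hX A hA; apply/not_notP => no.
have X0 : (0 < X)%N by apply: leq_trans hX.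
have XR : 0 < X%:R :> R by rewrite ltr0n.
(* The padding by the largest difference [Dm] excludes wrap-around: a congruence of [y] and
   [x + D w] modulo [Y] is an equality. *)
pose Y := (X + Dm)%N; have Y0 : (0 < Y)%N by rewrite addn_gt0 X0.
have YR : 0 < Y%:R :> R by rewrite ltr0n.
have Y2 : Y%:R <= 2 * X%:R :> R by rewrite -natrM ler_nat mul2n -addnn leq_add2l ltnW.
pose sA := [seq x <- iota 0 X | A x].
have sAP x : x \in sA -> A x /\ (x < X)%N by rewrite mem_filter mem_iota add0n => /andP[].
have szA : size sA = count A (iota 0 X) by rewrite size_filter.
pose th (k x : nat) : R := k%:R * (x%:R / Y%:R).
pose P k := \sum_(y <- sA) \sum_(x <- sA) cs (th k y - th k x).
have P0 k : 0 <= P k.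
  have -> : P k = (\sum_(x <- sA) 1 * cs (th k x)) ^+ 2 + (\sum_(x <- sA) 1 * sn (th k x)) ^+ 2.
    by rewrite sq_expand; apply: eq_bigr => y _; apply: eq_bigr => x _; rewrite !mul1r.
  by rewrite addr_ge0 ?sqr_ge0.
have antisym k : \sum_(y <- sA) \sum_(x <- sA) sn (th k y - th k x) = 0.
  set S := LHS; suff : S = - S by move=> h; lra.
  rewrite {1}/S exchange_big /= -sumrN; apply: eq_bigr => y _; rewrite -sumrN; apply: eq_bigr => x _.
  by rewrite -snN opprB.
have shiftP k (b : R) : \sum_(y <- sA) \sum_(x <- sA) cs (th k y - th k x - b) = P k * cs b.
  under eq_bigr => y _ do (under eq_bigr => x _ do rewrite csB; rewrite big_split /= -!mulr_suml).
  by rewrite big_split /= -!mulr_suml antisym mul0r addr0.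
have detect (y x d : nat) : (x + d <= 2 * Y)%N ->
    \sum_(0 <= k < Y) cs (th k y - th k x - th k d) = if (y == x + d %[mod Y])%N then Y%:R else 0.
  move=> hx; have hx' : (x + d <= y + 2 * Y)%N by apply: leq_trans hx (leq_addl _ _).
  have -> : (y == x + d %[mod Y])%N = (Y %| y + 2 * Y - (x + d))%N.
    by rewrite -eqn_mod_dvd // [(y + _)%N]addnC modnMDl.
  rewrite -cos_detect //; apply: eq_bigr => k _.
  have -> : (y + 2 * Y - (x + d))%:R = y%:R + 2 * Y%:R - x%:R - d%:R :> R.
    by rewrite natrB // natrD [(x + d)%:R]natrD natrM; ring.
  rewrite -[LHS](csDnat _ (2 * k)) natrM; congr cs; rewrite /th.
  by field; rewrite gt_eqF.
have parseval : \sum_(0 <= k < Y) P k = Y%:R * (size sA)%:R.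
  rewrite /P exchange_big /=; transitivity (\sum_(y <- sA) (Y%:R : R)); last first.
    by rewrite big_const_seq count_predT iter_addr addr0 mulr_natr.
  rewrite big_seq [RHS]big_seq; apply: eq_bigr => y yA; rewrite exchange_big /=.
  transitivity (\sum_(x <- sA | x == y) (Y%:R : R)).
    rewrite [RHS]big_mkcond big_seq [RHS]big_seq; apply: eq_bigr => x xA.
    have [_ xX] := sAP x xA; have [_ yX] := sAP y yA.
    transitivity (\sum_(0 <= k < Y) cs (th k y - th k x - th k 0)).
      by apply: eq_bigr => k _; rewrite /th mul0r mulr0 subr0.
    rewrite detect addn0; last first.
      by apply: leq_trans (ltnW xX) _; rewrite mul2n -addnn /Y -addnA leq_addr.
    by rewrite !modn_small ?(leq_trans yX) ?(leq_trans xX) ?leq_addr // eq_sym.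
  rewrite -big_filter filter_pred1_uniq ?filter_uniq ?iota_uniq // big_seq1 //.
have zero : \sum_(0 <= k < Y) P k * shift_kernel s r (m%:R * (k%:R / Y%:R)) = 0.
  rewrite /shift_kernel; under eq_bigr do rewrite mulr_sumr.
  rewrite exchange_big /= big_seq big1 // => w wr'.
  transitivity (w.1 * \sum_(y <- sA) \sum_(x <- sA) \sum_(0 <= k < Y) cs (th k y - th k x - th k (D w))).
    under [X in _ * X]eq_bigr do rewrite exchange_big /=.
    rewrite [X in _ * X]exchange_big /= mulr_sumr; apply: eq_bigr => k _.
    rewrite shiftP mulrCA; congr (_ * (_ * cs _)); rewrite /th /D natrM; ring.
  rewrite big_seq big1 ?mulr0 // => y yA; rewrite big_seq big1 // => x xA.
  have [Ax xX] := sAP x xA; have [Ay yX] := sAP y yA.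
  have Dw := hD w wr'; rewrite detect; last first.
    by rewrite mul2n -addnn /Y; apply: leq_trans (leq_addr _ _); apply: leq_add (ltnW xX) Dw.
  rewrite modn_small ?(leq_trans yX) ?leq_addr // modn_small; last first.
    by rewrite /Y -addSn leq_add.
  case: eqP => // e; case: no; exists x, y, w.2; split=> //.
  by have /allP /(_ w wr') /andP[] := wr.
(* Frequency [0] gives [|A| ^ 2], any other [k] at least [- delta / 4 * P k]; by Parseval these lose
   at most [delta / 4 * Y |A|]. As [Y <= 2 X] and [|A| >= delta X], the total would be positive. *)
have low : P 0%N - delta / 4 * (Y%:R * (size sA)%:R) <= \sum_(0 <= k < Y) P k * shift_kernel s r (m%:R * (k%:R / Y%:R)).
  rewrite -parseval mulr_sumr [leRHS]big_ltn // mul0r mulr0.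
  have k0 : shift_kernel s r 0 = 1.
    by rewrite -mr; apply: eq_bigr => w _; rewrite mulr0 cs0 mulr1.
  rewrite k0 mulr1 lerD2l [X in - X]big_ltn // opprD.
  apply: le_trans (_ : - \sum_(1 <= k < Y) delta / 4 * P k <= _).
    by rewrite gerDr oppr_le0 mulr_ge0 // ltW.
  by rewrite -sumrN; apply: ler_sum => k _; rewrite mulrC -mulrN ler_wpM2l // Kr.
have PA : P 0%N = (size sA)%:R ^+ 2.
  rewrite /P; under eq_bigr => y _ do under eq_bigr => x _ do rewrite /th !mul0r subr0 cs0.
  by rewrite !big_const_seq !count_predT !iter_addr !addr0 expr2 mulr_natr.
move: low; rewrite zero PA szA; set n := (count A _)%:R in hA *.
have n0 : 0 < n by apply: lt_le_trans hA; rewrite mulr_gt0.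
have -> : n ^+ 2 - delta / 4 * (Y%:R * n) = n * (n - delta / 4 * Y%:R) by ring.
rewrite pmulr_rle0 //; have := ler_wpM2l (ltW e0) Y2; nra.
Qed.

End Recurrence.

Local Close Scope ring_scope.

(** * Almost primes *)

Section AlmostPrimes.
Implicit Types (n m p q : nat) (ps s : seq nat).

Lemma prime_power_dvd_prod q ps j : prime q -> all prime ps -> q ^ j %| \prod_(p <- ps) p ->
  j <= size ps /\ (j = size ps -> \prod_(p <- ps) p = q ^ j).
Proof.
move=> qq; elim: ps j => [|p ps IH] j /=.
  rewrite big_nil dvdn1 => _; case: j => // j; rewrite expnS muln_eq1 => /andP[/eqP e _].
  by rewrite e in qq.
move=> /andP[pp hps]; rewrite big_cons; have [->|pq] := eqVneq p q.
  case: j => [|j]; first by [].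
  rewrite expnS dvdn_pmul2l ?prime_gt0 // => /(IH _ hps)[h1 h2].
  by split=> // -[e]; rewrite h2.
have cop : coprime (q ^ j) p by rewrite coprimeXl // prime_coprime // dvdn_prime2 // eq_sym.
rewrite Gauss_dvdr // => /(IH _ hps)[h1 _]; split; first exact: leqW.
by move=> e; rewrite e ltnn in h1.
Qed.

Lemma almost_prime_pow q n m j : prime q -> almost_primes n m -> q ^ j %| m ->
  j <= n /\ (j = n -> m = q ^ j).
Proof.
move=> qq [ps [/andP[_ sn] hps ->]] h.
have aps : all prime ps by apply/allP => p /hps.
have [h1 h2] := prime_power_dvd_prod qq aps h; split; first exact: leq_trans sn.
by move=> e; apply: h2; apply/eqP; rewrite eqn_leq h1 e.
Qed.

Lemma almost_prime_2pow n : 0 < n -> almost_primes n (2 ^ n).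
Proof.
move=> n0; exists (nseq n 2); split; first by rewrite size_nseq n0 leqnn.
  by move=> p; rewrite mem_nseq => /andP[_ /eqP ->].
by elim: n {n0} => [|n IH]; rewrite ?big_nil //= big_cons -IH expnS.
Qed.

(** All prime factors are at least [2]. That there are fewer than [n] leaves room for one more
    prime. *)
Lemma small_factorization n m : 0 < m < 2 ^ n -> exists2 ps, all prime ps & size ps < n /\ m = \prod_(p <- ps) p.
Proof.
elim: n m => [|n IH] m /andP[m0 mn]; first by move: m0 mn; case: m => // -[].
have [m1|m1] := leqP m 1.
  by exists [::] => //; rewrite big_nil; split=> //; apply/eqP; rewrite eqn_leq m1.
have pp := pdiv_prime m1; have /dvdnP[t tE] := pdiv_dvd m.
have t0 : 0 < t by move: m0; rewrite tE muln_gt0 => /andP[].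
have tn : t < 2 ^ n.
  rewrite -(ltn_pmul2r (isT : 0 < 2)) -expnSr; apply: leq_ltn_trans mn.
  by rewrite [leqRHS]tE leq_mul2l prime_gt1 ?orbT.
have [|ps hps [sps e]] := IH t; first by rewrite t0.
by exists (pdiv m :: ps); rewrite /= ?pp // big_cons -e; split=> //; rewrite mulnC.
Qed.

Lemma almost_prime_mul n m p : 0 < m < 2 ^ n -> prime p -> almost_primes n (m * p).
Proof.
move=> /small_factorization[ps hps [sps ->]] pp; exists (p :: ps); split=> //.
  by move=> q; rewrite inE => /orP[/eqP ->//|/(allP hps)].
by rewrite big_cons mulnC.
Qed.

Lemma not_accessible n r : 2 ^ n < r -> ~ accessible r (almost_primes n).
Proof.
case: r => // r; rewrite ltnS => nr acc.
pose q := 3 ^ n.+1; have q0 : 0 < q by rewrite expn_gt0.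
pose col x : nat := if q %| x then 2 ^ n else x %% 2 ^ n.
have n2 : 0 < 2 ^ n by rewrite expn_gt0.
have colr x : col x < r.+1.
  by rewrite ltnS /col; case: ifP => // _; apply: leq_trans nr; rewrite ltnW // ltn_pmod.
pose chi x : 'I_r.+1 := inord (col x).
have [|s [[spos sdiff] mono]] := acc chi q.+1; first by [].
have sz : size s = q.+1 by rewrite size_tuple.
have colE x y : x \in (s : seq nat) -> y \in (s : seq nat) -> col x = col y.
  by move=> xs ys; have := congr1 val (mono x y xs ys); rewrite /= !inordK.
have memn i : i < q.+1 -> nth 0 s i \in (s : seq nat) by move=> h; rewrite mem_nth // sz.
pose x0 := nth 0 s 0.
have x0s : x0 \in (s : seq nat) by apply: memn.
have q1 : 1 < q.+1 by rewrite ltnS.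
have [qx|qx] := boolP (q %| x0).
  have [lt01 d01] := sdiff 0 ltac:(by rewrite sz).
  have c1 : q %| nth 0 s 1.
    have := colE _ _ x0s (memn 1 q1); rewrite /col qx; case: ifP => // _ e.
    by have := ltn_pmod (nth 0 s 1) n2; rewrite -e ltnn.
  have p3 : prime 3 by [].
  have [h _] := almost_prime_pow p3 d01 (dvdn_sub c1 qx).
  by rewrite ltnn in h.
have nq i : i < q.+1 -> (q %| nth 0 s i) = false.
  move=> iq; apply/negP => h; have := colE _ _ x0s (memn i iq); rewrite /col h (negbTE qx) => e.
  by have := ltn_pmod x0 n2; rewrite e ltnn.
have ap i : i < q.+1 -> nth 0 s i = x0 + i * 2 ^ n.
  elim: i => [|i IH] iq; first by rewrite mul0n addn0.
  have [lti di] := sdiff i ltac:(by rewrite sz).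
  have := colE _ _ (memn _ iq) (memn _ (ltnW iq)); rewrite /col !nq ?(ltnW iq) // => e.
  have d2 : 2 ^ n %| nth 0 s i.+1 - nth 0 s i by rewrite -eqn_mod_dvd ?(ltnW lti) // e.
  have p2 : prime 2 by [].
  have [_ /(_ erefl) e2] := almost_prime_pow p2 di d2.
  by rewrite -(subnK (ltnW lti)) e2 IH ?(ltnW iq) // mulSn addnCA.
have cop : coprime (2 ^ n) q by rewrite coprimeXl // coprimeXr.
(* The added multiple of [2 ^ n * q] puts the solution of the congruences at or beyond [x0]. *)
pose N := chinese (2 ^ n) q x0 0 + x0 * (2 ^ n * q).
have xN : x0 <= N by rewrite /N (leq_trans _ (leq_addl _ _)) // leq_pmulr // muln_gt0 n2.
have Nx : N = x0 %[mod 2 ^ n].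
  have -> : N = (x0 * q) * 2 ^ n + chinese (2 ^ n) q x0 0 by rewrite /N addnC mulnCA mulnC.
  by rewrite modnMDl chinese_modl.
have N2 : 2 ^ n %| N - x0 by rewrite -eqn_mod_dvd // Nx.
pose i := (N - x0) %/ 2 ^ n.
have iE : x0 + i * 2 ^ n = N by rewrite /i divnK // subnKC.
(* Modulo [q] the progression is periodic in its index with period [q], so the index can be reduced
   to one of the available terms. *)
have iq : i %% q < q by rewrite ltn_pmod.
have := nq _ (leqW iq); rewrite ap ?(leqW iq) // /dvdn -modnDmr modnMml modnDmr iE.
have -> : N = (x0 * 2 ^ n) * q + chinese (2 ^ n) q x0 0 by rewrite /N addnC mulnA.
by rewrite modnMDl chinese_modr // mod0n.
Qed.

End AlmostPrimes.

(** * Chains: monochromatic diffsequences by their last term *)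

Section Accessibility.
(** The parameter [l] counts differences, not terms, so that it is the height and starts at [0]. *)
Variant chain (D : set nat) r (chi : nat -> 'I_r) (x l : nat) : Prop :=
  Chain s of size s = l.+1 & diffsequence D s & monochromatic chi [set y | y \in (s : seq nat)] & last 0 s = x.

Lemma chain1 D r (chi : nat -> 'I_r) x : 0 < x -> chain D chi x 0.
Proof.
move=> x0; exists [:: x] => //; first by split=> [y|i] //; rewrite inE => /eqP ->.
by move=> y z /=; rewrite !inE => /eqP -> /eqP ->.
Qed.

Lemma chain_extend D r (chi : nat -> 'I_r) x y l : chain D chi x l -> x < y -> D (y - x) ->
  chi x = chi y -> chain D chi y l.+1.
Proof.
move=> [s sz [pos diff] mono lst] xy dxy cxy.
have xs : x \in s by rewrite -lst; case: s sz {pos diff mono lst} => // a s _; rewrite /= mem_last.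
exists (rcons s y); rewrite ?size_rcons ?sz ?last_rcons //.
  split=> [z|i]; first by rewrite mem_rcons inE => /orP[/eqP ->|/pos //]; apply: leq_ltn_trans xy.
  rewrite size_rcons ltnS => ils; rewrite !nth_rcons ils; move: ils; rewrite leq_eqVlt => /orP[/eqP e|h].
    have ei : nth 0 s i = x by rewrite -lst -nth_last -e.
    by rewrite -e ltnn eqxx ei.
  by rewrite h; apply: diff.
move=> a b /=; rewrite !mem_rcons !inE.
have key c : (c == y) || (c \in s) -> chi c = chi x.
  by case/orP => [/eqP -> //|cs]; apply: mono.
by move=> /key -> /key ->.
Qed.

Lemma chain_accessible D r (chi : nat -> 'I_r) x l : chain D chi x l ->
  exists s : l.+1.-tuple nat, diffsequence D s /\ monochromatic chi [set y | y \in (s : seq nat)].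
Proof. by move=> [s /eqP sz ds ms _]; exists (Tuple sz). Qed.

(** Distinct colours on [2 ^ n] consecutive integers exhaust all colours, so the next integer must
    repeat the first of them. A window of length [(k + 1) 2 ^ n] has room for [k] steps of [2 ^ n],
    that is, for a chain of the excluded length. *)
Lemma repeated_colour n (chi : nat -> 'I_(2 ^ n)) k x : 0 < n -> 0 < x ->
  (forall y, ~ chain (almost_primes n) chi y k) ->
  exists i j, [/\ i < j, j < k.+1 * 2 ^ n, j - i < 2 ^ n & chi (x + i) = chi (x + j)].
Proof.
move=> n0 x0 nochain; apply/not_notP => no.
have n2 : 0 < 2 ^ n by rewrite expn_gt0.
have inj i j : i < j -> j < k.+1 * 2 ^ n -> j - i < 2 ^ n -> chi (x + i) <> chi (x + j).
  by move=> h1 h2 h3 e; apply: no; exists i, j.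
have per i : i + 2 ^ n < k.+1 * 2 ^ n -> chi (x + i) = chi (x + i + 2 ^ n).
  move=> hi; pose f (t : 'I_(2 ^ n)) := chi (x + (i + t)).
  have finj : injective f.
    move=> t u; apply: contra_eq => tu; have [h|h] : t < u \/ u < t by apply/orP; rewrite -neq_ltn.
      apply/eqP; apply: inj; rewrite ?ltn_add2l //.
        by apply: leq_trans hi; rewrite ltnW // ltnS ltn_add2l.
      by rewrite subnDl (leq_ltn_trans (leq_subr _ _)).
    apply/eqP => e; apply: (inj (i + u) (i + t)); rewrite ?ltn_add2l //.
      by apply: leq_trans hi; rewrite ltnW // ltnS ltn_add2l.
    by rewrite subnDl (leq_ltn_trans (leq_subr _ _)).
  have /codomP[t ft] : chi (x + i + 2 ^ n) \in codom f.
    apply: (inj_card_onto finj); by rewrite card_ord.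
  rewrite ft; have [t0|t0] := posnP t; first by rewrite /f t0 addn0.
  case: (inj (i + t) (i + 2 ^ n)); rewrite ?ltn_add2l ?subnDl ?ltn_subrL ?n2 ?t0 //.
  by rewrite [in RHS]addnA ft.
have ch t : t <= k -> chain (almost_primes n) chi (x + t * 2 ^ n) t.
  elim: t => [|t IH] tk; first by rewrite mul0n addn0; apply: chain1.
  apply: (chain_extend (IH (ltnW tk))).
  - by rewrite ltn_add2l ltn_pmul2r.
  - by rewrite subnDl -mulnBl subSnn mul1n; apply: almost_prime_2pow.
  - rewrite per; first by rewrite mulSn [2 ^ n + _]addnC addnA.
    by rewrite addnC -mulSn ltn_pmul2r.
exact: nochain (ch k (leqnn k)).
Qed.

End Accessibility.

(** * The degree of accessibility *)

Section Degree.

Lemma accessible_almost_primes n : 0 < n -> accessible (2 ^ n) (almost_primes n).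
Proof.
move=> n0 chi [//|k] _; apply/not_notP => no.
pose D := almost_primes n.
have nochain y : ~ chain D chi y k by move=> /chain_accessible.
have hP x : exists h : 'I_k.+1, 0 < x ->
    chain D chi x h /\ (forall l, chain D chi x l -> l <= h).
  have [x0|x0] := posnP x; first by exists ord0; rewrite x0.
  have bd l : `[< chain D chi x l >] -> l <= k.
    move=> /asboolP [s sz [spos sdiff] mono lst]; rewrite leqNgt; apply/negP => kl.
    apply: no; have szt : size (take k.+1 s) == k.+1 by rewrite size_takel // sz ltnW.
    exists (Tuple szt) => /=; split; last first.
      by move=> a b /= /mem_take ha /mem_take hb; apply: mono.
    split=> [a /mem_take /spos //|i]; rewrite (eqP szt) => ik.
    by rewrite !nth_take ?(ltnW ik) //; apply: sdiff; rewrite sz (leq_trans ik) // ltnS ltnW.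
  have ex0 : exists l, `[< chain D chi x l >] by exists 0; apply/asboolP/chain1.
  case: (ex_maxnP ex0 bd) => h /asboolP hh hmax.
  exists (inord h) => _; rewrite inordK ?ltnS ?bd //; last exact/asboolP.
  by split=> // l hl; apply/hmax/asboolP.
have [h hmax] := choice hP.
have hlt x y : 0 < x -> x < y -> D (y - x) -> chi x = chi y -> h x < h y.
  move=> x0 xy dxy cxy; have [hx _] := hmax _ x0.
  by have [_] := hmax _ (ltn_trans x0 xy); apply; apply: chain_extend hx _ _ _.
pose W := k.+1 * 2 ^ n.
have W0 : 0 < W by rewrite muln_gt0 expn_gt0.
have pairP x : exists ij : 'I_W * 'I_W,
    [/\ ij.1 < ij.2, ij.2 - ij.1 < 2 ^ n & chi (x.+1 + ij.1) = chi (x.+1 + ij.2)].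
  have [i [j [ij jW d e]]] := repeated_colour n0 (ltn0Sn x) nochain.
  by exists (Ordinal (ltn_trans ij jW), Ordinal jW).
have [ij ijP] := choice pairP.
(* Positions are counted from [x.+1], since the terms must be positive while recurrence is applied
   to subsets of an initial segment starting at [0]. The number of cells depends on [n] and [k]
   only. *)
pose cell x := (ij x, chi (x.+1 + (ij x).1), h (x.+1 + (ij x).1), h (x.+1 + (ij x).2)).
pose T : finType := ('I_W * 'I_W * 'I_(2 ^ n) * 'I_k.+1 * 'I_k.+1)%type.
have T0 : 0 < #|{: T}| by apply/card_gt0P; exists (cell 0).
pose R := Rstruct.RbaseSymbolsImpl_R__canonical__reals_Real.
pose delta : R := (#|{: T}|%:R^-1)%R.
have delta0 : (0 < delta)%R by rewrite invr_gt0 ltr0n.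
have XP (ms : 'I_(2 ^ n) * bool) : exists X0, forall X, X0 <= X -> 0 < ms.1 -> forall A : pred nat,
    (delta * X%:R <= (count A (iota 0 X))%:R)%R ->
    exists x y p, [/\ prime p, A x, A y, x < X & y < X /\ y = x + ms.1 * shift ms.2 p].
  have [m0|m0] := posnP ms.1; first by exists 0 => X _; rewrite m0.
  have [X0 hX] := @shifted_prime_recurrence R ms.2 ms.1 delta m0 delta0.
  by exists X0 => X hX0 _; apply: hX.
have [X0 X0P] := choice XP.
(* The difference and the sign are known only once a dense cell has been found below [X], so [X] has
   to serve all of them. *)
pose X := (\max_ms X0 ms).+1.
have [c cX] : exists c : T, X <= #|{: T}| * count (fun x => cell x == c) (iota 0 X).
  apply/not_notP => nc.
  have lt c : #|{: T}| * count (fun x => cell x == c) (iota 0 X) < X.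
    by rewrite ltnNge; apply/negP => h0; apply: nc; exists c.
  have : \sum_(c : T) #|{: T}| * count (fun x => cell x == c) (iota 0 X) < \sum_(c : T) X.
    rewrite [X in X < _](bigD1 (cell 0)) // [X in _ < X](bigD1 (cell 0)) //=.
    by rewrite -addSn; apply: leq_add (lt _) _; apply: leq_sum => c _; exact: ltnW (lt c).
  rewrite sum_nat_const -big_distrr /= ltn_pmul2l //.
  suff -> : \sum_(c : T) count (fun x => cell x == c) (iota 0 X) = X by rewrite ltnn.
  rewrite -[RHS](size_iota 0 X) -sum1_size; under eq_bigr do rewrite -sum1_count.
  rewrite (exchange_big_dep predT) //=; apply: eq_bigr => x _.
  by rewrite sum1_card; apply: eq_card1 => d; rewrite inE eq_sym.
have dX : (delta * X%:R <= (count (fun x => cell x == c) (iota 0 X))%:R)%R.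
  by rewrite /delta mulrC ler_pdivrMr ?ltr0n // -natrM ler_nat mulnC.
case: c dX {cX} => [[[[i j] a] h1] h2] dX.
have cellE x : (cell x == (i, j, a, h1, h2)) ->
  [/\ i < j, j - i < 2 ^ n, chi (x.+1 + i) = a, chi (x.+1 + j) = a & h (x.+1 + i) = h1 /\ h (x.+1 + j) = h2].
  move=> /eqP; rewrite /cell; have := ijP x; case: (ij x) => i' j' [/= hij hd hc].
  by move=> [ei ej ea e1 e2]; rewrite -ei -ej -ea -e1 -e2; split.
(* The sign is chosen against the order of the heights: the shift [p + 1] forces [h2 < h1], and
   [p - 1] forces [h1 < h2]. *)
pose s := h1 < h2.
have [x0 _ x0c] : exists2 x, x \in iota 0 X & cell x == (i, j, a, h1, h2).
  apply/hasP; rewrite has_count -(ltr0n R); apply: lt_le_trans dX.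
  by rewrite mulr_gt0 ?ltr0n.
have [ij' dn _ _ _] := cellE _ x0c.
have m0 : 0 < j - i by rewrite subn_gt0.
have XX : X0 (Ordinal dn, s) <= X by rewrite /X leqW // (bigD1 (Ordinal dn, s)) //= leq_maxl.
have [x [y [p [pp /cellE[_ _ xi xj [hxi hxj]] /cellE[_ _ yi yj [hyi hyj]] _ [_ yE]]]]] := X0P _ _ XX m0 _ dX.
have p1 := prime_gt1 pp.
have Dmp : D ((j - i) * p) by apply: almost_prime_mul => //; rewrite m0.
rewrite /= /shift in yE.
have [hs|hs] := boolP s; rewrite ?hs ?(negbTE hs) in yE.
  have := @hlt (x.+1 + j) (y.+1 + i) isT.
  have dE : y.+1 + i - (x.+1 + j) = (j - i) * p by rewrite yE mulnS; nia.
  rewrite dE hxj hyi xj yi; have lt : x.+1 + j < y.+1 + i by rewrite yE mulnS; nia.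
  by move=> /(_ lt Dmp erefl); rewrite ltnNge ltnW.
have := @hlt (x.+1 + i) (y.+1 + j) isT.
have dE : y.+1 + j - (x.+1 + i) = (j - i) * p by case: p p1 yE {pp Dmp} => // p p1; rewrite /= mulnS => ->; nia.
rewrite dE hxi hyj xi yj; have lt : x.+1 + i < y.+1 + j by rewrite yE; nia.
by move=> /(_ lt Dmp erefl) h0; rewrite /s h0 in hs.
Qed.

Lemma doa_almost_primes n : 0 < n -> doa (almost_primes n) = Some (2 ^ n).
Proof.
move=> n0; apply: doaE; split; [by rewrite expn_gt0|exact: accessible_almost_primes|].
by move=> s _ acc; rewrite leqNgt; apply/negP => /not_accessible.
Qed.

Lemma almost_primes1 : almost_primes 1 = primes_set.
Proof.
apply/seteqP; split=> m.
  move=> [[|p [|q ps]]] [//= _ hps ->]; rewrite big_seq1; apply: hps; exact: mem_head.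
by move=> pm; exists [:: m]; split=> //; [move=> p; rewrite inE => /eqP ->|rewrite big_seq1].
Qed.

End Degree.

Theorem theorem2 :
  (forall n : nat, 1 <= n -> doa (almost_primes n) = Some (2 ^ n)) /\
  (doa primes_set = Some 2 /\ accessible 2 primes_set).
Proof.
split; first exact: doa_almost_primes.
by rewrite -almost_primes1; split; [exact: (@doa_almost_primes 1)|exact: (@accessible_almost_primes 1)].
Qed.
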